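(* Let $\Bbbk$ be a commutative ring, $z,t\in\Bbbk^\times$, and let $f(w)=f_0w^l+f_1w^{l-1}+\cdots+f_l\in\Bbbk[w]$ be a polynomial of degree $l\ge0$ with $f_0=1$ and $f_l=t^2$. There is a unique strict $\Bbbk$-linear monoidal functor $$\Psi_f^\vee:\mathcal{H}eis_{l}(z,t^{-1})\to\mathcal{E}nd_\Bbbk\Big(\bigoplus_{n\ge0}H_n^f\text{-mod}\Big)$$ sending the generating object $\uparrow$ (resp. $\downarrow$) to the additive endofunctor that takes an $H_n^f$-module $M$ to $\operatorname{res}_{n-1}^{n}M$ (resp. $\operatorname{coind}^{n+1}_{n}M$), and the generating morphisms $x,\tau,c,d$ to the natural transformations defined on an $H_n^f$-module $M$ as follows: (a) $\Psi^\vee_f(x)_M:\operatorname{res}^n_{n-1}M\to\operatorname{res}^n_{n-1}M$, $v\mapsto x_nv$; (b) $\Psi^\vee_f(\tau)_M:\operatorname{res}^n_{n-2}M\to\operatorname{res}^n_{n-2}M$, $v\mapsto-\tau_{n-1}^{-1}v$; (c) $\Psi^\vee_f(c)_M:M\to\operatorname{Hom}_{H_{n-1}^f}(H_n^f,\operatorname{res}^n_{n-1}M)$, $v\mapsto(u\mapsto uv)$, i.e. the unit of the canonical adjunction making $(\operatorname{res}_{n-1}^n,\operatorname{coind}_{n-1}^n)$ an adjoint pair; (d) $\Psi^\vee_f(d)_M:\operatorname{res}^{n+1}_n\big(\operatorname{Hom}_{H_n^f}(H_{n+1}^f,M)\big)\to M$, $\theta\mapsto\theta(1)$, i.e. the counit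 of the canonical adjunction making $(\operatorname{res}_n^{n+1},\operatorname{coind}_n^{n+1})$ an adjoint pair.
   Context: $\mathcal{E}nd_\Bbbk(\mathcal C)$ is the strict monoidal category of $\Bbbk$-linear endofunctors of $\mathcal C$ and natural transformations, with tensor product given by composition of functors. In a strict monoidal category, $f\circ g$ means $f$ after $g$; $\mathbf 1$ is the unit object. **Cyclotomic Hecke algebras.** The affine Hecke algebra $AH_n$ is the $\Bbbk$-algebra with generators $x_1^{\pm1},\dots,x_n^{\pm1},\tau_1,\dots,\tau_{n-1}$ and relations: the $x_i$ commute; $\tau_jx_j\tau_j=x_{j+1}$; $\tau_jx_i=x_i\tau_j$ for $i\ne j,j+1$; $\tau_j^2=z\tau_j+1$; $\tau_i\tau_j=\tau_j\tau_i$ for $|i-j|>1$; $\tau_i\tau_{i+1}\tau_i=\tau_{i+1}\tau_i\tau_{i+1}$. $H_n^f$ is the quotient of $AH_n$ by the two-sided ideal generated by $f(x_1)$, with $H_0^f=\Bbbk$. The homomorphism $H_n^f\to H_{n+1}^f$ sending generators to generators of the same name is injective and is used to view $H_n^f\subseteq H_{n+1}^f$. $H_n^f\text{-mod}$ is the category of left modules, $\operatorname{res}_n^{n+1}$ is restriction (restriction of $H_0^f$-modules is zero), and $\operatorname{coind}_n^{n+1}=\operatorname{Hom}_{H_n^f}(H_{n+1}^f,-):H_n^f\text{-mod}\to H_{n+1}^f\text{-mod}$. **Quantum Heisenberg category.** For $k\in\mathbb Z$ and $s\in\Bbbk^\times$, $\mathcal{H}eis_k(z,s)$ is the strict $\Bbbk$-linear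 monoidal category with generating objects $\uparrow,\downarrow$ and the following generating morphisms and relations (here it is used with $k=l$, $s=t^{-1}$). (i) $x:\uparrow\to\uparrow$, invertible, and $\tau:\uparrow\otimes\uparrow\to\uparrow\otimes\uparrow$, with $\tau\circ(1_\uparrow\otimes x)\circ\tau=x\otimes 1_\uparrow$, $\tau\circ\tau=z\tau+1_{\uparrow\otimes\uparrow}$, $(\tau\otimes1_\uparrow)\circ(1_\uparrow\otimes\tau)\circ(\tau\otimes1_\uparrow)=(1_\uparrow\otimes\tau)\circ(\tau\otimes1_\uparrow)\circ(1_\uparrow\otimes\tau)$. (ii) $c:\mathbf 1\to\downarrow\otimes\uparrow$ and $d:\uparrow\otimes\downarrow\to\mathbf 1$ with $(d\otimes1_\uparrow)\circ(1_\uparrow\otimes c)=1_\uparrow$ and $(1_\downarrow\otimes d)\circ(c\otimes1_\downarrow)=1_\downarrow$. (iii) Let $\sigma_+:=(1_\downarrow\otimes1_\uparrow\otimes d)\circ(1_\downarrow\otimes\tau\otimes1_\downarrow)\circ(c\otimes1_\uparrow\otimes1_\downarrow):\uparrow\otimes\downarrow\to\downarrow\otimes\uparrow$. Let $M_k$ be, if $k\ge0$, the column matrix with entries $\sigma_+,\ d\circ(x^{a}\otimes1_\downarrow)\ (a=0,\dots,k-1)$, a morphism $\uparrow\otimes\downarrow\to(\downarrow\otimes\uparrow)\oplus\mathbf 1^{\oplus k}$ in the additive envelope; if $k<0$, the row matrix with entries $\sigma_+,\ (1_\downarrow\otimes x^{a})\circ c\ (a=0,\dots,-k-1)$, a morphism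 $(\uparrow\otimes\downarrow)\oplus\mathbf 1^{\oplus(-k)}\to\downarrow\otimes\uparrow$. Adjoin as generators the entries of a two-sided inverse of $M_k$: this inverse is the row $[L,\eta_0,\dots,\eta_{k-1}]$ if $k\ge0$, and the column with entries $L,\varepsilon_0,\dots,\varepsilon_{-k-1}$ if $k<0$, where $L:\downarrow\otimes\uparrow\to\uparrow\otimes\downarrow$, $\eta_a:\mathbf 1\to\uparrow\otimes\downarrow$, $\varepsilon_a:\downarrow\otimes\uparrow\to\mathbf 1$. (iv) Define $c':\mathbf 1\to\uparrow\otimes\downarrow$ by $c':=-s^{-1}z^{-1}(x^{-1}\otimes1_\downarrow)\circ\eta_{k-1}$ if $k>0$, $c':=s\,L\circ c$ if $k=0$, $c':=s^{-1}L\circ(1_\downarrow\otimes x^{-k})\circ c$ if $k<0$; and $d':\downarrow\otimes\uparrow\to\mathbf 1$ by $d':=s\,d\circ(x^k\otimes1_\downarrow)\circ L$ if $k\ge0$, $d':=-s^{-1}z^{-1}\varepsilon_0$ if $k<0$. Impose: $d\circ c'=sz^{-1}1_{\mathbf 1}$ if $k>0$; $d\circ c'=(sz^{-1}-s^{-1}z^{-1})1_{\mathbf 1}$ if $k=0$; $d'\circ(1_\downarrow\otimes x^{-k})\circ c=sz^{-1}1_{\mathbf 1}$ if $k<0$. *)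

(* Defs.v *)
From HB Require Import structures.
From mathcomp Require Import all_boot all_order all_algebra.
From mathcomp Require Import generic_quotient boolp.

Set Implicit Arguments.
Unset Strict Implicit.
Unset Printing Implicit Defensive.

Import GRing.Theory.
Local Open Scope ring_scope.
Local Open Scope quotient_scope.

(* A unital associative R-algebra.  The library's algType excludes the zero  *)
(* ring, whereas a cyclotomic Hecke algebra of level 0 vanishes for n > 0.   *)
Record ralg (R : comPzRingType) := RAlg {
  ralg_ring :> pzRingType;
  ralg_scal : {rmorphism R -> ralg_ring};
  ralg_scalC : forall a (x : ralg_ring), ralg_scal a * x = x * ralg_scal a
}.

(* Algebras presented by generators and relations: formal expressions in the *)
(* generators modulo the least congruence that contains the relations and    *)
(* the axioms of unital associative R-algebras.                              *)
Inductive aterm (R G : Type) : Type :=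
| AGen of G
| AScal of R
| AAdd of aterm R G & aterm R G
| AMul of aterm R G & aterm R G.

Arguments AGen {R G} _.
Arguments AScal {R G} _.

Section PresentedAlgebra.

Variables (R : comPzRingType) (G : Type).
Variable rel : aterm R G -> aterm R G -> Prop.

Inductive acong : aterm R G -> aterm R G -> Prop :=
| AC_rel s t : rel s t -> acong s t
| AC_refl t : acong t t
| AC_sym s t : acong s t -> acong t s
| AC_trans s t u : acong s t -> acong t u -> acong s u
| AC_add s s' t t' : acong s s' -> acong t t' -> acong (AAdd s t) (AAdd s' t')
| AC_mul s s' t t' : acong s s' -> acong t t' -> acong (AMul s t) (AMul s' t')
| AC_addA s t u : acong (AAdd s (AAdd t u)) (AAdd (AAdd s t) u)
| AC_addC s t : acong (AAdd s t) (AAdd t s)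
| AC_add0 t : acong (AAdd (AScal 0) t) t
| AC_addN t : acong (AAdd (AMul (AScal (-1)) t) t) (AScal 0)
| AC_mulA s t u : acong (AMul s (AMul t u)) (AMul (AMul s t) u)
| AC_mul1 t : acong (AMul (AScal 1) t) t
| AC_mulDl s t u : acong (AMul (AAdd s t) u) (AAdd (AMul s u) (AMul t u))
| AC_mulDr s t u : acong (AMul s (AAdd t u)) (AAdd (AMul s t) (AMul s u))
| AC_scalD a b : acong (AAdd (AScal a) (AScal b)) (AScal (a + b))
| AC_scalM a b : acong (AMul (AScal a) (AScal b)) (AScal (a * b))
| AC_scalC a t : acong (AMul (AScal a) t) (AMul t (AScal a)).

Definition acongb (s t : {classic (aterm R G)}) : bool := `[< acong s t >].

Lemma acongb_refl : reflexive acongb.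
Proof. by move=> t; apply/asboolP; apply: AC_refl. Qed.
Lemma acongb_sym : symmetric acongb.
Proof. by move=> s t; apply/asboolP/asboolP; apply: AC_sym. Qed.
Lemma acongb_trans : transitive acongb.
Proof.
by move=> t s u /asboolP st /asboolP tu; apply/asboolP; apply: AC_trans st tu.
Qed.

Canonical acongb_equiv := EquivRel acongb acongb_refl acongb_sym acongb_trans.

Definition palg_sort : Type := {eq_quot acongb}.
HB.instance Definition _ := Choice.on palg_sort.
HB.instance Definition _ := EqQuotient.on palg_sort.

Definition pclass (t : aterm R G) : palg_sort := \pi_palg_sort (t : {classic (aterm R G)}).
Definition prepr (x : palg_sort) : aterm R G := repr x.

Lemma preprK x : pclass (prepr x) = x. Proof. exact: reprK. Qed.
Lemma pclassP s t : pclass s = pclass t <-> acong s t.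
Proof.
split=> [/eqmodP|st]; first by move=> /asboolP.
by apply/eqmodP/asboolP.
Qed.
Lemma prepr_pclass t : acong (prepr (pclass t)) t.
Proof. by apply/pclassP; rewrite preprK. Qed.

Definition padd x y := pclass (AAdd (prepr x) (prepr y)).
Definition pmul x y := pclass (AMul (prepr x) (prepr y)).
Definition popp x := pclass (AMul (AScal (-1)) (prepr x)).

Lemma paddE s t : padd (pclass s) (pclass t) = pclass (AAdd s t).
Proof. by apply/pclassP/AC_add; apply: prepr_pclass. Qed.
Lemma pmulE s t : pmul (pclass s) (pclass t) = pclass (AMul s t).
Proof. by apply/pclassP/AC_mul; apply: prepr_pclass. Qed.
Lemma poppE t : popp (pclass t) = pclass (AMul (AScal (-1)) t).
Proof. by apply/pclassP/AC_mul; [apply: AC_refl|apply: prepr_pclass]. Qed.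

Lemma paddA : associative padd.
Proof.
move=> x y z; rewrite -[x]preprK -[y]preprK -[z]preprK !paddE.
exact/pclassP/AC_addA.
Qed.
Lemma paddC : commutative padd.
Proof. by move=> x y; apply/pclassP/AC_addC. Qed.
Lemma padd0 : left_id (pclass (AScal 0)) padd.
Proof. by move=> x; rewrite -[x]preprK paddE; apply/pclassP/AC_add0. Qed.
Lemma paddN : left_inverse (pclass (AScal 0)) popp padd.
Proof. by move=> x; rewrite -[x]preprK poppE paddE; apply/pclassP/AC_addN. Qed.
Lemma pmulA : associative pmul.
Proof.
move=> x y z; rewrite -[x]preprK -[y]preprK -[z]preprK !pmulE.
exact/pclassP/AC_mulA.
Qed.
Lemma pmul1 : left_id (pclass (AScal 1)) pmul.
Proof. by move=> x; rewrite -[x]preprK pmulE; apply/pclassP/AC_mul1. Qed.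
Lemma pmulr1 : right_id (pclass (AScal 1)) pmul.
Proof.
move=> x; rewrite -[x]preprK pmulE; apply/pclassP.
exact: AC_trans (AC_sym (AC_scalC _ _)) (AC_mul1 _).
Qed.
Lemma pmulDl : left_distributive pmul padd.
Proof.
move=> x y z; rewrite -[x]preprK -[y]preprK -[z]preprK !(pmulE, paddE).
exact/pclassP/AC_mulDl.
Qed.
Lemma pmulDr : right_distributive pmul padd.
Proof.
move=> x y z; rewrite -[x]preprK -[y]preprK -[z]preprK !(pmulE, paddE).
exact/pclassP/AC_mulDr.
Qed.

HB.instance Definition _ := GRing.isPzRing.Build palg_sort
  paddA paddC padd0 paddN pmulA pmul1 pmulr1 pmulDl pmulDr.

Definition pscal (a : R) : palg_sort := pclass (AScal a).

Lemma pclassD s t : pclass (AAdd s t) = pclass s + pclass t.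
Proof. by rewrite -paddE. Qed.
Lemma pclassM s t : pclass (AMul s t) = pclass s * pclass t.
Proof. by rewrite -pmulE. Qed.

Lemma pscal_zmod_morphism : zmod_morphism pscal.
Proof.
move=> a b; have D c d : pscal (c + d) = pscal c + pscal d.
  by rewrite -pclassD; apply/pclassP/AC_sym/AC_scalD.
by apply: (addIr (pscal b)); rewrite -D subrK subrK.
Qed.
Lemma pscal_monoid_morphism : monoid_morphism pscal.
Proof. by split=> // a b; rewrite -pclassM; apply/pclassP/AC_sym/AC_scalM. Qed.
HB.instance Definition _ :=
  GRing.isZmodMorphism.Build R palg_sort pscal pscal_zmod_morphism.
HB.instance Definition _ :=
  GRing.isMonoidMorphism.Build R palg_sort pscal pscal_monoid_morphism.

Lemma pscalC a (x : palg_sort) : pscal a * x = x * pscal a.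
Proof. by rewrite -[x]preprK -!pclassM; apply/pclassP/AC_scalC. Qed.

Definition palg : ralg R := RAlg pscalC.

Definition pgen (g : G) : palg := pclass (AGen g).

End PresentedAlgebra.

Section Evaluation.

Variables (R : comPzRingType) (G : Type) (A : ralg R) (h : G -> A).

Fixpoint aeval (t : aterm R G) : A :=
  match t with
  | AGen g => h g
  | AScal a => ralg_scal A a
  | AAdd s t => aeval s + aeval t
  | AMul s t => aeval s * aeval t
  end.

Variable rel : aterm R G -> aterm R G -> Prop.

Lemma aeval_acong : (forall s t, rel s t -> aeval s = aeval t) ->
  forall s t, acong rel s t -> aeval s = aeval t.
Proof.
move=> hrel s t; elim=> {s t} //=.
- by move=> s t u _ -> _ ->.
- by move=> s s' t t' _ -> _ ->.
- by move=> s s' t t' _ -> _ ->.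
- by move=> s t u; rewrite addrA.
- by move=> s t; rewrite addrC.
- by move=> t; rewrite rmorph0 add0r.
- by move=> t; rewrite rmorphN1 mulN1r addNr rmorph0.
- by move=> s t u; rewrite mulrA.
- by move=> t; rewrite rmorph1 mul1r.
- by move=> s t u; rewrite mulrDl.
- by move=> s t u; rewrite mulrDr.
- by move=> a b; rewrite rmorphD.
- by move=> a b; rewrite rmorphM.
- by move=> a t; rewrite ralg_scalC.
Qed.

Hypothesis hrel : forall s t, rel s t -> aeval s = aeval t.

Definition plift of (forall s t, rel s t -> aeval s = aeval t) :=
  fun x : palg rel => aeval (prepr x).

Lemma plift_pclass t : plift hrel (pclass rel t) = aeval t.
Proof. exact/(aeval_acong hrel)/prepr_pclass. Qed.

Lemma plift_zmod_morphism : zmod_morphism (plift hrel).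
Proof.
have D x y : plift hrel (x + y) = plift hrel x + plift hrel y.
  by rewrite -[x]preprK -[y]preprK -pclassD !plift_pclass.
by move=> x y; apply: (addIr (plift hrel y)); rewrite -D !subrK.
Qed.

Lemma plift_monoid_morphism : monoid_morphism (plift hrel).
Proof.
split; first by rewrite plift_pclass /= rmorph1.
by move=> x y; rewrite -[x]preprK -[y]preprK -pclassM !plift_pclass.
Qed.

End Evaluation.

HB.instance Definition _ (R : comPzRingType) G (A : ralg R) (h : G -> A)
    (rel : aterm R G -> aterm R G -> Prop)
    (hrel : forall s t, rel s t -> aeval h s = aeval h t) :=
  GRing.isZmodMorphism.Build (palg rel) A (plift hrel) (plift_zmod_morphism hrel).
HB.instance Definition _ (R : comPzRingType) G (A : ralg R) (h : G -> A)
    (rel : aterm R G -> aterm R G -> Prop)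
    (hrel : forall s t, rel s t -> aeval h s = aeval h t) :=
  GRing.isMonoidMorphism.Build (palg rel) A (plift hrel)
    (plift_monoid_morphism hrel).

Lemma aeval_pgen (R : comPzRingType) G (rel : aterm R G -> aterm R G -> Prop) t :
  aeval (pgen rel) t = pclass rel t.
Proof. by elim: t => //= s -> t ->; rewrite ?pclassD ?pclassM. Qed.

(* Indices start at 0: with i : 'I_n and j : 'I_n.-1, [Hx i], [Hxi i] and    *)
(* [Ht j] stand for x_{i+1}, x_{i+1}^-1 and tau_{j+1}.                       *)
Inductive hgen (n : nat) : Type :=
| Hx of 'I_n
| Hxi of 'I_n
| Ht of 'I_n.-1.

Section HeckePresentation.

Variables (R : comNzRingType) (z : R) (f : {poly R}) (n : nat).

Local Notation X i := (AGen (Hx i)).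
Local Notation Xi i := (AGen (Hxi i)).
Local Notation T j := (AGen (@Ht n j)).

Definition apow G (t : aterm R G) (m : nat) : aterm R G :=
  iter m (AMul t) (AScal 1).

Definition apoly G (p : {poly R}) (t : aterm R G) : aterm R G :=
  \big[@AAdd R G/AScal 0]_(i < size p) AMul (AScal p`_i) (apow t i).

Inductive affine_hecke_rel : aterm R (hgen n) -> aterm R (hgen n) -> Prop :=
| AH_xV i : affine_hecke_rel (AMul (X i) (Xi i)) (AScal 1)
| AH_Vx i : affine_hecke_rel (AMul (Xi i) (X i)) (AScal 1)
| AH_xx i i' : affine_hecke_rel (AMul (X i) (X i')) (AMul (X i') (X i))
| AH_txt (j : 'I_n.-1) (i i' : 'I_n) : i = j :> nat -> i' = j.+1 :> nat ->
    affine_hecke_rel (AMul (T j) (AMul (X i) (T j))) (X i')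
| AH_tx (j : 'I_n.-1) (i : 'I_n) : i <> j :> nat -> i <> j.+1 :> nat ->
    affine_hecke_rel (AMul (T j) (X i)) (AMul (X i) (T j))
| AH_tt j :
    affine_hecke_rel (AMul (T j) (T j)) (AAdd (AMul (AScal z) (T j)) (AScal 1))
| AH_ttC (j j' : 'I_n.-1) : (j.+1 < j')%N || (j'.+1 < j)%N ->
    affine_hecke_rel (AMul (T j) (T j')) (AMul (T j') (T j))
| AH_braid (j j' : 'I_n.-1) : j' = j.+1 :> nat ->
    affine_hecke_rel (AMul (T j) (AMul (T j') (T j)))
                     (AMul (T j') (AMul (T j) (T j'))).

(* The quotient of the affine Hecke algebra by the ideal generated by f(x_1) *)
(* is presented by adding the relation f(x_1) = 0.  For n = 0 there are no   *)
(* generators and no relations, so that the algebra is R.                    *)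
Inductive hecke_rel : aterm R (hgen n) -> aterm R (hgen n) -> Prop :=
| H_affine s t : affine_hecke_rel s t -> hecke_rel s t
| H_cyclotomic (i : 'I_n) : i = 0 :> nat -> hecke_rel (apoly f (X i)) (AScal 0).

Definition hecke : ralg R := palg hecke_rel.

Definition hx (i : 'I_n) : hecke := pgen hecke_rel (Hx i).
Definition hxi (i : 'I_n) : hecke := pgen hecke_rel (Hxi i).
Definition ht (j : 'I_n.-1) : hecke := pgen hecke_rel (Ht j).

(* tau^-1 = tau - z, by the quadratic relation; see htK and hKt below.       *)
Definition hti (j : 'I_n.-1) : hecke := ht j - ralg_scal hecke z.

Lemma heckeE s t : hecke_rel s t ->
  aeval (pgen hecke_rel) s = aeval (pgen hecke_rel) t.
Proof. by move=> st; rewrite !aeval_pgen; apply/pclassP/AC_rel. Qed.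
Lemma aheckeE s t : affine_hecke_rel s t ->
  aeval (pgen hecke_rel) s = aeval (pgen hecke_rel) t.
Proof. by move=> st; apply/heckeE/H_affine. Qed.

Lemma hxV i : hx i * hxi i = 1.
Proof. by have := aheckeE (AH_xV i); rewrite /= rmorph1. Qed.
Lemma hVx i : hxi i * hx i = 1.
Proof. by have := aheckeE (AH_Vx i); rewrite /= rmorph1. Qed.
Lemma hxC i i' : hx i * hx i' = hx i' * hx i.
Proof. exact: aheckeE (AH_xx i i'). Qed.
Lemma htxt (j : 'I_n.-1) (i i' : 'I_n) : i = j :> nat -> i' = j.+1 :> nat ->
  ht j * (hx i * ht j) = hx i'.
Proof. by move=> e e'; apply: aheckeE (AH_txt e e'). Qed.
Lemma htx (j : 'I_n.-1) (i : 'I_n) : i <> j :> nat -> i <> j.+1 :> nat ->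
  ht j * hx i = hx i * ht j.
Proof. by move=> e e'; apply: aheckeE (AH_tx e e'). Qed.
Lemma htt j : ht j * ht j = ralg_scal hecke z * ht j + 1.
Proof. by have := aheckeE (AH_tt j); rewrite /= rmorph1. Qed.
Lemma httC (j j' : 'I_n.-1) : (j.+1 < j')%N || (j'.+1 < j)%N ->
  ht j * ht j' = ht j' * ht j.
Proof. by move=> e; apply: aheckeE (AH_ttC e). Qed.
Lemma htbraid (j j' : 'I_n.-1) : j' = j.+1 :> nat ->
  ht j * (ht j' * ht j) = ht j' * (ht j * ht j').
Proof. by move=> e; apply: aheckeE (AH_braid e). Qed.

Lemma htK j : ht j * hti j = 1.
Proof. by rewrite mulrBr htt -ralg_scalC addrC addKr. Qed.
Lemma hKt j : hti j * ht j = 1.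
Proof. by rewrite mulrBl htt addrC addKr. Qed.

Lemma aeval_apoly G (A : ralg R) (h : G -> A) (p : {poly R}) t :
  aeval h (apoly p t) =
    \sum_(i < size p) ralg_scal A p`_i * aeval h t ^+ i.
Proof.
have E m : aeval h (apow t m) = aeval h t ^+ m.
  by elim: m => [|m /= ->]; rewrite /= ?rmorph1 ?exprS.
rewrite /apoly (big_morph (aeval h) (id1 := 0) (op1 := +%R)) //=; last first.
  by rewrite rmorph0.
by apply: eq_bigr => i _; rewrite E.
Qed.

Lemma hcyc (i : 'I_n) : i = 0 :> nat ->
  \sum_(m < size f) ralg_scal hecke f`_m * hx i ^+ m = 0.
Proof.
move=> i0; have := heckeE (H_cyclotomic i0).
by rewrite aeval_apoly /= rmorph0.
Qed.

End HeckePresentation.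

Arguments hecke_rel {R} z f n _ _.

Section HeckeInclusion.

Variables (R : comNzRingType) (z : R) (f : {poly R}) (n : nat).

Definition hgen_widen (g : hgen n) : hgen n.+1 :=
  match g with
  | Hx i => Hx (widen_ord (leqnSn n) i)
  | Hxi i => Hxi (widen_ord (leqnSn n) i)
  | Ht j => @Ht n.+1 (widen_ord (leq_pred n) j)
  end.

Lemma hecke_incl_rel s t : hecke_rel z f n s t ->
  aeval (fun g => pgen (hecke_rel z f n.+1) (hgen_widen g)) s =
  aeval (fun g => pgen (hecke_rel z f n.+1) (hgen_widen g)) t.
Proof.
case=> {s t} [s t|i i0]; last by rewrite aeval_apoly /= rmorph0; apply: hcyc.
case=> //=; rewrite ?rmorph1.
- by move=> i; apply: hxV.
- by move=> i; apply: hVx.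
- by move=> i i'; apply: hxC.
- by move=> j i i' e e'; apply: htxt.
- by move=> j i e e'; apply: htx.
- by move=> j; apply: htt.
- by move=> j j' e; apply: httC.
- by move=> j j' e; apply: htbraid.
Qed.

Definition hecke_incl : {rmorphism hecke z f n -> hecke z f n.+1} :=
  plift hecke_incl_rel.

Lemma hecke_incl_scal a :
  hecke_incl (ralg_scal (hecke z f n) a) = ralg_scal (hecke z f n.+1) a.
Proof. exact: plift_pclass. Qed.

Lemma hecke_incl_gen g :
  hecke_incl (pgen (hecke_rel z f n) g) = pgen (hecke_rel z f n.+1) (hgen_widen g).
Proof. exact: plift_pclass. Qed.

End HeckeInclusion.

(* Hom spaces carry an R-module structure given by this record and not by    *)
(* lmodType: natural transformations between endofunctors of a category of   *)
(* lmodType's do not live in the universe over which lmodType ranges.        *)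
Record rmod (R : comPzRingType) (T : Type) := RMod {
  rm_zero : T;
  rm_opp : T -> T;
  rm_add : T -> T -> T;
  rm_scale : R -> T -> T;
  rm_addA : associative rm_add;
  rm_addC : commutative rm_add;
  rm_add0 : left_id rm_zero rm_add;
  rm_addN : left_inverse rm_zero rm_opp rm_add;
  rm_scaleA : forall a b v, rm_scale a (rm_scale b v) = rm_scale (a * b) v;
  rm_scale1 : left_id 1 rm_scale;
  rm_scaleDr : right_distributive rm_scale rm_add;
  rm_scaleDl : forall v a b,
    rm_scale (a + b) v = rm_add (rm_scale a v) (rm_scale b v)
}.

Record lincat (R : comPzRingType) := LinCat {
  obj :> Type;
  hom : obj -> obj -> Type;
  hom_rmod : forall X Y, rmod R (hom X Y);
  idm : forall X, hom X X;
  comp : forall X Y Z, hom Y Z -> hom X Y -> hom X Z;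
  compA : forall W X Y Z (f : hom Y Z) (g : hom X Y) (h : hom W X),
    comp f (comp g h) = comp (comp f g) h;
  comp1m : forall X Y (f : hom X Y), comp (idm Y) f = f;
  compm1 : forall X Y (f : hom X Y), comp f (idm X) = f;
  compDl : forall X Y Z (f g : hom Y Z) (h : hom X Y),
    comp (rm_add (hom_rmod Y Z) f g) h =
    rm_add (hom_rmod X Z) (comp f h) (comp g h);
  compDr : forall X Y Z (f : hom Y Z) (g h : hom X Y),
    comp f (rm_add (hom_rmod X Y) g h) =
    rm_add (hom_rmod X Z) (comp f g) (comp f h);
  compZl : forall X Y Z a (f : hom Y Z) (h : hom X Y),
    comp (rm_scale (hom_rmod Y Z) a f) h = rm_scale (hom_rmod X Z) a (comp f h);
  compZr : forall X Y Z a (f : hom Y Z) (h : hom X Y),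
    comp f (rm_scale (hom_rmod X Y) a h) = rm_scale (hom_rmod X Z) a (comp f h)
}.

Arguments hom {R l} X Y.
Arguments hom_rmod {R l} X Y.
Arguments idm {R l} X.
Arguments comp {R l X Y Z} f g.

Definition hom0 (R : comPzRingType) (C : lincat R) (X Y : C) : hom X Y :=
  rm_zero (hom_rmod X Y).
Definition homD (R : comPzRingType) (C : lincat R) (X Y : C) (f g : hom X Y) :=
  rm_add (hom_rmod X Y) f g.
Definition homZ (R : comPzRingType) (C : lincat R) (X Y : C) a (f : hom X Y) :=
  rm_scale (hom_rmod X Y) a f.

Arguments hom0 {R C} X Y.

(* A morphism together with its source and target.  Equality of arrows is    *)
(* used to compare morphisms whose sources and targets are equal, but not    *)
(* convertible.                                                              *)
Definition arrow (R : comPzRingType) (C : lincat R) : Type :=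
  {XY : C * C & hom XY.1 XY.2}.
Definition arr (R : comPzRingType) (C : lincat R) (X Y : C) (f : hom X Y) :
  arrow C := existT (fun XY : C * C => hom XY.1 XY.2) (X, Y) f.

Lemma arr_inj (R : comPzRingType) (C : lincat R) (X Y : C) (f g : hom X Y) :
  arr f = arr g -> f = g.
Proof.
move=> e; have := projT2_eq e.
by rewrite (Prop_irrelevance (projT1_eq e) (erefl (X, Y))).
Qed.

Record linfunctor (R : comPzRingType) (C D : lincat R) := LinFunctor {
  fobj :> C -> D;
  fhom : forall X Y : C, hom X Y -> hom (fobj X) (fobj Y);
  fhom1 : forall X, fhom (idm X) = idm (fobj X);
  fhomM : forall X Y Z (f : hom Y Z) (g : hom X Y),
    fhom (comp f g) = comp (fhom f) (fhom g);
  fhomD : forall X Y (f g : hom X Y), fhom (homD f g) = homD (fhom f) (fhom g);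
  fhomZ : forall X Y a (f : hom X Y), fhom (homZ a f) = homZ a (fhom f)
}.

Arguments fhom {R C D} l {X Y} f.

Record nattrans (R : comPzRingType) (C D : lincat R) (F G : linfunctor C D) :=
  NatTrans {
    ncomp :> forall X : C, hom (F X) (G X);
    natural : forall (X Y : C) (f : hom X Y),
      comp (fhom G f) (ncomp X) = comp (ncomp Y) (fhom F f)
  }.

(* The monoidal structure is strict: the associativity and unit constraints  *)
(* are equalities of objects and of arrows.                                  *)
Record smcat (R : comPzRingType) := SMCat {
  sm_cat :> lincat R;
  sm_unit : sm_cat;
  tens : sm_cat -> sm_cat -> sm_cat;
  tensm : forall X Y X' Y' : sm_cat,
    hom X Y -> hom X' Y' -> hom (tens X X') (tens Y Y');
  tens_id : forall X Y, tensm (idm X) (idm Y) = idm (tens X Y);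
  tens_comp : forall X Y Z X' Y' Z' (f : hom Y Z) (g : hom X Y)
      (f' : hom Y' Z') (g' : hom X' Y'),
    tensm (comp f g) (comp f' g') = comp (tensm f f') (tensm g g');
  tensDl : forall X Y X' Y' (f g : hom X Y) (h : hom X' Y'),
    tensm (homD f g) h = homD (tensm f h) (tensm g h);
  tensDr : forall X Y X' Y' (f : hom X Y) (g h : hom X' Y'),
    tensm f (homD g h) = homD (tensm f g) (tensm f h);
  tensZl : forall X Y X' Y' a (f : hom X Y) (g : hom X' Y'),
    tensm (homZ a f) g = homZ a (tensm f g);
  tensZr : forall X Y X' Y' a (f : hom X Y) (g : hom X' Y'),
    tensm f (homZ a g) = homZ a (tensm f g);
  tensA : associative tens;
  tens1o : left_id sm_unit tens;
  tenso1 : right_id sm_unit tens;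
  tensmA : forall X Y X' Y' X'' Y''
      (f : hom X Y) (g : hom X' Y') (h : hom X'' Y''),
    arr (tensm f (tensm g h)) = arr (tensm (tensm f g) h);
  tens1m : forall X Y (f : hom X Y), arr (tensm (idm sm_unit) f) = arr f;
  tensm1 : forall X Y (f : hom X Y), arr (tensm f (idm sm_unit)) = arr f
}.

Arguments tens {R s} X Y.
Arguments tensm {R s X Y X' Y'} f g.

Record smfunctor (R : comPzRingType) (C D : smcat R) := SMFunctor {
  sm_fun :> linfunctor C D;
  sm_fun_unit : sm_fun (sm_unit C) = sm_unit D;
  sm_fun_tens : forall X Y, sm_fun (tens X Y) = tens (sm_fun X) (sm_fun Y);
  sm_fun_tensm : forall X Y X' Y' (f : hom X Y) (g : hom X' Y'),
    arr (fhom sm_fun (tensm f g)) = arr (tensm (fhom sm_fun f) (fhom sm_fun g))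
}.

Section LinCatTheory.

Variables (R : comPzRingType).

Lemma rm_addI T (m : rmod R T) u v w : rm_add m u v = rm_add m u w -> v = w.
Proof.
move=> e; rewrite -(rm_add0 m v) -(rm_add0 m w) -(rm_addN m u).
by rewrite -!rm_addA e.
Qed.

Lemma fhom0 (C D : lincat R) (F : linfunctor C D) (X Y : C) :
  fhom F (hom0 X Y) = hom0 (F X) (F Y).
Proof.
apply: (@rm_addI _ (hom_rmod _ _) (fhom F (hom0 X Y))).
rewrite -[LHS]fhomD /homD rm_add0 rm_addC; exact/esym/rm_add0.
Qed.

Lemma nattrans_eq (C D : lincat R) (F G : linfunctor C D) (a b : nattrans F G) :
  (forall X, a X = b X) -> a = b.
Proof.
case: a b => [a an] [b bn] /= ab.
have e : a = b by apply: functional_extensionality_dep.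
by case: _ / e bn => bn; congr NatTrans; apply: Prop_irrelevance.
Qed.

Definition idfunctor (C : lincat R) : linfunctor C C :=
  @LinFunctor R C C id (fun _ _ f => f) (fun=> erefl) (fun _ _ _ _ _ => erefl)
    (fun _ _ _ _ => erefl) (fun _ _ _ _ => erefl).

Section Composition.

Variables (C D E : lincat R) (F : linfunctor D E) (G : linfunctor C D).

Lemma funcomp1 (X : C) : fhom F (fhom G (idm X)) = idm (F (G X)).
Proof. by rewrite !fhom1. Qed.
Lemma funcompM (X Y Z : C) (f : hom Y Z) (g : hom X Y) :
  fhom F (fhom G (comp f g)) = comp (fhom F (fhom G f)) (fhom F (fhom G g)).
Proof. by rewrite !fhomM. Qed.
Lemma funcompD (X Y : C) (f g : hom X Y) :
  fhom F (fhom G (homD f g)) = homD (fhom F (fhom G f)) (fhom F (fhom G g)).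
Proof. by rewrite !fhomD. Qed.
Lemma funcompZ (X Y : C) a (f : hom X Y) :
  fhom F (fhom G (homZ a f)) = homZ a (fhom F (fhom G f)).
Proof. by rewrite !fhomZ. Qed.

Definition funcomp : linfunctor C E :=
  @LinFunctor R C E (fun X => F (G X)) (fun X Y f => fhom F (fhom G f))
    funcomp1 funcompM funcompD funcompZ.

End Composition.

End LinCatTheory.

Lemma LinFunctor_eq (R : comPzRingType) (C D : lincat R) fo fh p q r s p' q' r' s' :
  @LinFunctor R C D fo fh p q r s = @LinFunctor R C D fo fh p' q' r' s'.
Proof. by congr LinFunctor; apply: Prop_irrelevance. Qed.

Section EndCat.

Variables (R : comPzRingType) (C : lincat R).

Implicit Types F G H : linfunctor C C.

Section NatOperations.

Variables (F G : linfunctor C C).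

Lemma nat0_natural (X Y : C) (f : hom X Y) :
  comp (fhom G f) (hom0 (F X) (G X)) = comp (hom0 (F Y) (G Y)) (fhom F f).
Proof.
have c0 : comp (fhom G f) (hom0 (F X) (G X)) = hom0 _ _.
  apply: (@rm_addI _ _ (hom_rmod _ _) (comp (fhom G f) (hom0 (F X) (G X)))).
  by rewrite -compDr rm_add0 rm_addC; apply/esym/rm_add0.
rewrite c0.
apply: (@rm_addI _ _ (hom_rmod _ _) (comp (hom0 (F Y) (G Y)) (fhom F f))).
by rewrite -compDl rm_add0 rm_addC; apply: rm_add0.
Qed.
Definition nat0 := NatTrans nat0_natural.

Lemma natD_natural (a b : nattrans F G) (X Y : C) (f : hom X Y) :
  comp (fhom G f) (homD (a X) (b X)) = comp (homD (a Y) (b Y)) (fhom F f).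
Proof. by rewrite compDr compDl !natural. Qed.
Definition natD a b := NatTrans (natD_natural a b).

Lemma natZ_natural c (a : nattrans F G) (X Y : C) (f : hom X Y) :
  comp (fhom G f) (homZ c (a X)) = comp (homZ c (a Y)) (fhom F f).
Proof. by rewrite compZr compZl !natural. Qed.
Definition natZ c a := NatTrans (natZ_natural c a).

Lemma homZN1 (X Y : C) (f : hom X Y) :
  homD (homZ (-1) f) f = hom0 X Y.
Proof.
have z0 : homZ 0 f = hom0 X Y.
  apply: (@rm_addI _ _ (hom_rmod _ _) (homZ 0 f)).
  by rewrite -[LHS]rm_scaleDl addr0 rm_addC rm_add0.
by rewrite -{2}[f](rm_scale1 (hom_rmod X Y)) -[LHS]rm_scaleDl addNr.
Qed.

Lemma natDA : associative natD.
Proof. by move=> a b c; apply: nattrans_eq => X; apply: rm_addA. Qed.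
Lemma natDC : commutative natD.
Proof. by move=> a b; apply: nattrans_eq => X; apply: rm_addC. Qed.
Lemma natD0 : left_id nat0 natD.
Proof. by move=> a; apply: nattrans_eq => X; apply: rm_add0. Qed.
Lemma natDN : left_inverse nat0 (natZ (-1)) natD.
Proof. by move=> a; apply: nattrans_eq => X; apply: homZN1. Qed.
Lemma natZA a b v : natZ a (natZ b v) = natZ (a * b) v.
Proof. by apply: nattrans_eq => X; apply: rm_scaleA. Qed.
Lemma natZ1 : left_id 1 natZ.
Proof. by move=> a; apply: nattrans_eq => X; apply: rm_scale1. Qed.
Lemma natZDr : right_distributive natZ natD.
Proof. by move=> a b c; apply: nattrans_eq => X; apply: rm_scaleDr. Qed.
Lemma natZDl v a b : natZ (a + b) v = natD (natZ a v) (natZ b v).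
Proof. by apply: nattrans_eq => X; apply: rm_scaleDl. Qed.

Definition nattrans_rmod : rmod R (nattrans F G) :=
  RMod natDA natDC natD0 natDN natZA natZ1 natZDr natZDl.

End NatOperations.

Definition nat1 F : nattrans F F.
Proof.
by exists (fun X => idm (F X)) => X Y f; rewrite compm1 comp1m.
Defined.

Section VerticalComposition.

Variables (F G H : linfunctor C C) (a : nattrans G H) (b : nattrans F G).

Lemma natM_natural (X Y : C) (f : hom X Y) :
  comp (fhom H f) (comp (a X) (b X)) = comp (comp (a Y) (b Y)) (fhom F f).
Proof. by rewrite compA natural -compA natural compA. Qed.
Definition natM := NatTrans natM_natural.

End VerticalComposition.

Section HorizontalComposition.

Variables (F G F' G' : linfunctor C C) (a : nattrans F G) (b : nattrans F' G').

Lemma natT_natural (X Y : C) (f : hom X Y) :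
  comp (fhom (funcomp G G') f) (comp (a (G' X)) (fhom F (b X))) =
  comp (comp (a (G' Y)) (fhom F (b Y))) (fhom (funcomp F F') f).
Proof. by rewrite /= compA (natural a) -compA -fhomM natural fhomM compA. Qed.
Definition natT : nattrans (funcomp F F') (funcomp G G') :=
  @NatTrans R C C (funcomp F F') (funcomp G G')
    (fun X => comp (a (G' X)) (fhom F (b X))) natT_natural.

End HorizontalComposition.

Definition endcat_lin : lincat R.
Proof.
refine (@LinCat R (linfunctor C C) (@nattrans R C C) nattrans_rmod nat1 natM
          _ _ _ _ _ _ _).
- by move=> F G H K a b c; apply: nattrans_eq => X; apply: compA.
- by move=> F G a; apply: nattrans_eq => X; apply: comp1m.
- by move=> F G a; apply: nattrans_eq => X; apply: compm1.
- by move=> F G H a b c; apply: nattrans_eq => X; apply: compDl.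
- by move=> F G H a b c; apply: nattrans_eq => X; apply: compDr.
- by move=> F G H c a b; apply: nattrans_eq => X; apply: compZl.
- by move=> F G H c a b; apply: nattrans_eq => X; apply: compZr.
Defined.

Lemma endcat_arr (F G F' G' : endcat_lin) (a : hom F G) (b : hom F' G') :
  F = F' -> G = G' ->
  (forall X, arr (ncomp a X) = arr (ncomp b X)) -> arr a = arr b.
Proof.
move=> eF eG; case: _ / eF b => b; case: _ / eG b => b ab.
by congr arr; apply: nattrans_eq => X; apply: arr_inj.
Qed.

Lemma funcompA : associative (@funcomp R C C C).
Proof. by move=> F G H; apply: LinFunctor_eq. Qed.
Lemma funcomp1F : left_id (idfunctor C) (@funcomp R C C C).
Proof. by case=> *; apply: LinFunctor_eq. Qed.
Lemma funcompF1 : right_id (idfunctor C) (@funcomp R C C C).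
Proof. by case=> *; apply: LinFunctor_eq. Qed.

(* The tensor product F (x) G is the functor F after G. *)
Definition endcat : smcat R.
Proof.
refine (@SMCat R endcat_lin (idfunctor C) (@funcomp R C C C) natT
          _ _ _ _ _ _ funcompA funcomp1F funcompF1 _ _ _).
- by move=> F G; apply: nattrans_eq => X /=; rewrite comp1m fhom1.
- move=> F G H F' G' H' a b a' b'; apply: nattrans_eq => X /=.
  by rewrite fhomM -!compA; congr (comp _ _); rewrite !compA natural.
- by move=> F G F' G' a b c; apply: nattrans_eq => X; apply: compDl.
- move=> F G F' G' a b c; apply: nattrans_eq => X /=.
  by rewrite fhomD; apply: compDr.
- by move=> F G F' G' c a b; apply: nattrans_eq => X; apply: compZl.
- move=> F G F' G' c a b; apply: nattrans_eq => X /=.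
  by rewrite fhomZ; apply: compZr.
- move=> F G F' G' F'' G'' a b c.
  apply: endcat_arr; [exact: funcompA|exact: funcompA|move=> X /=].
  by rewrite fhomM compA.
- move=> F G a; apply: endcat_arr; [exact: funcomp1F|exact: funcomp1F|].
  by move=> X /=; rewrite comp1m.
- move=> F G a; apply: endcat_arr; [exact: funcompF1|exact: funcompF1|].
  by move=> X /=; rewrite fhom1 compm1.
Defined.

End EndCat.

Section DirectSum.

Variables (R : comPzRingType) (C : nat -> lincat R).

(* Families of objects almost all of which are zero objects; in a linear     *)
(* category an object is zero when its identity morphism is zero.            *)
Record dsum_obj := DSumObj {
  dfam :> forall n, C n;
  dfin : exists N, forall n, (N <= n)%N -> idm (dfam n) = hom0 (dfam n) (dfam n)
}.

Definition dsum_hom (X Y : dsum_obj) : Type := forall n, hom (X n) (Y n).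

Lemma dsum_hom_eq X Y (f g : dsum_hom X Y) : (forall n, f n = g n) -> f = g.
Proof. exact: functional_extensionality_dep. Qed.

Definition dsum_rmod X Y : rmod R (dsum_hom X Y).
Proof.
refine (@RMod R _ (fun=> hom0 _ _) (fun f n => rm_opp (hom_rmod _ _) (f n))
          (fun f g n => homD (f n) (g n)) (fun a f n => homZ a (f n))
          _ _ _ _ _ _ _ _).
- by move=> f g h; apply: dsum_hom_eq => n; apply: rm_addA.
- by move=> f g; apply: dsum_hom_eq => n; apply: rm_addC.
- by move=> f; apply: dsum_hom_eq => n; apply: rm_add0.
- by move=> f; apply: dsum_hom_eq => n; apply: rm_addN.
- by move=> a b f; apply: dsum_hom_eq => n; apply: rm_scaleA.
- by move=> f; apply: dsum_hom_eq => n; apply: rm_scale1.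
- by move=> a f g; apply: dsum_hom_eq => n; apply: rm_scaleDr.
- by move=> f a b; apply: dsum_hom_eq => n; apply: rm_scaleDl.
Defined.

Definition dsum : lincat R.
Proof.
refine (@LinCat R dsum_obj dsum_hom dsum_rmod (fun X n => idm (X n))
          (fun X Y Z f g n => comp (f n) (g n)) _ _ _ _ _ _ _).
- by move=> *; apply: dsum_hom_eq => n; apply: compA.
- by move=> *; apply: dsum_hom_eq => n; apply: comp1m.
- by move=> *; apply: dsum_hom_eq => n; apply: compm1.
- by move=> *; apply: dsum_hom_eq => n; apply: compDl.
- by move=> *; apply: dsum_hom_eq => n; apply: compDr.
- by move=> *; apply: dsum_hom_eq => n; apply: compZl.
- by move=> *; apply: dsum_hom_eq => n; apply: compZr.
Defined.

End DirectSum.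

(* Functors F n : C n.+1 -> C n induce an endofunctor of the direct sum that *)
(* vanishes on the summand C 0; functors F n : C n -> C n.+1 induce one whose *)
(* values have the zero object Z in degree 0.                                *)
Section DSumLower.

Variables (R : comPzRingType) (C : nat -> lincat R).
Variable F : forall n, linfunctor (C n.+1) (C n).

Lemma lower_fin (X : dsum C) : exists N, forall n, (N <= n)%N ->
  idm (F n (X n.+1)) = hom0 (F n (X n.+1)) (F n (X n.+1)).
Proof.
case: X => X [N XN] /=; exists N => n Nn.
by rewrite -fhom1 XN ?fhom0 // (leq_trans Nn).
Qed.

Definition lower_obj (X : dsum C) : dsum C := DSumObj (lower_fin X).

Definition dsum_lower : linfunctor (dsum C) (dsum C).
Proof.
refine (@LinFunctor R (dsum C) (dsum C) lower_obj
          (fun X Y f n => fhom (F n) (f n.+1)) _ _ _ _).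
- by move=> X; apply: dsum_hom_eq => n; apply: fhom1.
- by move=> X Y Z f g; apply: dsum_hom_eq => n; apply: fhomM.
- by move=> X Y f g; apply: dsum_hom_eq => n; apply: fhomD.
- by move=> X Y a f; apply: dsum_hom_eq => n; apply: fhomZ.
Defined.

End DSumLower.

Section DSumRaise.

Variables (R : comPzRingType) (C : nat -> lincat R).
Variables (Z : C 0%N) (Z0 : idm Z = hom0 Z Z).
Variable F : forall n, linfunctor (C n) (C n.+1).

Definition raise_fam (X : dsum C) (n : nat) : C n :=
  match n with
  | 0 => Z
  | m.+1 => F m (X m)
  end.

Lemma raise_fin (X : dsum C) : exists N, forall n, (N <= n)%N ->
  idm (raise_fam X n) = hom0 (raise_fam X n) (raise_fam X n).
Proof.
case: X => X [N XN]; exists N.+1 => -[|n] //= Nn.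
by rewrite -fhom1 XN ?fhom0.
Qed.

Definition raise_obj (X : dsum C) : dsum C := DSumObj (raise_fin X).

Definition raise_hom (X Y : dsum C) (f : hom X Y) (n : nat) :
    hom (raise_fam X n) (raise_fam Y n) :=
  match n with
  | 0 => idm Z
  | m.+1 => fhom (F m) (f m)
  end.

Definition dsum_raise : linfunctor (dsum C) (dsum C).
Proof.
refine (@LinFunctor R (dsum C) (dsum C) raise_obj raise_hom _ _ _ _).
- by move=> X; apply: dsum_hom_eq => -[|n] //; apply: fhom1.
- move=> X Y W f g; apply: dsum_hom_eq => -[|n]; first exact/esym/comp1m.
  exact: fhomM.
- move=> X Y f g; apply: dsum_hom_eq => -[|n]; last exact: fhomD.
  by change (idm Z = homD (idm Z) (idm Z)); rewrite Z0; apply/esym/rm_add0.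
- move=> X Y a f; apply: dsum_hom_eq => -[|n]; last exact: fhomZ.
  change (idm Z = homZ a (idm Z)); rewrite Z0.
  apply/esym/(@rm_addI _ _ (hom_rmod Z Z) (homZ a (hom0 Z Z))).
  by rewrite -[LHS]rm_scaleDr rm_add0 rm_addC rm_add0.
Defined.

End DSumRaise.

Lemma linear_fun_eq (A : pzRingType) (M N : lmodType A) (f g : {linear M -> N}) :
  (forall v, f v = g v) -> f = g.
Proof.
case: f g => [f [[fa] [fs]]] [g [[ga] [gs]]] /= fg.
have e : f = g by apply: functional_extensionality_dep.
case: _ / e ga gs => ga gs.
by rewrite (Prop_irrelevance fa ga) (Prop_irrelevance fs gs).
Qed.

Section ModuleCategory.

Variables (R : comPzRingType) (A : ralg R).

Definition lin_scale_fun (M N : lmodType A) (a : R) (f : M -> N) : M -> N :=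
  fun v => ralg_scal A a *: f v.

Section LinScale.
Variables (M N : lmodType A) (a : R) (f : {linear M -> N}).
Lemma lin_scale_is_linear : linear (lin_scale_fun a f).
Proof.
move=> b u v; rewrite /lin_scale_fun linearP scalerDr !scalerA.
by rewrite ralg_scalC.
Qed.
HB.instance Definition _ :=
  GRing.isLinear.Build A M N *:%R (lin_scale_fun a f) lin_scale_is_linear.
Definition lin_scale : {linear M -> N} := lin_scale_fun a f.
End LinScale.

Definition lin_rmod (M N : lmodType A) : rmod R {linear M -> N}.
Proof.
refine (@RMod R _ (\0 : {linear M -> N}) (fun f => \- f : {linear M -> N})
          (fun f g => f \+ g : {linear M -> N}) (@lin_scale M N)
          _ _ _ _ _ _ _ _).
- by move=> f g h; apply: linear_fun_eq => v; apply: addrA.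
- by move=> f g; apply: linear_fun_eq => v; apply: addrC.
- by move=> f; apply: linear_fun_eq => v; apply: add0r.
- by move=> f; apply: linear_fun_eq => v; apply: addNr.
- move=> a b f; apply: linear_fun_eq => v /=.
  by rewrite /lin_scale_fun /= /lin_scale_fun scalerA rmorphM.
- move=> f; apply: linear_fun_eq => v /=.
  by rewrite /lin_scale_fun /= rmorph1 scale1r.
- move=> a f g; apply: linear_fun_eq => v /=.
  by rewrite /lin_scale_fun /= scalerDr.
- move=> f a b; apply: linear_fun_eq => v /=.
  by rewrite /lin_scale_fun /= rmorphD scalerDl.
Defined.

Definition modcat : lincat R.
Proof.
refine (@LinCat R (lmodType A) (fun M N => {linear M -> N}) lin_rmod
          (fun M => idfun : {linear M -> M})
          (fun M N P f g => f \o g : {linear M -> P}) _ _ _ _ _ _ _).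
- by move=> *; apply: linear_fun_eq.
- by move=> *; apply: linear_fun_eq.
- by move=> *; apply: linear_fun_eq.
- by move=> *; apply: linear_fun_eq.
- by move=> *; apply: linear_fun_eq => v; apply: raddfD.
- by move=> *; apply: linear_fun_eq.
- by move=> *; apply: linear_fun_eq => v; apply: linearZZ.
Defined.

End ModuleCategory.

Section Restriction.

Variables (A B : pzRingType) (phi : {rmorphism A -> B}).

Definition res_sort (phi : {rmorphism A -> B}) (M : lmodType B) : Type := M.

Section Res.
Variable M : lmodType B.
HB.instance Definition _ := GRing.Zmodule.on (res_sort phi M).
Definition res_scale (a : A) (v : res_sort phi M) : res_sort phi M :=
  phi a *: (v : M).
Lemma res_scaleA a b v : res_scale a (res_scale b v) = res_scale (a * b) v.
Proof. by rewrite /res_scale scalerA rmorphM. Qed.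
Lemma res_scale1 : left_id 1 res_scale.
Proof. by move=> v; rewrite /res_scale rmorph1 scale1r. Qed.
Lemma res_scaleDr : right_distributive res_scale +%R.
Proof. by move=> a u v; apply: scalerDr. Qed.
Lemma res_scaleDl v : {morph res_scale^~ v : a b / a + b}.
Proof. by move=> a b; rewrite /res_scale rmorphD scalerDl. Qed.
HB.instance Definition _ := GRing.Zmodule_isLmodule.Build A (res_sort phi M)
  res_scaleA res_scale1 res_scaleDr res_scaleDl.
End Res.

Definition res (M : lmodType B) : lmodType A := res_sort phi M.

Section ResMap.
Variables (M N : lmodType B) (f : {linear M -> N}).
Definition res_map_fun (v : res M) : res N := f v.
Lemma res_map_is_linear : linear res_map_fun.
Proof. by move=> a u v; apply: (linearP f). Qed.
HB.instance Definition _ :=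
  GRing.isLinear.Build A (res M) (res N) *:%R res_map_fun res_map_is_linear.
Definition res_map : {linear res M -> res N} := res_map_fun.
End ResMap.

End Restriction.

Section Coinduction.

Variables (A B : pzRingType) (phi : {rmorphism A -> B}).

(* Hom_A(B, M), where A acts on B by left multiplication through phi.        *)
Definition coind_sort (phi : {rmorphism A -> B}) (M : lmodType A) : Type :=
  {linear res phi B^o -> M}.

Section Coind.
Variable M : lmodType A.

HB.instance Definition _ := gen_eqMixin (coind_sort phi M).
HB.instance Definition _ := gen_choiceMixin (coind_sort phi M).

Let cadd (f g : coind_sort phi M) : coind_sort phi M :=
  f \+ g : {linear res phi B^o -> M}.
Let copp (f : coind_sort phi M) : coind_sort phi M :=
  \- f : {linear res phi B^o -> M}.
Let czero : coind_sort phi M := \0 : {linear res phi B^o -> M}.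

Lemma coind_addA : associative cadd.
Proof. by move=> f g h; apply: linear_fun_eq => u; apply: addrA. Qed.
Lemma coind_addC : commutative cadd.
Proof. by move=> f g; apply: linear_fun_eq => u; apply: addrC. Qed.
Lemma coind_add0 : left_id czero cadd.
Proof. by move=> f; apply: linear_fun_eq => u; apply: add0r. Qed.
Lemma coind_addN : left_inverse czero copp cadd.
Proof. by move=> f; apply: linear_fun_eq => u; apply: addNr. Qed.
HB.instance Definition _ := GRing.isZmodule.Build (coind_sort phi M)
  coind_addA coind_addC coind_add0 coind_addN.

Definition coind_act_fun (b : B) (f : coind_sort phi M) (u : res phi B^o) : M :=
  f ((u : B) * b : B).
Lemma coind_act_is_linear b f : linear (coind_act_fun b f).
Proof.
move=> a u v; rewrite /coind_act_fun -linearP; congr (GRing.Linear.sort f _).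
by rewrite mulrDl; congr (_ + _); apply/esym/mulrA.
Qed.
HB.instance Definition _ b f := GRing.isLinear.Build A (res phi B^o) M *:%R
  (coind_act_fun b f) (coind_act_is_linear b f).
Definition coind_act (b : B) (f : coind_sort phi M) : coind_sort phi M :=
  coind_act_fun b f : {linear res phi B^o -> M}.

Lemma coind_actA a b v : coind_act a (coind_act b v) = coind_act (a * b) v.
Proof. by apply: linear_fun_eq => u /=; rewrite /coind_act_fun /= /coind_act_fun mulrA. Qed.
Lemma coind_act1 : left_id 1 coind_act.
Proof. by move=> f; apply: linear_fun_eq => u /=; rewrite /coind_act_fun mulr1. Qed.
Lemma coind_actDr : right_distributive coind_act +%R.
Proof. by move=> b f g; apply: linear_fun_eq => u. Qed.
Lemma coind_actDl f : {morph coind_act^~ f : a b / a + b}.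
Proof.
move=> a b; apply: linear_fun_eq => u /=; rewrite /coind_act_fun mulrDr.
exact: (raddfD f).
Qed.
HB.instance Definition _ := GRing.Zmodule_isLmodule.Build B (coind_sort phi M)
  coind_actA coind_act1 coind_actDr coind_actDl.

End Coind.

Definition coind (M : lmodType A) : lmodType B := coind_sort phi M.

Section CoindMap.
Variables (M N : lmodType A) (f : {linear M -> N}).
Definition coind_map_fun (g : coind M) : coind N :=
  (f \o (g : {linear res phi B^o -> M})) : {linear res phi B^o -> N}.
Lemma coind_map_is_linear : linear coind_map_fun.
Proof. by move=> b g h; apply: linear_fun_eq => u; apply: raddfD. Qed.
HB.instance Definition _ := GRing.isLinear.Build B (coind M) (coind N) *:%R
  coind_map_fun coind_map_is_linear.
Definition coind_map : {linear coind M -> coind N} := coind_map_fun.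
End CoindMap.

Section Unit.
Variable M : lmodType B.
Definition coind_unit_at_fun (v : M) (u : res phi B^o) : res phi M :=
  (u : B) *: v.
Lemma coind_unit_at_is_linear v : linear (coind_unit_at_fun v).
Proof.
move=> a u w; rewrite /coind_unit_at_fun scalerDl; congr (_ + _).
exact/esym/(scalerA (phi a) (u : B) v).
Qed.
HB.instance Definition _ v := GRing.isLinear.Build A (res phi B^o) (res phi M)
  *:%R (coind_unit_at_fun v) (coind_unit_at_is_linear v).
Definition coind_unit_fun (v : M) : coind (res phi M) :=
  coind_unit_at_fun v : {linear res phi B^o -> res phi M}.
Lemma coind_unit_is_linear : linear coind_unit_fun.
Proof.
move=> b v w; apply: linear_fun_eq => u; rewrite /= /coind_unit_at_fun scalerDr.
by congr (_ + _); exact: (scalerA (u : B) b v).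
Qed.
HB.instance Definition _ := GRing.isLinear.Build B M (coind (res phi M)) *:%R
  coind_unit_fun coind_unit_is_linear.
Definition coind_unit : {linear M -> coind (res phi M)} := coind_unit_fun.
End Unit.

Section Counit.
Variable M : lmodType A.
Definition coind_counit_fun (g : res phi (coind M)) : M :=
  (g : {linear res phi B^o -> M}) (1 : B).
Lemma coind_counit_is_linear : linear coind_counit_fun.
Proof.
move=> a g h; rewrite /coind_counit_fun /=; congr (_ + _).
rewrite /coind_act_fun mul1r -linearZZ; congr (GRing.Linear.sort g _).
exact/esym/mulr1.
Qed.
HB.instance Definition _ := GRing.isLinear.Build A (res phi (coind M)) M *:%R
  coind_counit_fun coind_counit_is_linear.
Definition coind_counit : {linear res phi (coind M) -> M} := coind_counit_fun.
End Counit.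

End Coinduction.

Section ResCoindFunctors.

Variables (R : comPzRingType) (A B : ralg R) (phi : {rmorphism A -> B}).
Hypothesis phiS : forall a, phi (ralg_scal A a) = ralg_scal B a.

Definition res_functor : linfunctor (modcat B) (modcat A).
Proof.
refine (@LinFunctor R (modcat B) (modcat A) (res phi)
          (fun M N f => res_map phi f) _ _ _ _).
- by move=> *; apply: linear_fun_eq.
- by move=> *; apply: linear_fun_eq.
- by move=> *; apply: linear_fun_eq.
- move=> M N a f; apply: linear_fun_eq => v /=; rewrite /lin_scale_fun.
  by rewrite /res_map_fun /= /lin_scale_fun -phiS.
Defined.

Definition coind_functor : linfunctor (modcat A) (modcat B).
Proof.
refine (@LinFunctor R (modcat A) (modcat B) (coind phi)
          (fun M N f => coind_map phi f) _ _ _ _).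
- by move=> *; apply: linear_fun_eq => g; apply: linear_fun_eq.
- by move=> *; apply: linear_fun_eq => g; apply: linear_fun_eq.
- by move=> *; apply: linear_fun_eq => g; apply: linear_fun_eq.
- move=> M N a f; apply: linear_fun_eq => g; apply: linear_fun_eq => u /=.
  set h : {linear res phi B^o -> M} := g.
  change (ralg_scal A a *: f (h u) = f (h ((u : B) * ralg_scal B a))).
  rewrite -ralg_scalC -phiS -linearZZ; congr (f _).
  exact/esym/(linearZZ h (ralg_scal A a) u).
Defined.

End ResCoindFunctors.

Lemma palg_centralizes (R : comPzRingType) (G : Type)
    (rel : aterm R G -> aterm R G -> Prop) (A : ralg R)
    (psi : {rmorphism palg rel -> A}) (x : A) :
  (forall a, psi (ralg_scal (palg rel) a) = ralg_scal A a) ->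
  (forall g, x * psi (pgen rel g) = psi (pgen rel g) * x) ->
  forall y, x * psi y = psi y * x.
Proof.
move=> psiS xg y; rewrite -[y]preprK -aeval_pgen.
elim: (prepr y) => //= [a|s IHs t IHt|s IHs t IHt].
- by rewrite psiS ralg_scalC.
- by rewrite rmorphD mulrDl mulrDr IHs IHt.
- by rewrite rmorphM mulrA IHs -mulrA IHt mulrA.
Qed.

Section HeckeCommutation.

Variables (R : comNzRingType) (z : R) (f : {poly R}) (n : nat).

Lemma hx_hxi_comm m (i : 'I_m) (y : hecke z f m) :
  y * hx z f i = hx z f i * y -> y * hxi z f i = hxi z f i * y.
Proof.
move=> yx; rewrite -[LHS]mul1r -(hVx z f i) -mulrA (mulrA _ y) -yx.
by rewrite -!mulrA hxV mulr1.
Qed.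

Lemma hx_last_comm (a : hecke z f n) :
  hx z f (ord_max : 'I_n.+1) * hecke_incl z f n a =
  hecke_incl z f n a * hx z f ord_max.
Proof.
apply: palg_centralizes a => [a|g]; first exact: hecke_incl_scal.
rewrite hecke_incl_gen; case: g => [i|i|j].
- exact: hxC.
- exact/hx_hxi_comm/hxC.
- have jn : (j.+1 < n)%N by rewrite -ltn_predRL.
  apply/esym/htx => /= e; first by move: jn; rewrite -e ltnNge leqW.
  by move: jn; rewrite -e ltnn.
Qed.

Lemma ht_last_comm (a : hecke z f n) :
  @ht R z f n.+2 ord_max * hecke_incl z f n.+1 (hecke_incl z f n a) =
  hecke_incl z f n.+1 (hecke_incl z f n a) * @ht R z f n.+2 ord_max.
Proof.
apply: (@palg_centralizes _ _ _ _ (hecke_incl z f n.+1 \o hecke_incl z f n)) a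
  => [a|g] /=; first by rewrite !hecke_incl_scal.
have hx_comm (i : 'I_n) : @ht R z f n.+2 ord_max *
    hx z f (widen_ord (leqnSn n.+1) (widen_ord (leqnSn n) i)) =
    hx z f (widen_ord (leqnSn n.+1) (widen_ord (leqnSn n) i)) *
    @ht R z f n.+2 ord_max.
  have ni := ltn_ord i.
  apply: htx => /= e; first by rewrite e ltnn in ni.
  by rewrite e ltnNge leqnSn in ni.
rewrite !hecke_incl_gen; case: g => [i|i|j] /=.
- exact: hx_comm.
- exact/hx_hxi_comm/hx_comm.
- by apply/httC/orP; right; rewrite /= -ltn_predRL.
Qed.

Lemma hti_last_comm (a : hecke z f n) :
  @hti R z f n.+2 ord_max * hecke_incl z f n.+1 (hecke_incl z f n a) =
  hecke_incl z f n.+1 (hecke_incl z f n a) * @hti R z f n.+2 ord_max.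
Proof. by rewrite mulrBl mulrBr ht_last_comm ralg_scalC. Qed.

End HeckeCommutation.

Section HeckeAction.

Variables (R : comNzRingType) (z : R) (f : {poly R}).

Local Notation H n := (hecke z f n).
Local Notation incl n := (hecke_incl z f n).

Definition hmod (n : nat) : lincat R := modcat (H n).

Definition hmods : lincat R := dsum hmod.

Definition res_n n : linfunctor (hmod n.+1) (hmod n) :=
  res_functor (@hecke_incl_scal R z f n).
Definition coind_n n : linfunctor (hmod n) (hmod n.+1) :=
  coind_functor (@hecke_incl_scal R z f n).

Definition zero_hmod : hmod 0 := 'rV[H 0]_0.
Lemma zero_hmodP : idm zero_hmod = hom0 zero_hmod zero_hmod.
Proof. by apply: linear_fun_eq => v; rewrite [v]thinmx0 [RHS]thinmx0. Qed.

Definition res_endo : endcat hmods := dsum_lower res_n.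
Definition coind_endo : endcat hmods := dsum_raise zero_hmodP coind_n.

(* The component in degree n of the image of a family M under res_endo is    *)
(* res (M n.+1), on which x_{n+1} acts; likewise tau_{n+1}^-1 acts on        *)
(* res (res (M n.+2)).                                                       *)
Section ActX.
Variables (n : nat) (M : hmod n.+1).
Definition act_x_fun (v : res (incl n) M) : res (incl n) M :=
  hx z f (ord_max : 'I_n.+1) *: (v : M).
Lemma act_x_is_linear : linear act_x_fun.
Proof.
move=> a u v; rewrite /act_x_fun scalerDr; congr (_ + _).
rewrite /GRing.scale /= /res_scale -[LHS]/(_ *: (_ *: _ : M)).
by rewrite !scalerA hx_last_comm.
Qed.
HB.instance Definition _ := GRing.isLinear.Build (H n) (res (incl n) M)
  (res (incl n) M) *:%R act_x_fun act_x_is_linear.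
Definition act_x : {linear res (incl n) M -> res (incl n) M} := act_x_fun.
End ActX.

Section ActTau.
Variables (n : nat) (M : hmod n.+2).
Local Notation res2 := (res (incl n) (res (incl n.+1) M)).
Definition act_tau_fun (v : res2) : res2 :=
  - (@hti R z f n.+2 ord_max *: (v : M)).
Lemma act_tau_is_linear : linear act_tau_fun.
Proof.
move=> a u v; rewrite /act_tau_fun scalerDr opprD; congr (_ + _).
apply: etrans (esym (scalerN _ _)); congr (- _).
exact: etrans (scalerA _ _ _)
  (etrans (congr1 (fun b => b *: (u : M)) (hti_last_comm a))
          (esym (scalerA _ _ _))).
Qed.
HB.instance Definition _ := GRing.isLinear.Build (H n) res2 res2 *:%R
  act_tau_fun act_tau_is_linear.
Definition act_tau : {linear res2 -> res2} := act_tau_fun.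
End ActTau.

Definition psi_x : @hom R (endcat hmods) res_endo res_endo.
Proof.
exists (fun (M : hmods) n => act_x (M n.+1)) => M N g.
apply: dsum_hom_eq => n; apply: linear_fun_eq => v.
exact: (linearZZ (g n.+1)).
Defined.

Definition psi_tau :
  @hom R (endcat hmods) (tens res_endo res_endo) (tens res_endo res_endo).
Proof.
exists (fun (M : hmods) n => act_tau (M n.+2)) => M N g.
apply: dsum_hom_eq => n; apply: linear_fun_eq => v.
exact: etrans (raddfN (g n.+2) _) (congr1 -%R (linearZZ (g n.+2) _ _)).
Defined.

Definition psi_c_at (M : hmods) (n : nat) :
    hom (M n) (coind_endo (res_endo M) n) :=
  match n with
  | 0 => hom0 _ _
  | m.+1 => coind_unit (incl m) (M m.+1)
  end.

Definition psi_c :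
  @hom R (endcat hmods) (sm_unit (endcat hmods)) (tens coind_endo res_endo).
Proof.
exists psi_c_at => M N g; apply: dsum_hom_eq => -[|n].
  by apply: linear_fun_eq => v; rewrite [LHS]thinmx0 [RHS]thinmx0.
apply: linear_fun_eq => v; apply: linear_fun_eq => u.
exact: (linearZZ (g n.+1)).
Defined.

Definition psi_d :
  @hom R (endcat hmods) (tens res_endo coind_endo) (sm_unit (endcat hmods)).
Proof.
exists (fun (M : hmods) n => coind_counit (incl n) (M n)) => M N g.
by apply: dsum_hom_eq => n; apply: linear_fun_eq.
Defined.

End HeckeAction.

Inductive updown : Type := Up | Down.

(* Objects are words in Up and Down, with concatenation as tensor product.   *)
Notation udword := (seq updown).

Definition pos_part (k : int) : nat := if k is Posz m then m else 0.
Definition neg_part (k : int) : nat := if k is Negz m then m.+1 else 0.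

Inductive heis_gen (k : int) : udword -> udword -> Type :=
| Gx : heis_gen k [:: Up] [:: Up]
| Gxi : heis_gen k [:: Up] [:: Up]
| Gtau : heis_gen k [:: Up; Up] [:: Up; Up]
| Gc : heis_gen k [::] [:: Down; Up]
| Gd : heis_gen k [:: Up; Down] [::]
| GL : heis_gen k [:: Down; Up] [:: Up; Down]
| Geta of 'I_(pos_part k) : heis_gen k [::] [:: Up; Down]
| Geps of 'I_(neg_part k) : heis_gen k [:: Down; Up] [::].

Inductive hterm (R : Type) (k : int) : udword -> udword -> Type :=
| TGen X Y : heis_gen k X Y -> hterm R k X Y
| TId X : hterm R k X X
| TComp X Y Z : hterm R k Y Z -> hterm R k X Y -> hterm R k X Z
| TTens X Y X' Y' :
    hterm R k X Y -> hterm R k X' Y' -> hterm R k (X ++ X') (Y ++ Y')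
| TZero X Y : hterm R k X Y
| TAdd X Y : hterm R k X Y -> hterm R k X Y -> hterm R k X Y
| TScale X Y : R -> hterm R k X Y -> hterm R k X Y.

Arguments TGen {R k X Y} _.
Arguments TId {R k} X.
Arguments TZero {R k X Y}.

Declare Scope heis_scope.
Delimit Scope heis_scope with heis.
Notation "f \c g" := (TComp f g) (at level 45, left associativity) : heis_scope.
Notation "f \ox g" := (TTens f g) (at level 40, left associativity) : heis_scope.
Notation "f \+ g" := (TAdd f g) (at level 50, left associativity) : heis_scope.
Notation "a \*: f" := (TScale a f) (at level 40) : heis_scope.
Local Open Scope heis_scope.

Section HeisTerms.

Variables (R : comUnitRingType) (k : int).

Local Notation hterm := (hterm R).
Local Notation "1u" := (TId [:: Up]).
Local Notation "1d" := (TId [:: Down]).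

Definition tx : hterm k [:: Up] [:: Up] := TGen (Gx k).
Definition txi : hterm k [:: Up] [:: Up] := TGen (Gxi k).
Definition ttau : hterm k [:: Up; Up] [:: Up; Up] := TGen (Gtau k).
Definition tc : hterm k [::] [:: Down; Up] := TGen (Gc k).
Definition td : hterm k [:: Up; Down] [::] := TGen (Gd k).
Definition tL : hterm k [:: Down; Up] [:: Up; Down] := TGen (GL k).
Definition teta a : hterm k [::] [:: Up; Down] := TGen (Geta a).
Definition teps a : hterm k [:: Down; Up] [::] := TGen (Geps a).

Definition tpow (a : nat) : hterm k [:: Up] [:: Up] := iter a (TComp tx) 1u.

Definition tsigma : hterm k [:: Up; Down] [:: Down; Up] :=
  (1d \ox 1u \ox td) \c (1d \ox ttau \ox 1d) \c (tc \ox 1u \ox 1d).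

(* The entries of M_k other than sigma_+. *)
Definition tdx (a : nat) : hterm k [:: Up; Down] [::] := td \c (tpow a \ox 1d).
Definition txc (a : nat) : hterm k [::] [:: Down; Up] := (1d \ox tpow a) \c tc.

Definition tsum X Y (n : nat) (F : 'I_n -> hterm k X Y) : hterm k X Y :=
  \big[@TAdd R k X Y/TZero]_(a < n) F a.

End HeisTerms.

Section HeisCups.

Variables (R : comUnitRingType) (z s : R).

Definition tcp (k : int) : hterm R k [::] [:: Up; Down] :=
  match k with
  | Posz 0 => s \*: (tL R _ \c tc R _)
  | Posz m.+1 =>
      - (s^-1 * z^-1) \*:
        ((txi R _ \ox TId [:: Down]) \c @teta R (Posz m.+1) ord_max)
  | Negz m => s^-1 \*: (tL R _ \c txc R _ m.+1)
  end.

Definition tdp (k : int) : hterm R k [:: Down; Up] [::] :=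
  match k with
  | Posz m => s \*: (tdx R _ m \c tL R _)
  | Negz m => - (s^-1 * z^-1) \*: @teps R (Negz m) ord0
  end.

End HeisCups.

Section HeisCategory.

Variables (R : comUnitRingType) (k : int) (z s : R).

Local Notation hterm := (hterm R k).
Local Notation "1u" := (TId [:: Up]).
Local Notation "1d" := (TId [:: Down]).
Local Notation "1n" := (TId [::]).
Local Notation x := (tx R k).
Local Notation xi := (txi R k).
Local Notation tau := (ttau R k).
Local Notation c := (tc R k).
Local Notation d := (td R k).
Local Notation L := (tL R k).
Local Notation eta := (@teta R k).
Local Notation eps := (@teps R k).
Local Notation sigma := (tsigma R k).
Local Notation dx := (tdx R k).
Local Notation xc := (txc R k).

(* The relations HR_Lsigma to HR_epsxc say that the matrix with entries L,   *)
(* eta_a, eps_a is a two-sided inverse of M_k: for k >= 0 there are no eps_a *)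
(* and the sum in HR_sigmaL is empty, for k < 0 there are no eta_a and the   *)
(* sum in HR_Lsigma is empty.                                                *)
Inductive heis_rel : forall X Y, hterm X Y -> hterm X Y -> Prop :=
| HR_xV : heis_rel (x \c xi) 1u
| HR_Vx : heis_rel (xi \c x) 1u
| HR_taux : heis_rel (tau \c (1u \ox x) \c tau) (x \ox 1u)
| HR_tautau : heis_rel (tau \c tau) (z \*: tau \+ TId [:: Up; Up])
| HR_braid : heis_rel ((tau \ox 1u) \c (1u \ox tau) \c (tau \ox 1u))
                      ((1u \ox tau) \c (tau \ox 1u) \c (1u \ox tau))
| HR_zigzag_up : heis_rel ((d \ox 1u) \c (1u \ox c)) 1u
| HR_zigzag_down : heis_rel ((1d \ox d) \c (c \ox 1d)) 1d
| HR_Lsigma :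
    heis_rel (L \c sigma \+ tsum (fun a : 'I_(pos_part k) => eta a \c dx a))
             (TId [:: Up; Down])
| HR_sigmaL :
    heis_rel (sigma \c L \+ tsum (fun a : 'I_(neg_part k) => xc a \c eps a))
             (TId [:: Down; Up])
| HR_sigmaeta a : heis_rel (sigma \c eta a) TZero
| HR_dxL (a : 'I_(pos_part k)) : heis_rel (dx a \c L) TZero
| HR_dxeta (a b : 'I_(pos_part k)) :
    heis_rel (dx a \c eta b) (if a == b then 1n else TZero)
| HR_epssigma a : heis_rel (eps a \c sigma) TZero
| HR_Lxc (a : 'I_(neg_part k)) : heis_rel (L \c xc a) TZero
| HR_epsxc (a b : 'I_(neg_part k)) :
    heis_rel (eps a \c xc b) (if a == b then 1n else TZero)
| HR_pos : (0 < k)%R -> heis_rel (d \c tcp z s k) ((s * z^-1) \*: 1n)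
| HR_zero : k = 0 ->
    heis_rel (d \c tcp z s k) ((s * z^-1 - s^-1 * z^-1) \*: 1n)
| HR_neg : (k < 0)%R ->
    heis_rel (tdp z s k \c xc (neg_part k)) ((s * z^-1) \*: 1n).

(* The least congruence that contains the relations above and the axioms of  *)
(* strict linear monoidal categories.  It relates terms of different types   *)
(* because the two sides of HC_tensA and HC_tensf1 have sources and targets  *)
(* that are equal but not convertible; see hcong_endpoints.                  *)
Inductive hcong : forall X Y, hterm X Y -> forall X' Y', hterm X' Y' -> Prop :=
| HC_rel X Y (f g : hterm X Y) : heis_rel f g -> hcong f g
| HC_refl X Y (f : hterm X Y) : hcong f f
| HC_sym X Y (f : hterm X Y) X' Y' (g : hterm X' Y') : hcong f g -> hcong g f
| HC_trans X Y (f : hterm X Y) X' Y' (g : hterm X' Y') X'' Y''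
    (h : hterm X'' Y'') : hcong f g -> hcong g h -> hcong f h
| HC_comp X Y Z (f : hterm Y Z) (g : hterm X Y)
    X' Y' Z' (f' : hterm Y' Z') (g' : hterm X' Y') :
    hcong f f' -> hcong g g' -> hcong (f \c g) (f' \c g')
| HC_tens X Y (f : hterm X Y) X1 Y1 (f1 : hterm X1 Y1)
    X' Y' (f' : hterm X' Y') X1' Y1' (f1' : hterm X1' Y1') :
    hcong f f' -> hcong f1 f1' -> hcong (f \ox f1) (f' \ox f1')
| HC_add X Y (f g : hterm X Y) X' Y' (f' g' : hterm X' Y') :
    hcong f f' -> hcong g g' -> hcong (f \+ g) (f' \+ g')
| HC_scale X Y (f : hterm X Y) X' Y' (f' : hterm X' Y') a :
    hcong f f' -> hcong (a \*: f) (a \*: f')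
| HC_addA X Y (f g h : hterm X Y) : hcong (f \+ (g \+ h)) (f \+ g \+ h)
| HC_addC X Y (f g : hterm X Y) : hcong (f \+ g) (g \+ f)
| HC_add0 X Y (f : hterm X Y) : hcong (TZero \+ f) f
| HC_addN X Y (f : hterm X Y) : hcong ((-1) \*: f \+ f) (@TZero R k X Y)
| HC_scaleA X Y a b (f : hterm X Y) : hcong (a \*: (b \*: f)) ((a * b) \*: f)
| HC_scale1 X Y (f : hterm X Y) : hcong (1 \*: f) f
| HC_scaleDr X Y a (f g : hterm X Y) :
    hcong (a \*: (f \+ g)) (a \*: f \+ a \*: g)
| HC_scaleDl X Y a b (f : hterm X Y) :
    hcong ((a + b)%R \*: f) (a \*: f \+ b \*: f)
| HC_compA W X Y Z (f : hterm Y Z) (g : hterm X Y) (h : hterm W X) :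
    hcong (f \c (g \c h)) (f \c g \c h)
| HC_comp1f X Y (f : hterm X Y) : hcong (TId Y \c f) f
| HC_compf1 X Y (f : hterm X Y) : hcong (f \c TId X) f
| HC_compDl X Y Z (f g : hterm Y Z) (h : hterm X Y) :
    hcong ((f \+ g) \c h) (f \c h \+ g \c h)
| HC_compDr X Y Z (f : hterm Y Z) (g h : hterm X Y) :
    hcong (f \c (g \+ h)) (f \c g \+ f \c h)
| HC_compZl X Y Z a (f : hterm Y Z) (g : hterm X Y) :
    hcong ((a \*: f) \c g) (a \*: (f \c g))
| HC_compZr X Y Z a (f : hterm Y Z) (g : hterm X Y) :
    hcong (f \c (a \*: g)) (a \*: (f \c g))
| HC_tens11 X Y : hcong (TId X \ox TId Y) (@TId R k (X ++ Y))
| HC_tensM X Y Z X' Y' Z' (f : hterm Y Z) (g : hterm X Y)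
    (f' : hterm Y' Z') (g' : hterm X' Y') :
    hcong ((f \c g) \ox (f' \c g')) ((f \ox f') \c (g \ox g'))
| HC_tensDl X Y X' Y' (f g : hterm X Y) (h : hterm X' Y') :
    hcong ((f \+ g) \ox h) (f \ox h \+ g \ox h)
| HC_tensDr X Y X' Y' (f : hterm X Y) (g h : hterm X' Y') :
    hcong (f \ox (g \+ h)) (f \ox g \+ f \ox h)
| HC_tensZl X Y X' Y' a (f : hterm X Y) (g : hterm X' Y') :
    hcong ((a \*: f) \ox g) (a \*: (f \ox g))
| HC_tensZr X Y X' Y' a (f : hterm X Y) (g : hterm X' Y') :
    hcong (f \ox (a \*: g)) (a \*: (f \ox g))
| HC_tensA X Y X' Y' X'' Y'' (f : hterm X Y) (g : hterm X' Y')
    (h : hterm X'' Y'') : hcong (f \ox (g \ox h)) (f \ox g \ox h)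
| HC_tens1f X Y (f : hterm X Y) : hcong (1n \ox f) f
| HC_tensf1 X Y (f : hterm X Y) : hcong (f \ox 1n) f.

Lemma hcong_endpoints X Y (f : hterm X Y) X' Y' (g : hterm X' Y') :
  hcong f g -> X = X' /\ Y = Y'.
Proof.
elim=> {X Y f X' Y' g} //.
- by move=> X Y f X' Y' g _ [-> ->].
- by move=> X Y f X' Y' g X'' Y'' h _ [-> ->] _ [-> ->].
- by move=> X Y Z f g X' Y' Z' f' g' _ [_ ->] _ [-> _].
- by move=> X Y f X1 Y1 f1 X' Y' f' X1' Y1' f1' _ [-> ->] _ [-> ->].
- by move=> *; rewrite !catA.
- by move=> *; rewrite !cats0.
Qed.

Definition hcongb X Y (f g : {classic (hterm X Y)}) : bool := `[< hcong f g >].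

Lemma hcongb_refl X Y : reflexive (@hcongb X Y).
Proof. by move=> f; apply/asboolP; apply: HC_refl. Qed.
Lemma hcongb_sym X Y : symmetric (@hcongb X Y).
Proof. by move=> f g; apply/asboolP/asboolP; apply: HC_sym. Qed.
Lemma hcongb_trans X Y : transitive (@hcongb X Y).
Proof.
by move=> f g h /asboolP fg /asboolP gh; apply/asboolP; apply: HC_trans fg gh.
Qed.

Canonical hcongb_equiv X Y :=
  EquivRel (@hcongb X Y) (@hcongb_refl X Y) (@hcongb_sym X Y) (@hcongb_trans X Y).

Definition heis_hom (X Y : udword) : Type := {eq_quot @hcongb X Y}.

Definition hclass X Y (f : hterm X Y) : heis_hom X Y :=
  \pi_{eq_quot @hcongb X Y} (f : {classic (hterm X Y)}).
Definition hrepr X Y (f : heis_hom X Y) : hterm X Y := repr f.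

Lemma hreprK X Y (f : heis_hom X Y) : hclass (hrepr f) = f.
Proof. exact: reprK. Qed.
Lemma hclassP X Y (f g : hterm X Y) : hclass f = hclass g <-> hcong f g.
Proof.
split=> [/eqmodP|fg]; first by move=> /asboolP.
by apply/eqmodP/asboolP.
Qed.
Lemma hrepr_hclass X Y (f : hterm X Y) : hcong (hrepr (hclass f)) f.
Proof. by apply/hclassP; rewrite hreprK. Qed.

Definition heis_comp X Y Z (f : heis_hom Y Z) (g : heis_hom X Y) :=
  hclass (hrepr f \c hrepr g).
Definition heis_tens X Y X' Y' (f : heis_hom X Y) (g : heis_hom X' Y') :=
  hclass (hrepr f \ox hrepr g).
Definition heis_add X Y (f g : heis_hom X Y) := hclass (hrepr f \+ hrepr g).
Definition heis_scale X Y (a : R) (f : heis_hom X Y) := hclass (a \*: hrepr f).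

Lemma heis_compE X Y Z (f : hterm Y Z) (g : hterm X Y) :
  heis_comp (hclass f) (hclass g) = hclass (f \c g).
Proof. by apply/hclassP/HC_comp; apply: hrepr_hclass. Qed.
Lemma heis_tensE X Y X' Y' (f : hterm X Y) (g : hterm X' Y') :
  heis_tens (hclass f) (hclass g) = hclass (f \ox g).
Proof. by apply/hclassP/HC_tens; apply: hrepr_hclass. Qed.
Lemma heis_addE X Y (f g : hterm X Y) :
  heis_add (hclass f) (hclass g) = hclass (f \+ g).
Proof. by apply/hclassP/HC_add; apply: hrepr_hclass. Qed.
Lemma heis_scaleE X Y a (f : hterm X Y) :
  heis_scale a (hclass f) = hclass (a \*: f).
Proof. by apply/hclassP/HC_scale; apply: hrepr_hclass. Qed.

Definition heisE := (heis_compE, heis_tensE, heis_addE, heis_scaleE).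

Lemma heis_ind X Y (P : heis_hom X Y -> Prop) :
  (forall f, P (hclass f)) -> forall f, P f.
Proof. by move=> Pf f; rewrite -[f]hreprK. Qed.

Definition heis_rmod X Y : rmod R (heis_hom X Y).
Proof.
refine (@RMod R _ (hclass TZero) (heis_scale (-1)) (@heis_add X Y)
          (@heis_scale X Y) _ _ _ _ _ _ _ _).
- move=> f g h; elim/heis_ind: f => f; elim/heis_ind: g => g.
  by elim/heis_ind: h => h; rewrite !heisE; apply/hclassP/HC_addA.
- move=> f g; elim/heis_ind: f => f; elim/heis_ind: g => g.
  by rewrite !heisE; apply/hclassP/HC_addC.
- by move=> f; elim/heis_ind: f => f; rewrite !heisE; apply/hclassP/HC_add0.
- by move=> f; elim/heis_ind: f => f; rewrite !heisE; apply/hclassP/HC_addN.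
- move=> a b f; elim/heis_ind: f => f.
  by rewrite !heisE; apply/hclassP/HC_scaleA.
- by move=> f; elim/heis_ind: f => f; rewrite !heisE; apply/hclassP/HC_scale1.
- move=> a f g; elim/heis_ind: f => f; elim/heis_ind: g => g.
  by rewrite !heisE; apply/hclassP/HC_scaleDr.
- move=> f a b; elim/heis_ind: f => f.
  by rewrite !heisE; apply/hclassP/HC_scaleDl.
Defined.

Definition heis_lin : lincat R.
Proof.
refine (@LinCat R udword heis_hom heis_rmod (fun X => hclass (TId X)) heis_comp
          _ _ _ _ _ _ _).
- move=> W X Y Z f g h; elim/heis_ind: f => f; elim/heis_ind: g => g.
  by elim/heis_ind: h => h; rewrite !heisE; apply/hclassP/HC_compA.
- move=> X Y f; elim/heis_ind: f => f.
  by rewrite !heisE; apply/hclassP/HC_comp1f.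
- move=> X Y f; elim/heis_ind: f => f.
  by rewrite !heisE; apply/hclassP/HC_compf1.
- move=> X Y Z f g h; elim/heis_ind: f => f; elim/heis_ind: g => g.
  by elim/heis_ind: h => h; rewrite /= !heisE; apply/hclassP/HC_compDl.
- move=> X Y Z f g h; elim/heis_ind: f => f; elim/heis_ind: g => g.
  by elim/heis_ind: h => h; rewrite /= !heisE; apply/hclassP/HC_compDr.
- move=> X Y Z a f g; elim/heis_ind: f => f; elim/heis_ind: g => g.
  by rewrite /= !heisE; apply/hclassP/HC_compZl.
- move=> X Y Z a f g; elim/heis_ind: f => f; elim/heis_ind: g => g.
  by rewrite /= !heisE; apply/hclassP/HC_compZr.
Defined.

Lemma heis_arr X Y (f : hterm X Y) X' Y' (g : hterm X' Y') : hcong f g ->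
  arr (hclass f : @hom R heis_lin X Y) = arr (hclass g : @hom R heis_lin X' Y').
Proof.
move=> fg; have [eX eY] := hcong_endpoints fg.
case: _ / eX g fg => g; case: _ / eY g => g fg.
by congr arr; apply/hclassP.
Qed.

Definition heis : smcat R.
Proof.
refine (@SMCat R heis_lin [::] cat heis_tens _ _ _ _ _ _
          (@catA updown) (fun X => erefl) (@cats0 updown) _ _ _).
- by move=> X Y; rewrite !heisE; apply/hclassP/HC_tens11.
- move=> X Y Z X' Y' Z' f g f' g'; elim/heis_ind: f => f.
  elim/heis_ind: g => g; elim/heis_ind: f' => f'; elim/heis_ind: g' => g'.
  by rewrite /= !heisE; apply/hclassP/HC_tensM.
- move=> X Y X' Y' f g h; elim/heis_ind: f => f; elim/heis_ind: g => g.
  by elim/heis_ind: h => h; rewrite /homD /= !heisE; apply/hclassP/HC_tensDl.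
- move=> X Y X' Y' f g h; elim/heis_ind: f => f; elim/heis_ind: g => g.
  by elim/heis_ind: h => h; rewrite /homD /= !heisE; apply/hclassP/HC_tensDr.
- move=> X Y X' Y' a f g; elim/heis_ind: f => f; elim/heis_ind: g => g.
  by rewrite /homZ /= !heisE; apply/hclassP/HC_tensZl.
- move=> X Y X' Y' a f g; elim/heis_ind: f => f; elim/heis_ind: g => g.
  by rewrite /homZ /= !heisE; apply/hclassP/HC_tensZr.
- move=> X Y X' Y' X'' Y'' f g h; elim/heis_ind: f => f.
  elim/heis_ind: g => g; elim/heis_ind: h => h; rewrite !heisE.
  exact/heis_arr/HC_tensA.
- move=> X Y f; elim/heis_ind: f => f; rewrite !heisE.
  exact/heis_arr/HC_tens1f.
- move=> X Y f; elim/heis_ind: f => f; rewrite !heisE.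
  exact/heis_arr/HC_tensf1.
Defined.

Definition heis_up : heis := [:: Up].
Definition heis_down : heis := [:: Down].
Definition heis_x : hom heis_up heis_up := hclass x.
Definition heis_tau : hom (tens heis_up heis_up) (tens heis_up heis_up) :=
  hclass tau.
Definition heis_c : hom (sm_unit heis) (tens heis_down heis_up) := hclass c.
Definition heis_d : hom (tens heis_up heis_down) (sm_unit heis) := hclass d.

End HeisCategory.

Arguments heis_up {R k z s}.
Arguments heis_down {R k z s}.
Arguments heis_x {R k z s}.
Arguments heis_tau {R k z s}.
Arguments heis_c {R k z s}.
Arguments heis_d {R k z s}.

(* Main.v *)
From Stdlib Require Import Ncring Ncring_tac.
From HB Require Import structures.
Require Import Defs.
From mathcomp Require Import all_boot all_order all_algebra.
From mathcomp Require Import generic_quotient boolp zify.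

(** The presentation becomes a functor as soon as its defining relations hold
for the prescribed natural transformations: terms are evaluated by recursion,
and the congruence on terms consists of the relations and of laws valid in
every strict linear monoidal category ([heis_functor]).  The functor is unique
because words in the two generating objects have forced images and because the
other generators are inverses, or entries of inverse matrices, and so are
determined by what they invert ([heis_functor_unique]).

The relations between x, tau, c and d are identities of the Hecke algebras
H_n and triangle identities of the adjunction.  The one relation with content
is the invertibility of the matrix with entries sigma_+ and d (x^a tensor 1),
for a < l.  With x and tau the last generators of H_{n+1}, it says that for
each H_n-module M the map sending theta in Hom_{H_n}(H_{n+1}, M) to
u |-> - theta(tau^-1 u) in Hom_{H_{n-1}}(H_n, M) and to the theta(x^a), a < l,
in M^l is bijective; in other words, as a left H_n-module H_{n+1} is the
direct sum of the H_n x^a, free of rank one, and of a copy of the tensor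
product of H_n with itself over H_{n-1}, namely H_n tau^-1 H_n.

The map is injective ([left_hom_inj]) because the elements x^a and tau^-1 u
generate the left module: the maps theta that vanish on them form a set stable
under right multiplication of the argument by every generator of H_{n+1}.

The map is surjective because H_{n+1} is free over H_n, on a basis made of the
x^a and of the tau^-1 b, for b in the basis of H_n over H_{n-1}.  To see that
no relation between these elements was overlooked, right multiplication on
this basis is written down as a matrix with entries in H_n, and the matrices
are shown to satisfy the relations of H_{n+1} ([regular_rep]); the first row
of the matrix of u then gives well defined coordinates of u
([left_hom_expand]).  By induction on n only the matrix T of the new tau has
to be studied.  It consists of a scalar part and of a 2 x 2 matrix over
M_l(H_n), built from the resolvent S = (1 - N x)^-1 of the shift matrix N:

  [ z S,             1         ]
  [ 1 - z^2 (S-1) S, - z (S-1) ].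

Conjugation by a unipotent matrix makes it constant, and for two consecutive
strands both matrices become constant after one common conjugation.  Thus the
quadratic relation and the braid relation hold formally ([swap_quadratic],
[swap_braid]).  The commutation of x with tau x tau follows from them except
at the first step n = 1, where x_1 acts by the companion matrix of f and
f(x_1) = 0 is used ([swap_type_B]).

The scalar d c' is - t z^-1 times the coordinate of x^-1 on x^(l-1), which is
- t^-2 for all n ([rep_last_xi]), since f has constant coefficient t^2 and
leading coefficient 1.  For l = 0 the algebras H_{n+1} vanish and t^2 = 1, so
that both sides of the normalization are zero. *)

Set Implicit Arguments.
Unset Strict Implicit.
Unset Printing Implicit Defensive.

Import GRing.Theory.
Local Open Scope ring_scope.

(** * Matrices of size two and three over a noncommutative ring *)

(** These instances make [non_commutative_ring] available in every ring. *)
#[export] Instance pzRing_ops (K : pzRingType) :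
  @Ring_ops K 0 1 (@GRing.add K) (@GRing.mul K) (fun a b => a - b)
    (@GRing.opp K) (@eq K) := {}.
#[export] Instance pzRing_ncring (K : pzRingType) : Ring (Ro := pzRing_ops K).
Proof.
split; try exact _; try (by move=> a b -> c d ->); try (by move=> a b ->).
- exact: add0r.
- exact: addrC.
- exact: addrA.
- exact: mul1r.
- exact: mulr1.
- exact: mulrA.
- exact: mulrDl.
- by move=> a b c; exact: mulrDr.
- by [].
- exact: subrr.
Qed.

Section SmallMatrices.
Variable K : pzRingType.
Implicit Types a b c d : K.

Definition mx2 a b c d : 'M[K]_2 :=
  \matrix_(i, j) nth 0 (nth [::] [:: [:: a; b]; [:: c; d]] i) j.

Definition mx3 a b c d e f g h k : 'M[K]_3 :=
  \matrix_(i, j)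
    nth 0 (nth [::] [:: [:: a; b; c]; [:: d; e; f]; [:: g; h; k]] i) j.

Lemma mx2M a b c d a' b' c' d' :
  mx2 a b c d * mx2 a' b' c' d' =
  mx2 (a * a' + b * c') (a * b' + b * d') (c * a' + d * c') (c * b' + d * d').
Proof.
apply/matrixP => -[[|[|i]] // ilt] -[[|[|j]] // jlt];
  by rewrite !mxE !big_ord_recl big_ord0 !mxE /= addr0.
Qed.

Lemma mx2D a b c d a' b' c' d' :
  mx2 a b c d + mx2 a' b' c' d' = mx2 (a + a') (b + b') (c + c') (d + d').
Proof.
by apply/matrixP => -[[|[|i]] // ilt] -[[|[|j]] // jlt]; rewrite !mxE.
Qed.

Lemma mx2_scalar a : a%:M = mx2 a 0 0 a.
Proof.
by apply/matrixP => -[[|[|i]] // ilt] -[[|[|j]] // jlt]; rewrite !mxE.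
Qed.

Lemma mx3M a b c d e f g h k a' b' c' d' e' f' g' h' k' :
  mx3 a b c d e f g h k * mx3 a' b' c' d' e' f' g' h' k' =
  mx3 (a * a' + (b * d' + c * g')) (a * b' + (b * e' + c * h'))
      (a * c' + (b * f' + c * k'))
      (d * a' + (e * d' + f * g')) (d * b' + (e * e' + f * h'))
      (d * c' + (e * f' + f * k'))
      (g * a' + (h * d' + k * g')) (g * b' + (h * e' + k * h'))
      (g * c' + (h * f' + k * k')).
Proof.
apply/matrixP => -[[|[|[|i]]] // ilt] -[[|[|[|j]]] // jlt];
  by rewrite !mxE !big_ord_recl big_ord0 !mxE /= addr0.
Qed.

Lemma mx3_scalar a : a%:M = mx3 a 0 0 0 a 0 0 0 a.
Proof.
by apply/matrixP => -[[|[|[|i]]] // ilt] -[[|[|[|j]]] // jlt]; rewrite !mxE.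
Qed.

Lemma mx2_diag_block a b c d e :
  block_mx (mx2 a b c d) 0 0 (e%:M : 'M_1) = mx3 a b 0 c d 0 0 0 e.
Proof.
apply/matrixP => -[[|[|[|i]]] // ilt] -[[|[|[|j]]] // jlt]; rewrite !mxE;
  case: splitP => -[[|[|i']] // i'lt] //= _; rewrite !mxE;
  by case: splitP => -[[|[|j']] // j'lt] //= _; rewrite !mxE.
Qed.

Lemma mx2_block_diag a b c d e :
  block_mx (e%:M : 'M_1) 0 0 (mx2 a b c d) = mx3 e 0 0 0 a b 0 c d.
Proof.
apply/matrixP => -[[|[|[|i]]] // ilt] -[[|[|[|j]]] // jlt]; rewrite !mxE;
  case: splitP => -[[|[|i']] // i'lt] //= _; rewrite !mxE;
  by case: splitP => -[[|[|j']] // j'lt] //= _; rewrite !mxE.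
Qed.

End SmallMatrices.

(** * A deformed transposition *)
Section SwapMatrices.
Variables (K : pzRingType) (zeta : K).
Hypothesis zetaC : forall a, a * zeta = zeta * a.

(** Right multiplication by tau on the families x_{n+1}^i and tau^-1 x_n^i, when
[a] is the matrix of coefficients of the sums of the x_n^(i-j) x_{n+1}^j; see
[x_exp_tau] and [taui_x_exp_tau].  For a = 0 it is a transposition up to the
parameter [zeta] in the corner. *)
Definition swap_mx (a : K) :=
  mx2 (zeta * a) 1 (1 - zeta * zeta * (a - 1) * a) (- (zeta * (a - 1))).

Let g a := mx2 1 0 (zeta * a) 1.
Let T0 := mx2 0 1 1 zeta.

Let gI a (P Q : 'M_2) : g a * P = g a * Q -> P = Q.
Proof.
move=> e; have gV : mx2 1 0 (- (zeta * a)) 1 * g a = 1.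
  rewrite mx2M [RHS](mx2_scalar 1); congr mx2; non_commutative_ring.
by rewrite -[P]mul1r -gV -mulrA e mulrA gV mul1r.
Qed.

(** A unipotent matrix conjugates [swap_mx a] to a matrix that does not depend
on [a], so that polynomial identities for it can be checked on constants. *)
Let gT a : g a * swap_mx a = T0 * g a.
Proof.
rewrite !mx2M; congr mx2; try non_commutative_ring.
have -> : zeta * a * (zeta * a) = zeta * zeta * a * a.
  by rewrite -!mulrA (mulrA a) zetaC !mulrA.
non_commutative_ring.
Qed.

Let zetaM n (P : 'M[K]_n) : P * zeta%:M = zeta%:M * P.
Proof.
apply/matrixP => i j; rewrite [LHS]mxE [RHS]mxE (bigD1 j) //= [in RHS](bigD1 i) //=.
rewrite !mxE !eqxx !big1 ?addr0 ?zetaC // => k /negPf kn.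
  by rewrite mxE eq_sym kn mul0r.
by rewrite mxE kn mulr0.
Qed.

Lemma swap_quadratic a : swap_mx a * swap_mx a = zeta%:M * swap_mx a + 1.
Proof.
apply: (@gI a).
have -> : g a * (swap_mx a * swap_mx a) = T0 * T0 * g a.
  by rewrite mulrA gT -mulrA gT mulrA.
have -> : g a * (zeta%:M * swap_mx a + 1) = zeta%:M * T0 * g a + g a.
  by rewrite mulrDr mulr1 mulrA zetaM -mulrA gT mulrA.
have -> : T0 * T0 = zeta%:M * T0 + 1.
  rewrite [1](mx2_scalar 1) (mx2_scalar zeta) !mx2M mx2D.
  congr mx2; non_commutative_ring.
by rewrite mulrDl mul1r.
Qed.

(** One unipotent matrix, [G] below, conjugates both factors to constant
matrices, for which the braid relation is immediate.  The second hypothesis is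
the only interaction between [a], [b] and [s] that this conjugation needs. *)
Lemma swap_braid a b s : s * s = zeta * s + 1 ->
    a * s = s * b + zeta * b * (a - 1) ->
  let t := block_mx (swap_mx a) 0 0 (s%:M : 'M_1) : 'M_3 in
  let t' := block_mx (s%:M : 'M_1) 0 0 (swap_mx b) : 'M_3 in
  t * t' * t = t' * t * t'.
Proof.
move=> ss as_ /=; rewrite mx2_diag_block mx2_block_diag.
set t := mx3 _ _ _ _ _ _ _ _ _; set t' := mx3 s _ _ _ _ _ _ _ _.
pose G := mx3 1 0 0 (zeta * a) 1 0 (zeta * a * s) (zeta * b) 1.
pose GV := mx3 1 0 0 (- (zeta * a)) 1 0
  (zeta * b * zeta * a - zeta * a * s) (- (zeta * b)) 1.
have GI P Q : G * P = G * Q -> P = Q.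
  move=> e; have gV : GV * G = 1.
    rewrite mx3M [RHS](mx3_scalar 1); congr mx3; non_commutative_ring.
  by rewrite -[P]mul1r -gV -mulrA e mulrA gV mul1r.
pose t0 := mx3 0 1 0 1 zeta 0 0 0 s; pose t0' := mx3 s 0 0 0 0 1 0 1 zeta.
have Gt : G * t = t0 * G.
  rewrite !mx3M; congr mx3; try non_commutative_ring.
  - have -> : zeta * a * (zeta * a) = zeta * zeta * a * a.
      by rewrite -!mulrA (mulrA a) zetaC !mulrA.
    non_commutative_ring.
  - have -> : s * (zeta * a * s) = zeta * (s * (a * s)) by rewrite !mulrA zetaC.
    have -> : s * (a * s) = (zeta * s + 1) * b + zeta * s * b * (a - 1).
      by rewrite as_ mulrDr mulrA ss !mulrA zetaC.
    have -> : zeta * a * s * (zeta * a) = zeta * zeta * ((a * s) * a).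
      by rewrite -!mulrA (mulrA s zeta) zetaC -!mulrA (mulrA a zeta) zetaC !mulrA.
    rewrite as_.
    have -> : zeta * zeta * ((s * b + zeta * b * (a - 1)) * a) =
      zeta * zeta * s * b * a + zeta * (zeta * zeta * b * (a - 1) * a).
      non_commutative_ring.
    have -> : zeta * b * (1 - zeta * zeta * (a - 1) * a) =
      zeta * b - zeta * (zeta * zeta * b * (a - 1) * a).
      rewrite mulrBr mulr1; congr (_ - _).
      by rewrite !mulrA -(mulrA zeta b) zetaC -!mulrA (mulrA b zeta) zetaC !mulrA.
    non_commutative_ring.
  - have -> : zeta * a * s * 1 = zeta * (a * s) by rewrite mulr1 mulrA.
    have -> : s * (zeta * b) = zeta * s * b by rewrite mulrA zetaC.
    have -> : zeta * b * - (zeta * (a - 1)) = - (zeta * (zeta * b * (a - 1))).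
      by rewrite mulrN; congr (- _); rewrite -!mulrA (mulrA b) zetaC !mulrA.
    rewrite as_; non_commutative_ring.
have Gt' : G * t' = t0' * G.
  rewrite !mx3M; congr mx3; try non_commutative_ring.
  - have -> : zeta * a * s * s = zeta * a * (s * s) by rewrite -mulrA.
    have -> : zeta * (zeta * a * s) = zeta * a * (zeta * s).
      by rewrite -!mulrA (mulrA a) zetaC -!mulrA.
    rewrite ss; non_commutative_ring.
  - have -> : zeta * b * (zeta * b) = zeta * zeta * b * b.
      by rewrite -!mulrA (mulrA b) zetaC !mulrA.
    non_commutative_ring.
apply: GI; rewrite !mulrA Gt Gt' -!(mulrA t0) -!(mulrA t0') Gt Gt' !mulrA.
rewrite -!(mulrA _ G) Gt Gt' !mulrA; congr (_ * G).
rewrite !mx3M; congr mx3; rewrite ?(mul0r, mulr0, add0r, addr0, mulr1, mul1r) //.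
by rewrite zetaC -!mulrA ss zetaC mulrDr mulr1 addrC.
Qed.
End SwapMatrices.

(** The relation s y s = x turns into a relation between [s] and the resolvents
[a] and [b] of [x] and [y]; this is what [swap_braid] asks for. *)
Lemma resolvent_twist (K : pzRingType) (zeta a b s x y : K) :
    (forall c, c * zeta = zeta * c) ->
    s * s = zeta * s + 1 -> s * y * s = x -> x * y = y * x ->
    a * (1 - x) = 1 -> (1 - x) * a = 1 -> b * (1 - y) = 1 -> (1 - y) * b = 1 ->
  a * s = s * b + zeta * b * (a - 1).
Proof.
move=> zetaC ss sys xy a1 a2 b1 b2.
have ca c : c * x = x * c -> c * a = a * c.
  move=> cx; have e : c * (1 - x) = (1 - x) * c.
    by rewrite mulrBr mulrBl cx mulr1 mul1r.
  by rewrite -[c * a]mul1r -{1}a1 -mulrA (mulrA _ c) -e -(mulrA c) a2 mulr1.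
have ba : b * a = a * b.
  have ya := ca y (esym xy); have e : a * (1 - y) = (1 - y) * a.
    by rewrite mulrBr mulrBl ya mulr1 mul1r.
  by rewrite -[a * b]mul1r -{1}b1 -mulrA (mulrA _ a) -e -(mulrA a) b2 mulr1.
(* the factor s^-1 = s - zeta turns s y s = x into s y = x s^-1 *)
have sy : s * y = x * s - zeta * x.
  rewrite -sys -mulrA ss mulrDr mulr1 mulrA zetaC.
  by rewrite !mulrA addrAC subrr add0r.
have e : s * (1 - y) = (1 - x) * s + zeta * x.
  by rewrite mulrBr sy; non_commutative_ring.
have a1x : a * x = a - 1 by rewrite -a1; non_commutative_ring.
have sb : s * b = a * s - zeta * (a * x) * b.
  have -> : s * b = a * ((1 - x) * s) * b by rewrite !mulrA a1 mul1r.
  have -> : (1 - x) * s = s * (1 - y) - zeta * x by rewrite e addrK.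
  have -> : zeta * (a * x) = a * (zeta * x) by rewrite !mulrA zetaC.
  have -> : a * (s * (1 - y) - zeta * x) * b = a * (s * ((1 - y) * b)) - a * (zeta * x) * b.
    by non_commutative_ring.
  by rewrite b2 mulr1.
rewrite sb a1x.
have -> : zeta * b * (a - 1) = zeta * (a - 1) * b.
  by rewrite -!mulrA mulrBr mulrBl ba mulr1 mul1r.
by rewrite subrK.
Qed.

(** The reflection relation of type B, which makes x_1 commute with
tau x_1 tau.  Here [N] is the shift, [S] its resolvent, [C] the companion matrix
of a polynomial with root [X]; the last hypothesis encodes this root, by
[geom_comp].  The product T D T is computed explicitly as
[[C - zeta^2 W S, - zeta W], [zeta Z, X]], and it commutes with D because
X commutes with all these matrices, W C = X W and C Z = X Z. *)
Lemma swap_type_B (K : pzRingType) (zeta N C X S : K) :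
    (forall c, c * zeta = zeta * c) ->
    X * N = N * X -> X * S = S * X -> X * C = C * X -> N * S = S * N ->
    S = 1 + N * X * S -> N * C * N = N ->
    (1 - C * N) * X * S * (1 - N * C) = C * (1 - N * C) ->
  let D := mx2 X 0 0 C in
  swap_mx zeta S * D * swap_mx zeta S * D = D * (swap_mx zeta S * D * swap_mx zeta S).
Proof.
move=> zetaC XN XS XC NS SE NCN WV D.
have zl x y : x * (zeta * y) = zeta * (x * y) by rewrite !mulrA zetaC.
set S0 := S - 1; have S0E : S0 = N * X * S by rewrite /S0 {1}SE addrC addKr.
pose W := C * S0 - S * X; pose Z := X * S - S0 * C.
have WE : W = - ((1 - C * N) * X * S).
  by rewrite /W S0E -XS; non_commutative_ring.
have S0W : S0 * W = 0.
  have -> : S0 = X * S * N by rewrite S0E -XN -!mulrA NS.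
  rewrite WE; have -> : X * S * N * - ((1 - C * N) * X * S) =
    - (X * S * ((N - N * C * N) * X * S)) by non_commutative_ring.
  by rewrite NCN subrr !mul0r mulr0 oppr0.
have S0CS0 : S0 * (C * S0) = S0 * (S * X).
  by rewrite -[C * S0](subrK (S * X)) mulrDr -/W S0W add0r.
have S1 : S * (1 - N * X) = 1.
  have -> : S * (1 - N * X) = S - S * N * X by non_commutative_ring.
  have -> : S * N * X = N * X * S by rewrite -NS -!mulrA XS.
  by rewrite {1}SE addrK.
have S2 : (1 - N * X) * S = 1.
  have -> : (1 - N * X) * S = S - N * X * S by non_commutative_ring.
  by rewrite {1}SE addrK.
have WC : W * C = X * W.
  have SC : S * (C - X) = C - S * X * (1 - N * C).
    have e : C - X = (1 - N * X) * C - X * (1 - N * C).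
      have -> : (1 - N * X) * C - X * (1 - N * C) = C - N * X * C - X + X * N * C.
        by non_commutative_ring.
      rewrite XN; non_commutative_ring.
    by rewrite e mulrBr !mulrA S1 mul1r.
  have -> : W * C = X * W + - ((1 - C * N) * X * (S * (C - X))).
    have -> : X * W = - ((1 - C * N) * X * S) * X.
      have -> : - ((1 - C * N) * X * S) * X = - ((1 - C * N) * (X * S * X)).
        by non_commutative_ring.
      rewrite WE; have -> : X * - ((1 - C * N) * X * S) =
        - (X * (X * S) - X * C * N * (X * S)) by non_commutative_ring.
      have -> : X * C * N = C * N * X by rewrite XC -!mulrA XN.
      have -> : X * S * X = X * (X * S) by rewrite -mulrA -XS.
      non_commutative_ring.
    rewrite WE; non_commutative_ring.
  have -> : (1 - C * N) * X * (S * (C - X)) =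
      X * (C * (1 - N * C)) - X * ((1 - C * N) * X * S * (1 - N * C)).
    rewrite SC -XS.
    have -> : X * (C * (1 - N * C)) = X * C - X * C * N * C by non_commutative_ring.
    have -> : X * ((1 - C * N) * X * S * (1 - N * C)) =
        (X * (X * S) - X * C * N * (X * S)) * (1 - N * C).
      by non_commutative_ring.
    have -> : X * C * N = C * N * X by rewrite XC -!mulrA XN.
    non_commutative_ring.
  by rewrite WV subrr oppr0 addr0.
have CZ : C * Z = X * Z.
  have ZE : Z = X * S * (1 - N * C).
    rewrite /Z S0E; have -> : N * X * S = X * S * N by rewrite -XN -!mulrA NS.
    non_commutative_ring.
  have XCS : (C - X) * S = C - (1 - C * N) * X * S.
    have -> : C - X = C * (1 - N * X) - (1 - C * N) * X by non_commutative_ring.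
    by rewrite mulrBl -(mulrA C) S2 mulr1.
  apply/eqP; rewrite -subr_eq0 ZE.
  have -> : C * (X * S * (1 - N * C)) = X * C * S * (1 - N * C).
    by rewrite XC !mulrA.
  have -> : X * C * S * (1 - N * C) - X * (X * S * (1 - N * C)) = X * ((C - X) * S * (1 - N * C)).
    by non_commutative_ring.
  by rewrite XCS mulrBl WV subrr mulr0.
have XWS : X * (W * S) = W * S * X.
  rewrite /W S0E; apply: commrM => //; apply: commrB; do ?apply: commrM => //.
pose zE := (zl S, zl X, zl C, zl S0).
have DE : swap_mx zeta S * D * swap_mx zeta S =
    mx2 (C - zeta * zeta * W * S) (- (zeta * W)) (zeta * Z) X.
  rewrite /swap_mx -/S0 /D !mx2M; congr mx2; rewrite ?(mul0r, mulr0, add0r, addr0).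
  - have -> : zeta * S * X * (zeta * S) = zeta * zeta * (S * X) * S.
      by rewrite -!mulrA ?zE !mulrA.
    have -> : 1 * C * (1 - zeta * zeta * S0 * S) = C - zeta * zeta * (C * S0) * S.
      rewrite mul1r mulrBr mulr1; congr (_ - _).
      by rewrite -!mulrA ?zE !mulrA.
    rewrite /W; non_commutative_ring.
  - have -> : 1 * C * - (zeta * S0) = - (zeta * (C * S0)).
      by rewrite mul1r mulrN mulrA zetaC -mulrA.
    rewrite /W; non_commutative_ring.
  - have -> : - (zeta * S0) * C * (1 - zeta * zeta * S0 * S) =
      - (zeta * (S0 * C)) + zeta * zeta * zeta * (S0 * (C * S0)) * S.
      rewrite mulrBr mulr1 !mulNr opprK.
      by congr (- _ + _); rewrite -!mulrA ?zE ?mulrA.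
    have -> : (1 - zeta * zeta * S0 * S) * X * (zeta * S) =
       zeta * (X * S) - zeta * zeta * zeta * (S0 * (S * X)) * S.
      rewrite mulrBl mul1r mulrBl; congr (_ - _); first by rewrite zl.
      by rewrite -!mulrA ?zE !mulrA.
    rewrite S0CS0 /Z; non_commutative_ring.
  - have -> : - (zeta * S0) * C * - (zeta * S0) = zeta * zeta * (S0 * (C * S0)).
      rewrite !(mulNr, mulrN) opprK.
      by rewrite -!mulrA ?zE !mulrA.
    rewrite S0CS0; non_commutative_ring.
rewrite DE /D !mx2M; congr mx2; rewrite ?(mul0r, mulr0, add0r, addr0) //.
- rewrite mulrBl mulrBr XC; congr (_ - _).
  have -> : zeta * zeta * W * S * X = zeta * zeta * (X * (W * S)).
    by rewrite XWS !mulrA.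
  by rewrite -!mulrA ?zE !mulrA.
- by rewrite mulNr mulrN -mulrA WC; congr (- _); rewrite !mulrA zetaC.
- rewrite (zl C) CZ -mulrA; congr (_ * _).
  by apply/esym; rewrite /Z S0E; apply: commrB; do ?apply: commrM.
Qed.

(** * Block-diagonal matrices *)

Section BlockDiagonal.
Variable K : pzRingType.

Definition diag_mx2 m n (P : 'M[K]_m) (Q : 'M[K]_n) : 'M[K]_(m + n) :=
  block_mx P 0 0 Q.

Lemma diag_mx2M m n (P P' : 'M[K]_m) (Q Q' : 'M[K]_n) :
  diag_mx2 P Q * diag_mx2 P' Q' = diag_mx2 (P * P') (Q * Q').
Proof. by rewrite -[LHS]/(_ *m _) /diag_mx2 mulmx_block !mul0mx !mulmx0 !addr0 !add0r. Qed.

Lemma diag_mx2D m n (P P' : 'M[K]_m) (Q Q' : 'M[K]_n) :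
  diag_mx2 P Q + diag_mx2 P' Q' = diag_mx2 (P + P') (Q + Q').
Proof. by rewrite /diag_mx2 add_block_mx !addr0. Qed.

Lemma diag_mx2B m n (P P' : 'M[K]_m) (Q Q' : 'M[K]_n) :
  diag_mx2 P Q - diag_mx2 P' Q' = diag_mx2 (P - P') (Q - Q').
Proof. by rewrite /diag_mx2 opp_block_mx add_block_mx !oppr0 !addr0. Qed.

Lemma diag_mx2_scalar m n (a : K) :
  (a%:M : 'M_(m + n)) = diag_mx2 (a%:M : 'M_m) (a%:M : 'M_n).
Proof. exact: scalar_mx_block. Qed.

Lemma diag_mx2A m n p (P : 'M[K]_m) (Q : 'M[K]_n) (T : 'M[K]_p) :
  diag_mx2 P (diag_mx2 Q T) =
  castmx (esym (addnA m n p), esym (addnA m n p)) (diag_mx2 (diag_mx2 P Q) T).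
Proof.
have := @block_mxA K m n p m n p P 0 0 0 Q 0 0 0 T => /=.
by rewrite !row_mx0 !col_mx0.
Qed.

Lemma diag_mx2_1A n p (P : 'M[K]_1) (Q : 'M[K]_n) (T : 'M[K]_p) :
  diag_mx2 P (diag_mx2 Q T) = diag_mx2 (diag_mx2 P Q) T.
Proof. by rewrite diag_mx2A castmx_id. Qed.

Lemma diag_mx2_2A p (P : 'M[K]_2) (Q : 'M[K]_1) (T : 'M[K]_p) :
  diag_mx2 P (diag_mx2 Q T) = diag_mx2 (diag_mx2 P Q) T.
Proof. by rewrite diag_mx2A castmx_id. Qed.

Lemma diag_mx2_mx0 (P : 'M[K]_2) (Q : 'M[K]_0) : diag_mx2 P Q = P.
Proof.
apply/matrixP => i j; rewrite [LHS]mxE; case: splitP => [i' ei|[]//].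
by rewrite mxE; case: splitP => [j' ej|[]//]; congr (P _ _); apply/val_inj.
Qed.

Lemma diag_mx2_11 (a b : K) : diag_mx2 (a%:M : 'M_1) (b%:M : 'M_1) = mx2 a 0 0 b.
Proof.
apply/matrixP => -[[|[|i]] // ilt] -[[|[|j]] // jlt]; rewrite !mxE;
  case: splitP => -[[|i'] // i'lt] //= _; rewrite !mxE;
  by case: splitP => -[[|j'] // j'lt] //= _; rewrite !mxE.
Qed.

Lemma scalar_mx_comm n (a : K) (P : 'M[K]_n) :
  (forall i j, a * P i j = P i j * a) -> a%:M * P = P * a%:M.
Proof.
move=> aP; apply/matrixP => i j; rewrite -[a%:M * P]/(_ *m _) mul_scalar_mx !mxE aP.
rewrite (bigD1 j) //= mxE eqxx big1 ?addr0 // => k /negPf kj.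
by rewrite mxE kj mulr0.
Qed.

End BlockDiagonal.

Lemma map_swap_mx (K K' : pzRingType) (g : {rmorphism K -> K'}) (zeta a : K) :
  map_mx g (swap_mx zeta a) = swap_mx (g zeta) (g a).
Proof.
apply/matrixP => -[[|[|i]] // ilt] -[[|[|j]] // jlt]; rewrite !mxE /=;
  by rewrite ?(rmorphM, rmorphN, rmorphB, rmorph1).
Qed.

Section TauMatrices.
Variables (K : pzRingType) (zeta : K).
Hypothesis zetaC : forall a, a * zeta = zeta * a.

(** The matrix of the new generator tau: a deformed transposition of the first
two families of the basis, while the previous tau, called [s], acts on the
other ones. *)
Definition tau_mx n (a s : K) : 'M[K]_(2 + n) :=
  diag_mx2 (swap_mx zeta a) (s%:M : 'M_n).

Lemma tau_mx_quadratic (n : nat) (a s : K) : ((0 < n)%N -> s * s = zeta * s + 1) ->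
  tau_mx n a s * tau_mx n a s = zeta%:M * tau_mx n a s + 1.
Proof.
move=> ss; rewrite [LHS]diag_mx2M [1](diag_mx2_scalar _ _ 1) (diag_mx2_scalar 2 n zeta).
rewrite [X in X + _]diag_mx2M diag_mx2D swap_quadratic //; congr (diag_mx2 _ _).
case: n ss => [|n] ss; first by rewrite [LHS]flatmx0 [RHS]flatmx0.
by rewrite -!rmorphM ss // !rmorphD rmorph1.
Qed.

Lemma tau_mx_comm n (a s c : K) (Q : 'M[K]_n) : a * c = c * a ->
    s%:M * Q = Q * s%:M ->
  tau_mx n a s * diag_mx2 (c%:M : 'M_2) Q = diag_mx2 (c%:M : 'M_2) Q * tau_mx n a s.
Proof.
move=> ac sQ; rewrite [LHS]diag_mx2M [RHS]diag_mx2M sQ; congr (diag_mx2 _ _).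
rewrite mx2_scalar !mx2M.
have zl x y : x * (zeta * y) = zeta * (x * y) by rewrite !mulrA zetaC.
have a1c : (a - 1) * c = c * (a - 1) by rewrite mulrBl mulrBr ac mulr1 mul1r.
congr mx2; rewrite ?(mul0r, mulr0, add0r, addr0, mulr1, mul1r) //.
- by rewrite zl -mulrA ac.
- rewrite [LHS]mulrBl [RHS]mulrBr mulr1 mul1r; congr (_ - _).
  by rewrite -!mulrA !zl ac !mulrA -(mulrA _ _ c) a1c !mulrA.
- by rewrite mulNr mulrN zl -mulrA a1c.
Qed.

Lemma tau_mx_braid (n : nat) (a b s s' : K) : s * s = zeta * s + 1 ->
    a * s = s * b + zeta * b * (a - 1) ->
    ((0 < n)%N -> s * s' * s = s' * s * s') ->
  let t := tau_mx n.+1 a s in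
  let t' : 'M_(1 + (2 + n)) := diag_mx2 (s%:M : 'M_1) (tau_mx n b s') in
  t * t' * t = t' * t * t'.
Proof.
move=> ss as_ sss t t'.
have tE : t = diag_mx2 (diag_mx2 (swap_mx zeta a) (s%:M : 'M_1)) (s%:M : 'M_n).
  by rewrite -diag_mx2_2A /t /tau_mx (diag_mx2_scalar 1 n s).
have t'E : t' = diag_mx2 (diag_mx2 (s%:M : 'M_1) (swap_mx zeta b)) (s'%:M : 'M_n).
  by rewrite /t' diag_mx2_1A.
rewrite tE t'E !(@diag_mx2M _ 3 n).
apply: (congr2 (@diag_mx2 K 3 n)); first exact: (swap_braid zetaC ss as_).
case: n sss {t t' tE t'E} => [|n] sss.
  by rewrite [LHS]flatmx0 [RHS]flatmx0.
by rewrite -!rmorphM sss.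
Qed.

End TauMatrices.

(** * Extending a morphism from a Hecke algebra to the next one *)

Section PresentedAlgebraTheory.
Variables (R : comPzRingType) (G : Type) (rel : aterm R G -> aterm R G -> Prop).

Lemma palg_ind (P : palg rel -> Prop) :
    (forall a, P (ralg_scal (palg rel) a)) -> (forall g, P (pgen rel g)) ->
    (forall u v, P u -> P v -> P (u + v)) ->
    (forall u v, P u -> P v -> P (u * v)) ->
  forall u, P u.
Proof.
move=> Ps Pg PD PM u; rewrite -[u]preprK -aeval_pgen.
by elim: (prepr u) => //= *; [exact: PD|exact: PM].
Qed.

Lemma palg_morph_eq (E : pzRingType) (p q : {rmorphism palg rel -> E}) :
    (forall a, p (ralg_scal (palg rel) a) = q (ralg_scal (palg rel) a)) ->
    (forall g, p (pgen rel g) = q (pgen rel g)) ->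
  p =1 q.
Proof.
by move=> es eg; elim/palg_ind => // u v; rewrite ?rmorphD ?rmorphM => -> ->.
Qed.

End PresentedAlgebraTheory.

Section HeckeExtension.

Variables (R : comNzRingType) (z : R) (f : {poly R}).
Local Notation H n := (hecke z f n).
Local Notation incl n := (hecke_incl z f n).
Local Notation tau n := (@ht R z f n.+2 ord_max).
Local Notation X n := (@hx R z f n.+1 ord_max).
Local Notation Xi n := (@hxi R z f n.+1 ord_max).

Lemma widen_or_max n (P : 'I_n.+1 -> Prop) :
  (forall j, P (widen_ord (leqnSn n) j)) -> P ord_max -> forall i, P i.
Proof.
move=> Pw Pm i; case: (ltnP i n) => lin.
  by have := Pw (Ordinal lin); congr P; apply/val_inj.
suff -> : i = ord_max by [].
by apply/val_inj/eqP; rewrite eqn_leq lin -ltnS ltn_ord.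
Qed.

Lemma incl_hx n (i : 'I_n) :
  incl n (hx z f i) = hx z f (widen_ord (leqnSn n) i).
Proof. exact: hecke_incl_gen. Qed.
Lemma incl_hxi n (i : 'I_n) :
  incl n (hxi z f i) = hxi z f (widen_ord (leqnSn n) i).
Proof. exact: hecke_incl_gen. Qed.
Lemma incl_ht n (j : 'I_n) :
  incl n.+1 (@ht R z f n.+1 j) = @ht R z f n.+2 (widen_ord (leqnSn n) j).
Proof.
rewrite [LHS]hecke_incl_gen; congr (pgen _ (Ht _)).
exact/val_inj.
Qed.

Lemma tau_x_tau n : tau n * (incl n.+1 (X n) * tau n) = X n.+1.
Proof. by rewrite incl_hx; apply: htxt. Qed.

Lemma tau_braid n :
  tau n.+1 * incl n.+2 (tau n) * tau n.+1 =
  incl n.+2 (tau n) * tau n.+1 * incl n.+2 (tau n).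
Proof. by rewrite incl_ht; apply/esym; rewrite -!mulrA; apply: htbraid. Qed.

(** The generators at distance more than one from the last one come from two
levels below, hence commute with it. *)
Lemma incl_ht_lt n (j : 'I_n) : (j.+1 < n)%N ->
  exists u, incl n u = @ht R z f n.+1 j.
Proof.
case: n j => [|n] j; first by case: j.
elim/widen_or_max: j => [j _|]; last by rewrite ltnn.
by exists (@ht R z f n.+1 j); apply: incl_ht.
Qed.

(** To extend [rho] to the next Hecke algebra it suffices to choose the image [T]
of the new generator tau; the image of the new x must then be T rho(x) T.  The
hypotheses on [T] are the relations that involve the new generators. *)
Section Extension.

Variables (n : nat) (E : ralg R) (rho : {rmorphism H n.+1 -> E}) (T : E).
Hypothesis rhoS : forall a, rho (ralg_scal (H n.+1) a) = ralg_scal E a.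
Hypothesis Tquad : T * T = ralg_scal E z * T + 1.
Hypothesis Tcomm : forall b, T * rho (incl n b) = rho (incl n b) * T.
Hypothesis Tbraid : forall j : 'I_n, j.+1 = n ->
  T * rho (@ht R z f n.+1 j) * T =
  rho (@ht R z f n.+1 j) * T * rho (@ht R z f n.+1 j).
Hypothesis Txcomm : forall u,
  T * (rho (X n) * T) * rho u = rho u * (T * (rho (X n) * T)).

Let Ti := T - ralg_scal E z.
Let TTi : T * Ti = 1.
Proof. by rewrite /Ti mulrBr Tquad -ralg_scalC addrC addKr. Qed.
Let TiT : Ti * T = 1.
Proof. by rewrite /Ti mulrBl Tquad addrC addKr. Qed.

Definition ext_gen (g : hgen n.+2) : E :=
  match g with
  | Hx i => if insub (i : nat) is Some j then rho (hx z f (j : 'I_n.+1))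
            else T * (rho (X n) * T)
  | Hxi i => if insub (i : nat) is Some j then rho (hxi z f (j : 'I_n.+1))
             else Ti * (rho (Xi n) * Ti)
  | Ht j => if insub (j : nat) is Some j' then rho (@ht R z f n.+1 (j' : 'I_n))
            else T
  end.

Local Arguments ext_gen : simpl never.

Let insub_widen m (j : 'I_m) : insub (widen_ord (leqnSn m) j : nat) = Some j.
Proof. exact: (valK j). Qed.
Let insub_max m : insub (@ord_max m : nat) = None :> option 'I_m.
Proof. by rewrite insubN //= ltnn. Qed.

Let ext_x j : ext_gen (Hx (widen_ord (leqnSn n.+1) j)) = rho (hx z f j).
Proof. by rewrite /ext_gen insub_widen. Qed.
Let ext_xi j : ext_gen (Hxi (widen_ord (leqnSn n.+1) j)) = rho (hxi z f j).
Proof. by rewrite /ext_gen insub_widen. Qed.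
Let ext_t (j : 'I_n) : ext_gen (@Ht n.+2 (widen_ord (leqnSn n) j)) =
  rho (@ht R z f n.+1 j).
Proof. by rewrite /ext_gen insub_widen. Qed.
Let ext_xmax : ext_gen (Hx ord_max) = T * (rho (X n) * T).
Proof. by rewrite /ext_gen insub_max. Qed.
Let ext_ximax : ext_gen (Hxi ord_max) = Ti * (rho (Xi n) * Ti).
Proof. by rewrite /ext_gen insub_max. Qed.
Let ext_tmax : ext_gen (@Ht n.+2 ord_max) = T.
Proof. by rewrite /ext_gen insub_max. Qed.
Let extE := (ext_x, ext_xi, ext_t, ext_xmax, ext_ximax, ext_tmax).

Let xV : rho (X n) * rho (Xi n) = 1.
Proof. by rewrite -rmorphM hxV rmorph1. Qed.
Let Vx : rho (Xi n) * rho (X n) = 1.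
Proof. by rewrite -rmorphM hVx rmorph1. Qed.

Lemma ext_rel s t : hecke_rel z f n.+2 s t -> aeval ext_gen s = aeval ext_gen t.
Proof.
case=> {s t} [s t|].
  case=> /=; rewrite ?rmorph1.
  - elim/widen_or_max => [i|]; rewrite !extE -?rmorphM ?hxV ?rmorph1 //.
    by rewrite -!mulrA (mulrA T Ti) TTi mul1r (mulrA (rho _)) xV mul1r.
  - elim/widen_or_max => [i|]; rewrite !extE -?rmorphM ?hVx ?rmorph1 //.
    by rewrite -!mulrA (mulrA Ti T) TiT mul1r (mulrA (rho _)) Vx mul1r.
  - elim/widen_or_max => [i|]; elim/widen_or_max => [i'|] //; rewrite !extE //.
    by rewrite -!rmorphM hxC.
  - elim/widen_or_max => [j|]; elim/widen_or_max => [i|];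
      elim/widen_or_max => [i'|] /= ei ei'; rewrite !extE -?rmorphM.
    + by congr (rho _); apply: htxt.
    + by move: (ltn_ord j); lia.
    + by move: (ltn_ord j); lia.
    + by move: (ltn_ord j); lia.
    + by move: (ltn_ord i'); lia.
    + by have -> : i = ord_max by apply/val_inj.
    + by lia.
    + by lia.
  - elim/widen_or_max => [j|]; elim/widen_or_max => [i|] /= e1 e2;
      rewrite !extE //.
    + by rewrite -!rmorphM; congr (rho _); apply: htx.
    + move: i e1 e2; elim/widen_or_max => [i|] // _ _.
      by rewrite -incl_hx Tcomm.
  - elim/widen_or_max => [j|]; rewrite !extE //.
    by rewrite -rmorphM htt rmorphD rmorph1 rmorphM rhoS.
  - elim/widen_or_max => [j|]; elim/widen_or_max => [j'|] /= e;
      rewrite !extE //; first by rewrite -!rmorphM httC.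
    + have lt_jn : (j.+1 < n)%N by move: (ltn_ord j) e; lia.
      by have [u <-] := incl_ht_lt lt_jn; rewrite Tcomm.
    + have lt_jn : (j'.+1 < n)%N by move: (ltn_ord j') e; lia.
      by have [u <-] := incl_ht_lt lt_jn; rewrite Tcomm.
  - elim/widen_or_max => [j|]; elim/widen_or_max => [j'|] /= e; rewrite !extE //.
    + by rewrite -!rmorphM; congr (rho _); apply: htbraid.
    + by rewrite !mulrA Tbraid.
    + by move: (ltn_ord j'); lia.
(* the cyclotomic relation only involves x_1, which is an old generator *)
elim/widen_or_max => [i|//] i0.
rewrite aeval_apoly /= extE rmorph0 -[RHS](rmorph0 rho) -(hcyc z f (i0 : (i : nat) = 0%N)).
by rewrite rmorph_sum; apply: eq_bigr => m _; rewrite rmorphM rhoS rmorphXn.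
Qed.

Definition hecke_ext : {rmorphism H n.+2 -> E} := plift ext_rel.

Lemma hecke_ext_scal a : hecke_ext (ralg_scal (H n.+2) a) = ralg_scal E a.
Proof. exact: plift_pclass. Qed.

Lemma hecke_ext_tau : hecke_ext (tau n) = T.
Proof. by rewrite [LHS]plift_pclass /= ext_tmax. Qed.

Lemma hecke_ext_incl u : hecke_ext (incl n.+1 u) = rho u.
Proof.
apply: (@palg_morph_eq _ _ _ E (hecke_ext \o incl n.+1) rho _ _ u) => [a|g] /=.
  by rewrite hecke_incl_scal hecke_ext_scal rhoS.
rewrite hecke_incl_gen; case: g => [i|i|j] /=.
- by rewrite [LHS]plift_pclass /= ext_x.
- by rewrite [LHS]plift_pclass /= ext_xi.
- rewrite -[RHS]ext_t; have -> : widen_ord (leq_pred n.+1) j = widen_ord (leqnSn n) j.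
    exact/val_inj.
  exact: plift_pclass.
Qed.

End Extension.
End HeckeExtension.

(** * Companion, shift and resolvent matrices *)

Section MatrixAlgebra.
Variables (R : comPzRingType) (A : ralg R) (n : nat).

Lemma mat_scalC (a : R) (P : 'M[A]_n) :
  (@scalar_mx A n \o ralg_scal A) a * P = P * (@scalar_mx A n \o ralg_scal A) a.
Proof. by apply: scalar_mx_comm => i j; apply: ralg_scalC. Qed.

Definition mat_ralg : ralg R := RAlg mat_scalC.

End MatrixAlgebra.

Section CompanionMatrices.

Variables (R : comNzRingType) (f : {poly R}) (l : nat).
Variable A : ralg R.
Local Notation fc i := (ralg_scal A f`_i).

(** The matrix N of the nilpotent shift; [geom_mx x] is (1 - N x)^-1, and
[comp_mx] has the rows of right multiplication by a root of [f] on its powers. *)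
Definition shift_mx : 'M[A]_l := \matrix_(i, j) (i == j.+1 :> nat)%:R.
Definition geom_mx (x : A) : 'M[A]_l :=
  \matrix_(i, j) if (j <= i)%N then x ^+ (i - j) else 0.
Definition comp_mx : 'M[A]_l :=
  \matrix_(i, j) if (i.+1 == l)%N then - fc j else (j == i.+1 :> nat)%:R.

Lemma shift_mulE (P : 'M[A]_l) i j : (shift_mx * P) i j =
  if insub (i : nat).-1 is Some i' then if i == 0%N :> nat then 0 else P i' j else 0.
Proof.
have lt_il : ((i : nat).-1 < l)%N by move: (ltn_ord i); lia.
rewrite insubT /= [LHS]mxE; case: eqP => [i0|/eqP i0].
  by rewrite big1 // => k _; rewrite mxE i0 mul0r.
rewrite (bigD1 (Ordinal lt_il)) //= mxE /= prednK ?lt0n // eqxx mul1r.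
rewrite big1 ?addr0 // => k ki; rewrite mxE.
case: eqP => [e|]; last by rewrite mul0r.
by case/eqP: ki; apply/val_inj; rewrite /= e.
Qed.

Lemma shift_mulS (P : 'M[A]_l) (i i' : 'I_l) j : i = i'.+1 :> nat ->
  (shift_mx * P) i j = P i' j.
Proof. by move=> e; rewrite shift_mulE e /= valK. Qed.

Lemma shift_mul0 (P : 'M[A]_l) (i : 'I_l) j : i = 0%N :> nat ->
  (shift_mx * P) i j = 0.
Proof. by move=> e; rewrite shift_mulE e /=; case: insub. Qed.

Lemma mul_shiftS (P : 'M[A]_l) i (j j' : 'I_l) : j' = j.+1 :> nat ->
  (P * shift_mx) i j = P i j'.
Proof.
move=> e; rewrite [LHS]mxE (bigD1 j') //= mxE e eqxx mulr1 big1 ?addr0 //.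
move=> k kj; rewrite mxE; case: eqP => [e'|]; last by rewrite mulr0.
by case/eqP: kj; apply/val_inj; apply: etrans e' (esym e).
Qed.

Lemma mul_shift_last (P : 'M[A]_l) i (j : 'I_l) : j.+1 = l :> nat ->
  (P * shift_mx) i j = 0.
Proof.
move=> e; rewrite [LHS]mxE big1 // => k _; rewrite mxE e.
by rewrite ltn_eqF ?mulr0 ?ltn_ord.
Qed.

Lemma comp_mulS (P : 'M[A]_l) (i i' : 'I_l) j : i' = i.+1 :> nat ->
  (comp_mx * P) i j = P i' j.
Proof.
move=> e; have il : (i.+1 == l)%N = false.
  by apply/eqP => il; move: (ltn_ord i'); lia.
rewrite [LHS]mxE (bigD1 i') //= mxE il e eqxx mul1r big1 ?addr0 //.
move=> k ki; rewrite mxE il; case: eqP => [e'|]; last by rewrite mul0r.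
by case/eqP: ki; apply/val_inj; apply: etrans e' (esym e).
Qed.

Lemma ord_pred_or (i : 'I_l) : i = 0%N :> nat \/ exists i' : 'I_l, i = i'.+1 :> nat.
Proof.
case: i => [[|i] lt_il] /=; [by left|right].
by exists (Ordinal (ltnW lt_il)).
Qed.
Lemma ord_succ_or (i : 'I_l) : i.+1 = l \/ exists i' : 'I_l, i' = i.+1 :> nat.
Proof.
have := ltn_ord i; rewrite leq_eqVlt => /orP[/eqP|lt]; first by left.
by right; exists (Ordinal lt).
Qed.

Lemma shift_scalarC (x : A) : x%:M * shift_mx = shift_mx * x%:M.
Proof.
by apply: scalar_mx_comm => i j; rewrite mxE; case: eqP;
  rewrite ?mulr1 ?mul1r ?mulr0 ?mul0r.
Qed.

Lemma comp_scalarC (x : A) : x%:M * comp_mx = comp_mx * x%:M.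
Proof.
apply: scalar_mx_comm => i j; rewrite mxE; case: eqP => _.
  by rewrite mulrN mulNr ralg_scalC.
by case: eqP; rewrite ?mulr1 ?mul1r ?mulr0 ?mul0r.
Qed.

Lemma geom_scalarC (x y : A) : x * y = y * x ->
  x%:M * geom_mx y = geom_mx y * x%:M.
Proof.
move=> xy; apply: scalar_mx_comm => i j; rewrite mxE; case: ifP => _.
  exact: commrX.
by rewrite mulr0 mul0r.
Qed.

Lemma scalar_mulE (x : A) (P : 'M[A]_l) i j : (x%:M * P) i j = x * P i j.
Proof. by rewrite -[x%:M * P]/(_ *m _) mul_scalar_mx mxE. Qed.

Lemma shift_geomC (x : A) : shift_mx * geom_mx x = geom_mx x * shift_mx.
Proof.
apply/matrixP => i j; have [i0|[i' ei]] := ord_pred_or i.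
  rewrite shift_mul0 //; have [jl|[j' ej]] := ord_succ_or j.
    by rewrite mul_shift_last.
  by rewrite (mul_shiftS _ _ ej) mxE ej i0.
rewrite (shift_mulS _ _ ei); have [jl|[j' ej]] := ord_succ_or j.
  rewrite mul_shift_last // mxE ifF //; apply/negP; move: (ltn_ord i); lia.
by rewrite (mul_shiftS _ _ ej) !mxE ej ei ltnS subSS.
Qed.

Lemma geom_mxE (x : A) : geom_mx x = 1 + shift_mx * x%:M * geom_mx x.
Proof.
apply/matrixP => i j; rewrite -shift_scalarC -mulrA [RHS]mxE scalar_mulE.
have [i0|[i' ei]] := ord_pred_or i.
  rewrite shift_mul0 // mulr0 addr0 !mxE -val_eqE /= i0.
  by case: (nat_of_ord j).
rewrite (shift_mulS _ _ ei) !mxE -val_eqE /= ei.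
case: (ltngtP j i'.+1) => ji.
- by rewrite add0r -ltnS ji subSn // exprS.
- by rewrite add0r leqNgt ltnW ?mulr0.
- by rewrite ji subnn expr0 ifN ?mulr0 ?addr0 // -ltnNge.
Qed.

Lemma shift_comp_shift : shift_mx * comp_mx * shift_mx = shift_mx.
Proof.
rewrite -mulrA; apply/matrixP => i j; have [i0|[i' ei]] := ord_pred_or i.
  by rewrite shift_mul0 // mxE i0.
by rewrite (shift_mulS _ _ ei) (comp_mulS _ _ ei).
Qed.

Lemma geom_resolvent (x : A) :
  geom_mx x * (1 - shift_mx * x%:M) = 1 /\ (1 - shift_mx * x%:M) * geom_mx x = 1.
Proof.
split; last by rewrite mulrBl mul1r {1}(geom_mxE x) addrK.
rewrite mulrBr mulr1 mulrA -shift_geomC -mulrA -geom_scalarC // mulrA.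
by rewrite {1}(geom_mxE x) addrK.
Qed.

Hypotheses (szf : size f = l.+1) (f_monic : f`_l = 1).

(** 1 - N C is the projection onto the coordinate 0, and 1 - C N has all its
rows equal to 0 except the last one, where the coefficients of f appear: both
sides have a single nonzero entry, and there the identity reads f(x) = 0. *)
Lemma geom_comp (x : A) : \sum_(m < size f) fc m * x ^+ m = 0 ->
  (1 - comp_mx * shift_mx) * x%:M * geom_mx x * (1 - shift_mx * comp_mx) =
  comp_mx * (1 - shift_mx * comp_mx).
Proof.
move=> fx0.
have VE (P : 'M[A]_l) i j : (P * (1 - shift_mx * comp_mx)) i j =
    if j == 0%N :> nat then P i j else 0.
  have Vij (k : 'I_l) : (1 - shift_mx * comp_mx) k j =
      ((k == j) && (j == 0%N :> nat))%:R.
    rewrite [LHS]mxE [in X in _ + X]mxE mxE.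
    have [k0|[k' ek]] := ord_pred_or k.
      rewrite shift_mul0 // subr0; congr (_%:R).
      by case: eqP => // <-; rewrite k0.
    rewrite (shift_mulS _ _ ek) mxE ifF; last first.
      by apply/negP; move: (ltn_ord k); lia.
    rewrite -[k == j]val_eqE /= -ek [(j : nat) == k]eq_sym subrr.
    by case: eqP => // <-; rewrite ek.
  rewrite [LHS]mxE (bigD1 j) //= Vij eqxx /= big1 ?addr0; last first.
    by move=> k /negPf kj; rewrite Vij kj mulr0.
  by case: eqP; rewrite ?mulr1 ?mulr0.
have WE (P : 'M[A]_l) i j : ((1 - comp_mx * shift_mx) * P) i j =
    if i.+1 == l then \sum_(k < l) fc k.+1 * P k j else 0.
  have Wik (k : 'I_l) : (1 - comp_mx * shift_mx) i k =
      if i.+1 == l then fc k.+1 else 0.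
    rewrite [LHS]mxE [in X in _ + X]mxE mxE.
    have [kl|[k' ek]] := ord_succ_or k.
      rewrite mul_shift_last // subr0 kl f_monic rmorph1 -val_eqE /=.
      by rewrite -eqSS kl; case: eqP.
    rewrite (mul_shiftS _ _ ek) mxE ek -val_eqE /= eqSS.
    case: (i.+1 =P l) => il; last by rewrite eq_sym subrr.
    rewrite opprK [_ == _](_ : _ = false) ?add0r //.
    by apply/eqP; move: (ltn_ord k'); lia.
  rewrite [LHS]mxE; case: eqP => il.
    by apply: eq_bigr => k _; rewrite Wik il eqxx.
  by rewrite big1 // => k _; rewrite Wik ifN ?mul0r //; apply/eqP.
apply/matrixP => i j; rewrite [LHS]VE [RHS]VE; case: eqP => // j0.
rewrite -mulrA WE mxE; case: eqP => il; last by rewrite j0.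
have {}fx0 : \sum_(k < l) fc k.+1 * x ^+ k.+1 = - fc 0.
  apply/eqP; rewrite -addr_eq0 addrC; apply/eqP; rewrite -[RHS]fx0 szf.
  by rewrite big_ord_recl expr0 mulr1; congr (_ + _).
rewrite j0 -fx0; apply: eq_bigr => k _.
by rewrite scalar_mulE mxE j0 /= subn0 exprS.
Qed.

Lemma comp_powE (k : nat) (i j : 'I_l) : i = 0%N :> nat -> (k < l)%N ->
  (comp_mx ^+ k) i j = (j == k :> nat)%:R.
Proof.
elim: k i j => [|k IHk] i j i0 kl.
  by rewrite expr0 mxE -val_eqE /= i0 eq_sym.
have kl' := ltnW kl.
rewrite exprSr [LHS]mxE (bigD1 (Ordinal kl')) //= IHk // eqxx mul1r big1 ?addr0.
  by rewrite mxE /= ltn_eqF // eq_sym.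
move=> k' kk; rewrite IHk //; case: eqP => e; last by rewrite mul0r.
by case/eqP: kk; apply/val_inj.
Qed.

(** The first row of f(C) vanishes because the first rows of C^0, ..., C^(l-1) are
unit vectors and that of C^l is the last row of C; any other row of f(C) is
the first row of f(C) C^i. *)
Lemma comp_mx_root : \sum_(m < size f) (fc m)%:M * comp_mx ^+ m = 0.
Proof.
set P := LHS.
have row0 (i j : 'I_l) : i = 0%N :> nat -> P i j = 0.
  move=> i0; rewrite /P szf big_ord_recr /= f_monic rmorph1 mul1r mxE summxE.
  have l_gt0 : (0 < l)%N := leq_ltn_trans (leq0n i) (ltn_ord i).
  have lp : (l.-1 < l)%N by rewrite prednK.
  have -> : (comp_mx ^+ l) i j = - fc j.
    have -> : comp_mx ^+ l = comp_mx ^+ l.-1 * comp_mx.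
      by rewrite -exprSr; congr (_ ^+ _); rewrite prednK.
    rewrite [LHS]mxE (bigD1 (Ordinal lp)) //=.
    rewrite comp_powE // eqxx mul1r big1 ?addr0.
      by rewrite mxE /= prednK // eqxx.
    move=> k kk; rewrite comp_powE //; case: eqP => e; last by rewrite mul0r.
    by case/eqP: kk; apply/val_inj.
  rewrite (bigD1 j) //= scalar_mulE comp_powE // eqxx mulr1 big1 ?addr0 ?subrr //.
  move=> k kj; rewrite scalar_mulE comp_powE // eq_sym.
  by rewrite [(k : nat) == j](negPf kj) mulr0.
have PC m : P * comp_mx ^+ m = comp_mx ^+ m * P.
  rewrite /P mulr_suml mulr_sumr; apply: eq_bigr => k _.
  rewrite -mulrA -exprD addnC exprD !mulrA; congr (_ * _).
  exact/commrX/comp_scalarC.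
apply/matrixP => i j; rewrite [RHS]mxE.
have l_gt0 : (0 < l)%N := leq_ltn_trans (leq0n i) (ltn_ord i).
pose o := Ordinal l_gt0.
have -> : P i j = (comp_mx ^+ i * P) o j.
  rewrite [RHS]mxE (bigD1 i) //= comp_powE // eqxx mul1r big1 ?addr0 // => k ki.
  by rewrite comp_powE // [(k : nat) == i](negPf ki) mul0r.
by rewrite -PC [LHS]mxE big1 // => k _; rewrite row0 // mul0r.
Qed.

End CompanionMatrices.

(** * Generation of cyclotomic Hecke algebras *)

(** Dividing f(x) = 0 by the invertible constant coefficient expresses the
inverse of x as a polynomial of degree less than l, whose top coefficient is
the source of the normalization constant. *)
Lemma root_inverse (R : comUnitRingType) (f : {poly R}) (l : nat) (A : ralg R)
    (x : A) : size f = l.+1 -> f`_0 \is a GRing.unit ->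
    \sum_(m < size f) ralg_scal A f`_m * x ^+ m = 0 ->
  let y := - (ralg_scal A (f`_0)^-1 *
    \sum_(m < l) ralg_scal A f`_m.+1 * x ^+ m) in
  x * y = 1 /\ y * x = 1.
Proof.
move=> szf f0 fx0 y; have yx : y * x = x * y.
  rewrite /y mulrN mulNr; congr (- _); rewrite [RHS]mulrA -ralg_scalC -!mulrA.
  congr (_ * _); rewrite mulr_suml mulr_sumr; apply: eq_bigr => m _.
  by rewrite [RHS]mulrA -ralg_scalC -!mulrA -exprSr -exprS.
suff xy : y * x = 1 by split; rewrite -?yx.
rewrite /y mulNr -mulrA -mulrN -[RHS](rmorph1 (ralg_scal A)) -(mulVr f0) rmorphM.
congr (_ * _); apply/esym/eqP; rewrite -addr_eq0; apply/eqP; rewrite -[RHS]fx0 szf.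
rewrite big_ord_recl expr0 mulr1 mulr_suml; congr (_ + _); apply: eq_bigr => m _.
by rewrite -mulrA -exprSr.
Qed.

Section MorphismCommutation.
Variables (A B : pzRingType) (rho : {rmorphism A -> B}) (d : B).

Lemma comm_rmorphD u v : d * rho u = rho u * d -> d * rho v = rho v * d ->
  d * rho (u + v) = rho (u + v) * d.
Proof. by rewrite rmorphD; apply: commrD. Qed.

Lemma comm_rmorphM u v : d * rho u = rho u * d -> d * rho v = rho v * d ->
  d * rho (u * v) = rho (u * v) * d.
Proof. by rewrite rmorphM; apply: commrM. Qed.

Lemma comm_rmorphV u v : u * v = 1 -> v * u = 1 -> d * rho u = rho u * d ->
  d * rho v = rho v * d.
Proof.
move=> uv vu du; rewrite -[LHS]mul1r -(rmorph1 rho) -vu rmorphM.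
by rewrite -mulrA (mulrA (rho u)) -du -!mulrA -rmorphM uv rmorph1 mulr1.
Qed.

End MorphismCommutation.

Section HeckeGeneration.
Variables (R : comNzRingType) (z : R) (f : {poly R}).
Local Notation H n := (hecke z f n).
Local Notation incl n := (hecke_incl z f n).
Local Notation tau n := (@ht R z f n.+2 ord_max).
Local Notation taui n := (@hti R z f n.+2 ord_max).
Local Notation xlast n := (@hx R z f n.+1 ord_max).
Local Notation xilast n := (@hxi R z f n.+1 ord_max).

Lemma taui_xi_taui n : taui n * (incl n.+1 (xilast n) * taui n) = xilast n.+1.
Proof.
rewrite -[LHS]mulr1 -(hxV z f ord_max) -tau_x_tau -!mulrA.
rewrite [X in _ * (_ * X)]mulrA hKt mul1r (mulrA (incl _ _) (incl _ _)).
by rewrite -rmorphM hVx rmorph1 mul1r mulrA hKt mul1r.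
Qed.

(** Only one new generator is needed at each step, since x_{n+2}^(+-1) is
tau^(+-1) x_{n+1}^(+-1) tau^(+-1) and tau^-1 = tau - z. *)
Lemma hecke_gen_ind n (P : H n.+2 -> Prop) :
    (forall u, P (incl n.+1 u)) -> P (tau n) ->
    (forall u v, P u -> P v -> P (u + v)) ->
    (forall u v, P u -> P v -> P (u * v)) ->
  forall u, P u.
Proof.
move=> Pi Pt PD PM; have Ps a : P (ralg_scal (H n.+2) a).
  by rewrite -hecke_incl_scal; apply: Pi.
have Pti : P (taui n) by rewrite /hti -rmorphN; apply: PD.
apply: palg_ind => // -[|i|j].
- elim/widen_or_max => [i|]; rewrite -/(hx z f _) -?incl_hx -?tau_x_tau //.
  by apply: (PM) => //; apply: PM.
- move: i; elim/widen_or_max => [i|]; rewrite -/(hxi z f _) -?incl_hxi //.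
  by rewrite -taui_xi_taui; apply: (PM) => //; apply: PM.
- by move: j; elim/widen_or_max => [j|]; rewrite -/(ht z f _) -?incl_ht.
Qed.

Lemma hecke1_gen_ind (P : H 1 -> Prop) :
    (forall a, P (ralg_scal (H 1) a)) -> P (xlast 0) -> P (xilast 0) ->
    (forall u v, P u -> P v -> P (u + v)) ->
    (forall u v, P u -> P v -> P (u * v)) ->
  forall u, P u.
Proof.
move=> Ps Px Pxi PD PM; apply: palg_ind => // -[|i|j]; last by case: j.
  by elim/widen_or_max => [[]|].
by move: i; elim/widen_or_max => [[]|].
Qed.

Lemma hecke0_scal (u : H 0) : exists a, u = ralg_scal (H 0) a.
Proof.
move: u; apply: palg_ind => [a|[[]|[]|[]]//|u v [a ->] [b ->]|u v [a ->] [b ->]].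
- by exists a.
- by exists (a + b); rewrite rmorphD.
- by exists (a * b); rewrite rmorphM.
Qed.

(** At least two levels above H_0, the element tau x tau commutes with the
previous Hecke algebra already by the braid relation: the old x is itself
conjugated from below by the old tau. *)
Lemma txt_comm n (E : pzRingType) (rho : {rmorphism H n.+2 -> E}) (T : E) :
    (forall b, T * rho (incl n.+1 b) = rho (incl n.+1 b) * T) ->
    T * rho (tau n) * T = rho (tau n) * T * rho (tau n) ->
  forall u, T * (rho (xlast n.+1) * T) * rho u = rho u * (T * (rho (xlast n.+1) * T)).
Proof.
move=> Tb Tt; set D := T * _.
elim/hecke_gen_ind => [b||u v Du Dv|u v Du Dv].
- rewrite /D -!mulrA Tb (mulrA (rho _)) -rmorphM hx_last_comm rmorphM.
  by rewrite !mulrA Tb.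
- rewrite /D -tau_x_tau !rmorphM.
  set t := rho (tau n) in Tt *; set y := rho _.
  have -> : T * (t * (y * t) * T) * t = T * t * y * (t * T * t) by rewrite !mulrA.
  have -> : t * (T * (t * (y * t) * T)) = (t * T * t) * y * t * T by rewrite !mulrA.
  by rewrite -Tt -!mulrA (mulrA y T) -Tb !mulrA.
- exact: comm_rmorphD.
- exact: comm_rmorphM.
Qed.

End HeckeGeneration.

(** * The regular representation over the previous Hecke algebra *)

Section RegularRepresentation.

Variables (R : comUnitRingType) (z : R) (f : {poly R}) (l : nat).
Hypotheses (szf : size f = l.+1) (f_monic : f`_l = 1).
Hypothesis f0_unit : f`_0 \is a GRing.unit.

Local Notation H n := (hecke z f n).
Local Notation incl n := (hecke_incl z f n).
Local Notation tau n := (@ht R z f n.+2 ord_max).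
Local Notation taui n := (@hti R z f n.+2 ord_max).
Local Notation xlast n := (@hx R z f n.+1 ord_max).
Local Notation xilast n := (@hxi R z f n.+1 ord_max).

(** A block of [block_ralg n] runs over the exponents a < l, and the n + 1 blocks
of [rep_ralg n] over the coset representatives tau_n^-1 ... tau_i^-1. *)
Definition block_ralg n : ralg R := mat_ralg (H n) l.
Definition rep_ralg n : ralg R := mat_ralg (block_ralg n) n.+1.

Local Notation K n := (block_ralg n).
Local Notation E n := (rep_ralg n).

Definition lift_block n : {rmorphism K n -> K n.+1} := map_mx (incl n).

Section RepDiag.
Variables (n : nat) (rho : {rmorphism H n.+1 -> E n}).
(** Right multiplication by an element of the previous Hecke algebra: it commutes
with the powers of the new x, and on tau^-1 b it acts as on b. *)
Definition rep_diag_fun (u : H n.+1) : E n.+1 :=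
  diag_mx2 ((u%:M : K n.+1)%:M : 'M_1) (map_mx (lift_block n) (rho u)).
Lemma rep_diag_zmod_morphism : zmod_morphism rep_diag_fun.
Proof.
move=> u v; rewrite /rep_diag_fun !rmorphB; exact: esym (@diag_mx2B (K n.+1) 1 n.+1 _ _ _ _).
Qed.
Lemma rep_diag_monoid_morphism : monoid_morphism rep_diag_fun.
Proof.
split=> [|u v]; rewrite /rep_diag_fun ?rmorph1 ?rmorphM.
  exact: esym (@diag_mx2_scalar (K n.+1) 1 n.+1 1).
exact: esym (@diag_mx2M (K n.+1) 1 n.+1 _ _ _ _).
Qed.
HB.instance Definition _ := GRing.isZmodMorphism.Build (H n.+1) (E n.+1)
  rep_diag_fun rep_diag_zmod_morphism.
HB.instance Definition _ := GRing.isMonoidMorphism.Build (H n.+1) (E n.+1)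
  rep_diag_fun rep_diag_monoid_morphism.
Definition rep_diag : {rmorphism H n.+1 -> E n.+1} := rep_diag_fun.

Lemma rep_diagE u : rep_diag u =
  diag_mx2 ((u%:M : K n.+1)%:M : 'M_1) (map_mx (lift_block n) (rho u)).
Proof. by []. Qed.

Lemma rep_diag_scal : (forall a, rho (ralg_scal (H n.+1) a) = ralg_scal (E n) a) ->
  forall a, rep_diag (ralg_scal (H n.+1) a) = ralg_scal (E n.+1) a.
Proof.
move=> rhoS a; rewrite rep_diagE rhoS -[RHS]/((_%:M : K n.+1)%:M).
rewrite -[ralg_scal (E n) a]/((_%:M : K n)%:M) (map_scalar_mx (lift_block n)).
rewrite -[lift_block n _]/(map_mx _ _) map_scalar_mx hecke_incl_scal.
exact: esym (@diag_mx2_scalar (K n.+1) 1 n.+1 _).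
Qed.
End RepDiag.

(** Right multiplication by tau on tau^-1 s^-1 b, where s is the previous
generator, is left multiplication by s; the value for n = 0 is arbitrary, as
there is no such family. *)
Definition tau_scalar n : H n.+1 :=
  match n with 0 => 1 | m.+1 => tau m end.

Definition rep_tau n : E n.+1 :=
  @tau_mx (K n.+1) (ralg_scal (K n.+1) z) n (geom_mx l (xlast n)) (tau_scalar n)%:M.

Lemma scalZC (A : ralg R) (a : R) (u : A) : u * ralg_scal A a = ralg_scal A a * u.
Proof. by rewrite ralg_scalC. Qed.

Section BaseRepresentation.

Local Notation C := (comp_mx f l (H 0) : K 0).

Definition comp_inv : K 0 := - (ralg_scal (K 0) (f`_0)^-1 *
  \sum_(m < l) ralg_scal (K 0) f`_m.+1 * C ^+ m).

Lemma comp_invK : C * comp_inv = 1 /\ comp_inv * C = 1.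
Proof.
exact: (@root_inverse R f l (K 0) C szf f0_unit (comp_mx_root (H 0) szf f_monic)).
Qed.

Definition base_gen (g : hgen 1) : E 0 :=
  match g with
  | Hx _ => C%:M
  | Hxi _ => comp_inv%:M
  | Ht _ => 0
  end.

Lemma base_rel s t : hecke_rel z f 1 s t -> aeval base_gen s = aeval base_gen t.
Proof.
have [CV VC] := comp_invK.
case=> {s t} [s t|i _].
  have E1 : aeval base_gen (AScal 1) = 1 by apply: rmorph1.
  case=> [i|i|i i'|j|j|j|j|j]; try case: (notF (ltn_ord j)).
  - apply: etrans (esym (rmorphM (@scalar_mx (K 0) 1) _ _)) _; rewrite CV E1; exact: rmorph1.
  - apply: etrans (esym (rmorphM (@scalar_mx (K 0) 1) _ _)) _; rewrite VC E1; exact: rmorph1.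
  - by [].
rewrite aeval_apoly [RHS]rmorph0 /=.
rewrite -[RHS](rmorph0 (@scalar_mx (K 0) 1)) -(comp_mx_root (H 0) szf f_monic).
by rewrite rmorph_sum; apply: eq_bigr => m _; rewrite rmorphM rmorphXn.
Qed.

Definition base_rep : {rmorphism H 1 -> E 0} := plift base_rel.

End BaseRepresentation.

(** The recursive construction of [rho] is recorded, because its entries are
computed by induction along it. *)
Fixpoint is_rep n : {rmorphism H n.+1 -> E n} -> Prop :=
  match n with
  | 0 => fun rho => (forall a, rho (ralg_scal (H 1) a) = ralg_scal (E 0) a) /\
      rho (xlast 0) = (comp_mx f l (H 0) : K 0)%:M
  | m.+1 => fun rho => exists rho' : {rmorphism H m.+1 -> E m},
     [/\ is_rep rho', forall a, rho (ralg_scal (H m.+2) a) = ralg_scal (E m.+1) a,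
         forall u, rho (incl m.+1 u) = rep_diag rho' u &
         rho (tau m) = rep_tau m]
  end.

Lemma is_rep_scal n (rho : {rmorphism H n.+1 -> E n}) : is_rep rho ->
  forall a, rho (ralg_scal (H n.+1) a) = ralg_scal (E n) a.
Proof. by case: n rho => [|n] rho /= [] // rho' []. Qed.

Lemma tau_scalar_quadratic n : (0 < n)%N ->
  tau_scalar n * tau_scalar n = ralg_scal (H n.+1) z * tau_scalar n + 1.
Proof. by case: n => // n _; apply: htt. Qed.

Lemma map_lift_geom n (x : H n) :
  map_mx (incl n) (geom_mx l x) = geom_mx l (incl n x).
Proof.
by apply/matrixP => i j; rewrite !mxE; case: ifP; rewrite ?rmorph0 ?rmorphXn.
Qed.
Lemma map_lift_comp n : map_mx (incl n) (comp_mx f l (H n)) = comp_mx f l (H n.+1).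
Proof.
apply/matrixP => i j; rewrite !mxE; case: ifP => _; last by rewrite rmorph_nat.
by rewrite rmorphN hecke_incl_scal.
Qed.

Lemma rep_tau_quadratic n : rep_tau n * rep_tau n =
  ralg_scal (E n.+1) z * rep_tau n + 1.
Proof.
apply: (@tau_mx_quadratic (K n.+1) (ralg_scal (K n.+1) z)) => [a|n_gt0].
  exact: scalZC.
by rewrite -rmorphM tau_scalar_quadratic // rmorphD rmorph1 rmorphM.
Qed.

Lemma rep_diag_incl n (rho : {rmorphism H n.+2 -> E n.+1})
    (rho' : {rmorphism H n.+1 -> E n}) :
    (forall u, rho (incl n.+1 u) = rep_diag rho' u) ->
  forall u, rep_diag rho (incl n.+1 u) =
    @diag_mx2 (K n.+2) 2 n.+1 (((incl n.+1 u)%:M : K n.+2)%:M)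
      (map_mx (lift_block n.+1) (map_mx (lift_block n) (rho' u))).
Proof.
move=> rho_incl u; rewrite rep_diagE rho_incl rep_diagE.
rewrite (@map_block_mx _ _ (lift_block n.+1) 1 n.+1 1 n.+1) !map_mx0.
rewrite (map_scalar_mx (lift_block n.+1)) -[lift_block _ _%:M]/(map_mx _ _).
rewrite map_scalar_mx (@diag_mx2_scalar (K n.+2) 1 1).
exact: (@diag_mx2_1A (K n.+2) 1 n.+1 _ _ _).
Qed.

Lemma rep_tau_comm n (rho : {rmorphism H n.+1 -> E n}) : is_rep rho ->
  forall b, rep_tau n * rep_diag rho (incl n b) =
            rep_diag rho (incl n b) * rep_tau n.
Proof.
move=> rep_rho b; case: n rho rep_rho b => [|n] rho rep_rho b.
  have [a ->] := hecke0_scal b.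
  by rewrite hecke_incl_scal rep_diag_scal ?ralg_scalC //; apply: is_rep_scal.
have [rho' [_ _ rho_incl _]] := rep_rho.
rewrite (rep_diag_incl rho_incl).
apply: (@tau_mx_comm (K n.+2) (ralg_scal (K n.+2) z)).
- by move=> a; apply: scalZC.
- exact/esym/geom_scalarC/esym/hx_last_comm.
apply: scalar_mx_comm => i j; rewrite !mxE.
apply: scalar_mx_comm => p q; rewrite /lift_block /= !mxE.
exact: ht_last_comm.
Qed.

Lemma geom_twist n : let s : K n.+2 := (tau n)%:M in
  let a : K n.+2 := geom_mx l (xlast n.+1) in
  let b : K n.+2 := geom_mx l (incl n.+1 (xlast n)) in
  a * s = s * b + ralg_scal (K n.+2) z * b * (a - 1).
Proof.
move=> s a b; set N : K n.+2 := shift_mx l (H n.+2).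
set x : K n.+2 := (xlast n.+1)%:M; set y : K n.+2 := (incl n.+1 (xlast n))%:M.
have [a1 a2] := geom_resolvent l (xlast n.+1).
have [b1 b2] := geom_resolvent l (incl n.+1 (xlast n)).
apply: (@resolvent_twist _ _ a b s (N * x) (N * y) _ _ _ _ a1 a2 b1 b2).
- by move=> c; apply: scalZC.
- by rewrite -rmorphM htt rmorphD rmorph1 rmorphM.
- rewrite mulrA shift_scalarC -!mulrA; congr (_ * _).
  by rewrite -!rmorphM tau_x_tau.
- rewrite -!mulrA; congr (_ * _).
  rewrite (mulrA x) (mulrA y) !shift_scalarC -!mulrA; congr (_ * _).
  by rewrite -!rmorphM hx_last_comm.
Qed.

Lemma rep_tau_braid n (rho : {rmorphism H n.+2 -> E n.+1}) : is_rep rho ->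
  rep_tau n.+1 * rep_diag rho (tau n) * rep_tau n.+1 =
  rep_diag rho (tau n) * rep_tau n.+1 * rep_diag rho (tau n).
Proof.
move=> [rho' [_ _ _ rho_tau]].
have -> : rep_diag rho (tau n) = @diag_mx2 (K n.+2) 1 n.+2 (((tau n)%:M : K n.+2)%:M)
    (tau_mx (ralg_scal (K n.+2) z) n (geom_mx l (incl n.+1 (xlast n)))
      (incl n.+1 (tau_scalar n))%:M).
  rewrite rep_diagE rho_tau; congr (@diag_mx2 _ 1 n.+2 _ _).
  rewrite (@map_block_mx _ _ (lift_block n.+1) 2 n 2 n) !map_mx0.
  rewrite (map_scalar_mx (lift_block n.+1)) -[lift_block _ _%:M]/(map_mx _ _).
  rewrite map_scalar_mx /tau_mx /diag_mx2; congr (@block_mx _ 2 n 2 n _ _ _ _).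
  rewrite (map_swap_mx (lift_block n.+1)) -map_lift_geom; congr (swap_mx _ _).
  by rewrite -[LHS]/(map_mx _ _%:M) map_scalar_mx hecke_incl_scal.
apply: (@tau_mx_braid (K n.+2) (ralg_scal (K n.+2) z)).
- by move=> a; apply: scalZC.
- by rewrite -rmorphM htt rmorphD rmorph1 rmorphM.
- exact: geom_twist.
- case: n {rho rho' rho_tau} => // n _.
  by rewrite -!rmorphM tau_braid.
Qed.

(** At the first step no braid relation is available, and the cyclotomic relation
f(x_1) = 0 is what makes x_1 and x_2 commute. *)
Lemma rep_tau_type_B (rho : {rmorphism H 1 -> E 0}) : is_rep rho ->
  let T := rep_tau 0 in
  forall u, T * (rep_diag rho (xlast 0) * T) * rep_diag rho u =
            rep_diag rho u * (T * (rep_diag rho (xlast 0) * T)).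
Proof.
move=> rep_rho T; have [rhoS rho_x] := rep_rho.
pose X : K 1 := (xlast 0)%:M; pose C : K 1 := comp_mx f l (H 1).
have DE : rep_diag rho (xlast 0) = mx2 X 0 0 C.
  rewrite rep_diagE rho_x (map_scalar_mx (lift_block 0)).
  by rewrite -[lift_block 0 _]/(map_mx _ _) map_lift_comp diag_mx2_11.
have TE : T = swap_mx (ralg_scal (K 1) z) (geom_mx l (xlast 0)).
  exact: diag_mx2_mx0.
have Tx : GRing.comm (T * (rep_diag rho (xlast 0) * T)) (rep_diag rho (xlast 0)).
  have XC : X * C = C * X := comp_scalarC f l (xlast 0).
  have XN := shift_scalarC l (xlast 0).
  have XS : X * geom_mx l (xlast 0) = geom_mx l (xlast 0) * X.
    exact: (geom_scalarC l (erefl (xlast 0 * xlast 0))).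
  have WV := geom_comp szf f_monic (hcyc z f (i := ord_max) erefl).
  have := @swap_type_B (K 1) (ralg_scal (K 1) z) (shift_mx l (H 1)) C X
    (geom_mx l (xlast 0)) (fun c => scalZC z c) XN XS XC (shift_geomC l (xlast 0))
    (geom_mxE l (xlast 0)) (shift_comp_shift f l (H 1)) WV.
  rewrite /GRing.comm DE TE (mulrA (swap_mx _ _) (mx2 _ _ _ _)); exact.
elim/hecke1_gen_ind => [a|||u v Du Dv|u v Du Dv].
- rewrite (rep_diag_scal rhoS); exact/esym/ralg_scalC.
- exact: Tx.
- exact: comm_rmorphV (hxV z f ord_max) (hVx z f ord_max) Tx.
- exact: comm_rmorphD Du Dv.
- exact: comm_rmorphM Du Dv.
Qed.

Lemma rep_tau_braid_gen n (rho : {rmorphism H n.+1 -> E n}) (j : 'I_n) :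
    is_rep rho -> j.+1 = n ->
  rep_tau n * rep_diag rho (@ht R z f n.+1 j) * rep_tau n =
  rep_diag rho (@ht R z f n.+1 j) * rep_tau n * rep_diag rho (@ht R z f n.+1 j).
Proof.
case: n rho j => [|n] rho j rep_rho jn; first case: (notF (ltn_ord j)).
have -> : j = ord_max by apply/val_inj/(succn_inj jn).
exact: rep_tau_braid.
Qed.

Lemma rep_tau_x_comm n (rho : {rmorphism H n.+1 -> E n}) (u : H n.+1) : is_rep rho ->
  rep_tau n * (rep_diag rho (xlast n) * rep_tau n) * rep_diag rho u =
  rep_diag rho u * (rep_tau n * (rep_diag rho (xlast n) * rep_tau n)).
Proof.
case: n rho u => [|n] rho u rep_rho; first exact: rep_tau_type_B.
exact: txt_comm (rep_tau_comm rep_rho) (rep_tau_braid rep_rho) u.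
Qed.

(** The induction step extends [rep_diag rho], with [rep_tau n] as image of the
new generator. *)
Theorem regular_rep n : exists rho : {rmorphism H n.+1 -> E n}, is_rep rho.
Proof.
elim: n => [|n [rho rep_rho]].
  exists base_rep; split; first by move=> a; apply: plift_pclass.
  exact: plift_pclass.
exists (hecke_ext (rep_diag_scal (is_rep_scal rep_rho)) (rep_tau_quadratic n)
  (rep_tau_comm rep_rho) (fun j => rep_tau_braid_gen rep_rho)
  (fun u => rep_tau_x_comm u rep_rho)).
exists rho; split=> //; first exact: hecke_ext_scal.
  exact: hecke_ext_incl.
exact: hecke_ext_tau.
Qed.

End RegularRepresentation.

(** * First rows of the representing matrices *)

Section FirstRows.
Variables (K : pzRingType) (zeta : K) (n : nat) (a s : K).
Local Notation i0 := (ord0 : 'I_n.+2).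
Local Notation i1 := (lift ord0 ord0 : 'I_n.+2).
Local Notation T := (tau_mx zeta n a s : 'M_n.+2).

Lemma tau_mx_row0 (P : 'M[K]_n.+2) j : (T * P) i0 j = zeta * a * P i0 j + P i1 j.
Proof.
have -> : i1 = lshift n (lift ord0 ord0 : 'I_2) by apply/val_inj.
have -> : i0 = lshift n (ord0 : 'I_2) by apply/val_inj.
rewrite -[T * P]/(_ *m _) mxE (@big_split_ord _ _ _ 2 n) /= [X in _ + X]big1 ?addr0.
  by rewrite 2!big_ord_recl big_ord0 addr0 !(@block_mxEul K 2 n 2 n) !mxE mul1r.
by move=> k _; rewrite (@block_mxEur K 2 n 2 n) mxE mul0r.
Qed.

Lemma mul_tau_mx_col0 (P : 'M[K]_n.+2) i : (P * T) i i0 =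
  P i i0 * (zeta * a) + P i i1 * (1 - zeta * zeta * (a - 1) * a).
Proof.
have -> : i1 = lshift n (lift ord0 ord0 : 'I_2) by apply/val_inj.
have -> : i0 = lshift n (ord0 : 'I_2) by apply/val_inj.
rewrite -[P * T]/(_ *m _) mxE (@big_split_ord _ _ _ 2 n) /= [X in _ + X]big1 ?addr0.
  by rewrite 2!big_ord_recl big_ord0 addr0 !(@block_mxEul K 2 n 2 n) !mxE.
by move=> k _; rewrite (@block_mxEdl K 2 n 2 n) mxE mulr0.
Qed.

Lemma mul_tau_mx_col1 (P : 'M[K]_n.+2) i : (P * T) i i1 =
  P i i0 - P i i1 * (zeta * (a - 1)).
Proof.
have -> : i1 = lshift n (lift ord0 ord0 : 'I_2) by apply/val_inj.
have -> : i0 = lshift n (ord0 : 'I_2) by apply/val_inj.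
rewrite -[P * T]/(_ *m _) mxE (@big_split_ord _ _ _ 2 n) /= [X in _ + X]big1 ?addr0.
  by rewrite 2!big_ord_recl big_ord0 addr0 !(@block_mxEul K 2 n 2 n) !mxE mulr1 mulrN.
by move=> k _; rewrite (@block_mxEdl K 2 n 2 n) mxE mulr0.
Qed.

Lemma mul_tau_mx_col2 (P : 'M[K]_n.+2) i (j : 'I_n) :
  (P * T) i (lift ord0 (lift ord0 j)) = P i (lift ord0 (lift ord0 j)) * s.
Proof.
have -> : lift ord0 (lift ord0 j) = rshift 2 j :> 'I_n.+2 by apply/val_inj.
rewrite -[P * T]/(_ *m _) mxE (@big_split_ord _ _ _ 2 n) /= [X in X + _]big1 ?add0r.
  rewrite (bigD1 j) //= (@block_mxEdr K 2 n 2 n) mxE eqxx big1 ?addr0 //.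
  by move=> k /negPf kj; rewrite (@block_mxEdr K 2 n 2 n) mxE kj mulr0.
by move=> k _; rewrite (@block_mxEur K 2 n 2 n) mxE mulr0.
Qed.

End FirstRows.

Section DiagEntries.
Variables (K : pzRingType) (n : nat) (c : K) (Q : 'M[K]_n).
Local Notation D := (diag_mx2 (c%:M : 'M_1) Q : 'M_n.+1).
Let liftE i : lift ord0 i = rshift 1 i :> 'I_(1 + n).
Proof. exact/val_inj. Qed.
Let ord0E : ord0 = lshift n (ord0 : 'I_1) :> 'I_n.+1.
Proof. exact/val_inj. Qed.

Lemma diag_mx2_00 : D ord0 ord0 = c.
Proof. by rewrite ord0E (@block_mxEul K 1 n 1 n) mxE. Qed.
Lemma diag_mx2_0S j : D ord0 (lift ord0 j) = 0.
Proof. by rewrite liftE ord0E (@block_mxEur K 1 n 1 n) mxE. Qed.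
Lemma diag_mx2_S0 i : D (lift ord0 i) ord0 = 0.
Proof. by rewrite liftE ord0E (@block_mxEdl K 1 n 1 n) mxE. Qed.
Lemma diag_mx2_SS i j : D (lift ord0 i) (lift ord0 j) = Q i j.
Proof. by rewrite !liftE (@block_mxEdr K 1 n 1 n). Qed.
End DiagEntries.

Lemma mx_subE (V : zmodType) m n (A B : 'M[V]_(m, n)) i j :
  (A - B) i j = A i j - B i j.
Proof. by rewrite !mxE. Qed.

Lemma mx_sub_sub_addE (V : zmodType) m n (A B C D : 'M[V]_(m, n)) i j :
  (A - B - C + D) i j = A i j - B i j - C i j + D i j.
Proof. by rewrite !mxE. Qed.

(** Entries of the products T D T and (T - zeta) D (T - zeta), which represent
x_{n+2} = tau x_{n+1} tau and its inverse; the factor g - 1 = N x g in the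
correction terms is what makes them drop out of the relevant rows and
columns. *)
Section SandwichIdentities.
Variables (A : pzRingType) (zeta g x N : A).
Hypothesis zetaC : forall c, c * zeta = zeta * c.

Let zl P P' : P * (zeta * P') = zeta * (P * P').
Proof. by rewrite !mulrA zetaC. Qed.

Lemma sandwich_sub (T D : A) : (T - zeta) * (D * (T - zeta)) =
  T * (D * T) - zeta * (T * D) - zeta * (D * T) + zeta * (zeta * D).
Proof.
have -> : (T - zeta) * (D * (T - zeta)) =
    T * (D * T) - T * (D * zeta) - zeta * (D * T) + zeta * (D * zeta).
  by non_commutative_ring.
by rewrite zetaC zl.
Qed.

Lemma sandwich_geom : zeta * g * (x * (zeta * g)) - zeta * (zeta * g * x) -
    zeta * (x * (zeta * g)) + zeta * (zeta * x) =
  (g - 1) * (zeta * zeta * x * (g - 1)).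
Proof.
have -> : zeta * g * (x * (zeta * g)) = zeta * (zeta * (g * x * g)).
  by rewrite -!mulrA !zl.
have -> : zeta * (x * (zeta * g)) = zeta * (zeta * (x * g)) by rewrite zl.
have -> : (g - 1) * (zeta * zeta * x * (g - 1)) =
    zeta * (zeta * ((g - 1) * x * (g - 1))) by rewrite -!mulrA !zl.
non_commutative_ring.
Qed.

Lemma sandwich_corner (Q Y P B C D : A) :
    P = zeta * g * (x * (zeta * g)) + Q * (1 - Y) ->
    B = zeta * (zeta * g * x) -> C = zeta * (x * (zeta * g)) ->
    D = zeta * (zeta * x) ->
  P - B - C + D = (g - 1) * (zeta * zeta * x * (g - 1)) + (Q - Q * Y).
Proof. by move=> -> -> -> ->; rewrite -sandwich_geom; non_commutative_ring. Qed.

Lemma sandwich_rearrange (P Q Y : A) : P + Q * (1 - Y) = Q - (Q * Y - P).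
Proof. by non_commutative_ring. Qed.

Hypotheses (gx : g * x = x * g) (g1 : g - 1 = N * x * g).

Lemma shifted_remainder u :
  zeta * g * u + 0 - zeta * u = N * (x * g * (zeta * u)).
Proof.
have -> : zeta * g * u + 0 - zeta * u = zeta * ((g - 1) * u).
  by non_commutative_ring.
by rewrite g1 -!mulrA !zl.
Qed.

Lemma sandwich_shift2 :
  zeta * zeta * (g - 1) * g = N * (zeta * g * (x * (zeta * g))).
Proof.
rewrite g1 -!mulrA !zl; do 2 congr (_ * _).
by rewrite (mulrA g) gx -!mulrA.
Qed.

Lemma sandwich_shift1 : zeta * (g - 1) = N * (zeta * g * x).
Proof. by rewrite g1 -(mulrA _ g) zl gx -!mulrA. Qed.

Lemma sandwich_shift_right (Q : A) : x * N = N * x -> g * N = N * g ->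
  Q * (zeta * zeta * (g - 1) * g) = Q * (zeta * zeta * (x * (g * g))) * N.
Proof.
move=> xN gN; rewrite -!mulrA; do 3 congr (_ * _).
by rewrite gN (mulrA g N) gN !mulrA xN -g1.
Qed.

End SandwichIdentities.

Section RepresentingMatrices.

Variables (R : comUnitRingType) (z : R) (f : {poly R}) (l : nat).
Hypotheses (szf : size f = l.+1) (f_monic : f`_l = 1).
Hypothesis f0_unit : f`_0 \is a GRing.unit.

Local Notation H n := (hecke z f n).
Local Notation incl n := (hecke_incl z f n).
Local Notation tau n := (@ht R z f n.+2 ord_max).
Local Notation taui n := (@hti R z f n.+2 ord_max).
Local Notation xlast n := (@hx R z f n.+1 ord_max).
Local Notation xilast n := (@hxi R z f n.+1 ord_max).
Local Notation K n := (block_ralg z f l n).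
Local Notation E n := (rep_ralg z f l n).
Local Notation lift_block n := (lift_block z f l n).
Local Notation zeta n := (ralg_scal (K n) z).
Local Notation geom n := (geom_mx l (xlast n) : K n.+1).
Local Notation rep_tau n := (rep_tau z f l n).

Section Sandwich.
Variables (n : nat) (rho : {rmorphism H n.+1 -> E n}) (u : H n.+1).
Let U : K n.+1 := u%:M.
Let Q := map_mx (lift_block n) (rho u).
Let P := rep_tau n * (rep_diag rho u * rep_tau n).

Lemma rep_sandwich0 : P ord0 ord0 = zeta n.+1 * geom n * (U * (zeta n.+1 * geom n))
  + Q ord0 ord0 * (1 - zeta n.+1 * zeta n.+1 * (geom n - 1) * geom n).
Proof.
rewrite /P [LHS](@tau_mx_row0 (K n.+1)) !(@mul_tau_mx_col0 (K n.+1)) rep_diagE.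
by rewrite diag_mx2_00 diag_mx2_0S diag_mx2_S0 diag_mx2_SS !mul0r addr0 add0r.
Qed.

Lemma rep_sandwich1 : P ord0 (lift ord0 ord0) =
  zeta n.+1 * geom n * U - Q ord0 ord0 * (zeta n.+1 * (geom n - 1)).
Proof.
rewrite /P [LHS](@tau_mx_row0 (K n.+1)) !(@mul_tau_mx_col1 (K n.+1)) rep_diagE.
by rewrite diag_mx2_00 diag_mx2_0S diag_mx2_S0 diag_mx2_SS !mul0r subr0 add0r.
Qed.

Lemma rep_sandwich2 (j : 'I_n) : P ord0 (lift ord0 (lift ord0 j)) =
  Q ord0 (lift ord0 j) * (tau_scalar z f n)%:M.
Proof.
rewrite /P [LHS](@tau_mx_row0 (K n.+1)) !(@mul_tau_mx_col2 (K n.+1)) rep_diagE.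
by rewrite diag_mx2_0S diag_mx2_SS mul0r mulr0 add0r.
Qed.

End Sandwich.

Lemma mulmxE_row m (A : pzRingType) (P Q Y : 'M[A]_m) (i i' j : 'I_m) :
  (forall c, P i c = Q i' c) -> (P * Y) i j = (Q * Y) i' j.
Proof. by move=> PQ; rewrite !mxE; apply: eq_bigr => c _; rewrite PQ. Qed.

Lemma shift_unit_row (A : ralg R) (P Y : 'M[A]_l) (i i' : 'I_l) j :
  (forall c : 'I_l, P i c = (c == i' :> nat)%:R) -> (P * Y) i j = Y i' j.
Proof.
move=> Pi; rewrite -[in RHS](mul1r Y); apply: mulmxE_row => c.
by rewrite Pi mxE -val_eqE eq_sym.
Qed.

Lemma geom_sub1E n : geom n - 1 = shift_mx l (H n.+1) * (xlast n)%:M * geom n :> K n.+1.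
Proof. by rewrite {1}geom_mxE addrC addKr. Qed.

(** For i + 1 < l this is x^i x = x^(i+1), read in coordinates.  In the induction
step the row i of the old matrix is the unit vector i + 1, and multiplying it
by N gives the row i of the identity, so that the correction terms cancel. *)
Lemma rep_last_x n (rho : {rmorphism H n.+1 -> E n}) : is_rep rho ->
  forall j (i i' c : 'I_l), i' = i.+1 :> nat ->
    rho (xlast n) ord0 j i c = ((j == ord0) && (c == i'))%:R.
Proof.
elim: n rho => [|n IHn] rho rep_rho j i i' c ii'.
  case: rep_rho => _ ->; rewrite [j]ord1 mxE eqxx /= mxE ifF.
    by rewrite -val_eqE /= ii'.
  by rewrite -ii' ltn_eqF.
have [rho' [rep_rho' _ rho_incl rho_tau]] := rep_rho.
rewrite -tau_x_tau !rmorphM rho_incl rho_tau.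
have Qi (j' : 'I_n.+1) (c' : 'I_l) :
    (map_mx (lift_block n) (rho' (xlast n))) ord0 j' i c' =
    ((j' == ord0) && (c' == i'))%:R.
  by rewrite mxE /= mxE (IHn _ rep_rho' _ _ _ _ ii') rmorph_nat.
have zC (P : K n.+1) : P * zeta n.+1 = zeta n.+1 * P by apply: scalZC.
have gx : geom n * (xlast n)%:M = (xlast n)%:M * geom n.
  exact/esym/geom_scalarC.
set x := (xlast n)%:M in gx; set N : K n.+1 := shift_mx l (H n.+1).
have Qrow (A B : K n.+1) : A = N * B ->
    (map_mx (lift_block n) (rho' (xlast n)) ord0 ord0 * A) i c = B i c.
  move=> ->; rewrite (@shift_unit_row (H n.+1) _ _ i i') ?(shift_mulS _ _ ii') //.
have subE (A B : K n.+1) : (A - B) i c = A i c - B i c.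
  by rewrite mxE [X in _ + X]mxE.
case: (unliftP ord0 j) => [j'|] ->; last first.
  rewrite rep_sandwich0; set Q := _ ord0 ord0; set U := _%:M; set g := geom n.
  have -> : zeta n.+1 * g * (U * (zeta n.+1 * g)) +
      Q * (1 - zeta n.+1 * zeta n.+1 * (g - 1) * g) =
      Q - (Q * (zeta n.+1 * zeta n.+1 * (g - 1) * g) - zeta n.+1 * g * (U * (zeta n.+1 * g))).
    exact: sandwich_rearrange.
  rewrite subE [X in X - _]Qi subE.
  by rewrite (Qrow _ _ (sandwich_shift2 zC gx (geom_sub1E n))) subrr subr0.
case: (unliftP ord0 j') => [j''|] ->.
  rewrite rep_sandwich2 [LHS]mxE big1 // => c' _; rewrite mxE.
  by have := Qi (lift ord0 j'') c'; rewrite mxE => ->; rewrite mul0r.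
by rewrite rep_sandwich1 subE (Qrow _ _ (sandwich_shift1 zC gx (geom_sub1E n))) subrr.
Qed.

(** For n = 0 this coefficient of x^-1 on x^(l-1) is read off [root_inverse]; in the induction step one correction term
has N as a left factor, which has zero first row, and the other one has N as a
right factor, which has zero last column. *)
Lemma rep_last_xi n (rho : {rmorphism H n.+1 -> E n}) (o m : 'I_l) :
    is_rep rho -> o = 0%N :> nat -> m.+1 = l ->
  rho (xilast n) ord0 ord0 o m = - ralg_scal (H n) (f`_0)^-1.
Proof.
move=> rep_rho o0 ml; elim: n rho rep_rho => [|n IHn] rho rep_rho.
  have [_ rho_x] := rep_rho.
  have [CV VC] := comp_invK z szf f_monic f0_unit.
  have -> : rho (xilast 0) = (comp_inv z f l)%:M.
    have e : (comp_inv z f l)%:M * rho (xlast 0) = 1.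
      by rewrite rho_x -rmorphM VC rmorph1.
    by rewrite -[LHS]mul1r -e -mulrA -rmorphM hxV rmorph1 mulr1.
  have SE (a : R) (P : K 0) i j : (ralg_scal (K 0) a * P) i j = ralg_scal (H 0) a * P i j.
    exact: scalar_mulE.
  rewrite mxE eqxx /= /comp_inv mxE SE summxE (bigD1 m) //= SE.
  rewrite comp_powE ?ltn_ord // eqxx mulr1 ml f_monic rmorph1 big1 ?addr0 ?mulr1 //.
  move=> k km; rewrite SE comp_powE ?ltn_ord // eq_sym.
  by rewrite [(k : nat) == m](negPf km) mulr0.
have [rho' [rep_rho' rhoS rho_incl rho_tau]] := rep_rho.
have rho_taui : rho (taui n) = rep_tau n - ralg_scal (E n.+1) z.
  by rewrite rmorphB rho_tau rhoS.
rewrite -taui_xi_taui !rmorphM rho_incl rho_taui.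
set T := rep_tau n; set Z := ralg_scal (E n.+1) z; set D := rep_diag rho' _.
pose x : K n.+1 := (xilast n)%:M; pose g := geom n.
pose N : K n.+1 := shift_mx l (H n.+1).
have ZE P i j : (Z * P) i j = zeta n.+1 * P i j.
  by rewrite -[Z * P]/(_ *m _) mul_scalar_mx mxE.
have zC (P : K n.+1) : P * zeta n.+1 = zeta n.+1 * P by apply: scalZC.
have D0 : D ord0 ord0 = x by rewrite /D rep_diagE diag_mx2_00.
have DT : (D * T) ord0 ord0 = x * (zeta n.+1 * g).
  rewrite [LHS](@mul_tau_mx_col0 (K n.+1)) D0 /D rep_diagE diag_mx2_0S.
  by rewrite mul0r addr0.
have TD : (T * D) ord0 ord0 = zeta n.+1 * g * x.
  rewrite [LHS](@tau_mx_row0 (K n.+1)) D0 /D rep_diagE diag_mx2_S0.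
  by rewrite addr0.
have ZC P : P * Z = Z * P by apply: scalZC.
rewrite (sandwich_sub ZC T D).
set Q := map_mx (lift_block n) (rho' (xilast n)) ord0 ord0.
have -> : (T * (D * T) - Z * (T * D) - Z * (D * T) + Z * (Z * D)) ord0 ord0 =
   (g - 1) * (zeta n.+1 * zeta n.+1 * x * (g - 1)) +
   (Q - Q * (zeta n.+1 * zeta n.+1 * (g - 1) * g)).
  have eB : (Z * (T * D)) ord0 ord0 = zeta n.+1 * (zeta n.+1 * g * x).
    exact: etrans (ZE _ _ _) (congr1 _ TD).
  have eC : (Z * (D * T)) ord0 ord0 = zeta n.+1 * (x * (zeta n.+1 * g)).
    exact: etrans (ZE _ _ _) (congr1 _ DT).
  have eD : (Z * (Z * D)) ord0 ord0 = zeta n.+1 * (zeta n.+1 * x).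
    exact: etrans (ZE _ _ _) (congr1 _ (etrans (ZE _ _ _) (congr1 _ D0))).
  apply: etrans (mx_sub_sub_addE _ _ _ _ _ _) _.
  exact: (sandwich_corner zC (rep_sandwich0 rho' (xilast n)) eB eC eD).
have g1 := geom_sub1E n.
rewrite mxE [X in X + _](_ : _ = 0) ?add0r; last first.
  by rewrite g1 -!mulrA shift_mul0.
rewrite mxE [X in _ + X]mxE [X in _ - X](_ : _ = 0) ?subr0.
  by rewrite /Q mxE /= mxE (IHn _ rep_rho') rmorphN hecke_incl_scal.
have gx : g * (xlast n)%:M = (xlast n)%:M * g by exact/esym/geom_scalarC.
rewrite (sandwich_shift_right (zeta n.+1) g1 Q (shift_scalarC _ _) _); last first.
  by rewrite [RHS]shift_geomC.
exact: mul_shift_last.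
Qed.

End RepresentingMatrices.

(** * The Mackey decomposition *)

Section MackeyDecomposition.

Variables (R : comUnitRingType) (z : R) (f : {poly R}) (l : nat).
Hypotheses (szf : size f = l.+1) (f_monic : f`_l = 1).
Hypothesis f0_unit : f`_0 \is a GRing.unit.

Local Notation H n := (hecke z f n).
Local Notation incl n := (hecke_incl z f n).
Local Notation tau n := (@ht R z f n.+2 ord_max).
Local Notation taui n := (@hti R z f n.+2 ord_max).
Local Notation xlast n := (@hx R z f n.+1 ord_max).
Local Notation xilast n := (@hxi R z f n.+1 ord_max).
Local Notation K n := (block_ralg z f l n).
Local Notation E n := (rep_ralg z f l n).
Local Notation zeta n := (ralg_scal (H n) z).

(** Linearity is stated for plain functions, so that a map may be composed with
right multiplications or viewed over a smaller algebra without repackaging. *)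
Definition left_hom n (M : lmodType (H n)) (th : H n.+1 -> M) : Prop :=
  (forall u v, th (u + v) = th u + th v) /\
  (forall w u, th (incl n w * u) = w *: th u).

Lemma left_hom0 n (M : lmodType (H n)) (th : H n.+1 -> M) : left_hom th -> th 0 = 0.
Proof. by case=> thD _; apply: (addrI (th 0)); rewrite -thD !addr0. Qed.

Lemma left_homN n (M : lmodType (H n)) (th : H n.+1 -> M) u :
  left_hom th -> th (- u) = - th u.
Proof.
move=> hth; apply/eqP; rewrite -addr_eq0; apply/eqP.
by have [thD _] := hth; rewrite -thD addNr left_hom0.
Qed.

Lemma left_hom_sum n (M : lmodType (H n)) (th : H n.+1 -> M) (I : Type)
    (r : seq I) P (F : I -> H n.+1) : left_hom th ->
  th (\sum_(i <- r | P i) F i) = \sum_(i <- r | P i) th (F i).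
Proof.
move=> hth; elim/big_rec2: _ => [|i y x _ <-]; first exact: left_hom0.
by have [thD _] := hth.
Qed.

Lemma left_hom_mulr n (M : lmodType (H n)) (th : H n.+1 -> M) (v : H n.+1) :
  left_hom th -> left_hom (fun u => th (u * v)).
Proof.
by case=> thD thZ; split=> [u u'|w u]; rewrite ?mulrDl ?thD // -mulrA thZ.
Qed.

Lemma left_hom_sandwich n (M : lmodType (H n.+1)) (th : H n.+2 -> M) (v : H n.+2) :
  left_hom th ->
  @left_hom n (res (incl n) M) (fun u => th (taui n * (incl n.+1 u * v))).
Proof.
case=> thD thZ; split=> [u u'|w u]; first by rewrite rmorphD (mulrDl _ _ v) mulrDr thD.
by rewrite rmorphM -mulrA mulrA hti_last_comm -mulrA thZ.
Qed.

(** Powers of x move across tau one at a time, by x_{n+2} tau^-1 = tau x_{n+1} and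
tau = tau^-1 + z. *)
Lemma x_exp_tau n i : xlast n.+1 ^+ i * tau n =
  taui n * incl n.+1 (xlast n ^+ i) +
  zeta n.+2 * \sum_(j < i.+1) incl n.+1 (xlast n ^+ (i - j)) * xlast n.+1 ^+ j.
Proof.
elim: i => [|i IHi].
  rewrite big_ord_recl big_ord0 subn0 !expr0 rmorph1 !mul1r addr0 !mulr1 /hti.
  by rewrite subrK.
rewrite exprS -mulrA IHi mulrDr.
have -> : xlast n.+1 * (taui n * incl n.+1 (xlast n ^+ i)) =
    taui n * incl n.+1 (xlast n ^+ i.+1) + zeta n.+2 * incl n.+1 (xlast n ^+ i.+1).
  rewrite -tau_x_tau -!mulrA (mulrA (tau n) (taui n)) htK mul1r -rmorphM -exprS.
  by rewrite -mulrDl /hti subrK.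
rewrite -addrA; congr (_ + _); rewrite mulrA -ralg_scalC -mulrA -mulrDr.
rewrite [in RHS]big_ord_recl subn0 expr0 mulr1; congr (_ * (_ + _)).
rewrite mulr_sumr; apply: eq_bigr => j _; rewrite subSS.
by rewrite mulrA hx_last_comm -mulrA -exprS.
Qed.

Lemma taui_x_exp_tau n i : taui n * (incl n.+1 (xlast n ^+ i) * tau n) =
  xlast n.+1 ^+ i - zeta n.+2 *
    \sum_(j < i) incl n.+1 (xlast n ^+ (i - j)) * (xlast n.+1 ^+ j * tau n).
Proof.
have e : taui n * incl n.+1 (xlast n ^+ i) = xlast n.+1 ^+ i * taui n -
    zeta n.+2 * \sum_(j < i) incl n.+1 (xlast n ^+ (i - j)) * xlast n.+1 ^+ j.
  have := x_exp_tau n i; rewrite big_ord_recr /= subnn expr0 rmorph1 mul1r.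
  rewrite mulrDr addrA => /eqP; rewrite -subr_eq => /eqP e.
  have -> : xlast n.+1 ^+ i * taui n = xlast n.+1 ^+ i * tau n - zeta n.+2 * xlast n.+1 ^+ i.
    by rewrite /hti mulrBr ralg_scalC.
  by rewrite e addrK.
rewrite mulrA e mulrBl -mulrA hKt mulr1 -mulrA mulr_suml.
by congr (_ - _ * _); apply: eq_bigr => j _; rewrite mulrA.
Qed.

Lemma braid_inverse (A : pzRingType) (s s' t t' : A) :
    s * s' = 1 -> s' * s = 1 -> t * t' = 1 -> t' * t = 1 ->
  s * t * s = t * s * t -> s' * t' * s = t * s' * t'.
Proof.
move=> sV Vs tV Vt st.
have -> : s' * t' * s = s' * t' * (s * t * s) * s' * t'.
  by rewrite -!mulrA (mulrA s s') sV mul1r tV mulr1.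
by rewrite st !mulrA -(mulrA s' t') Vt mulr1 Vs mul1r.
Qed.

Lemma taui_taui_tau n (v : H n.+1) :
  taui n.+1 * (incl n.+2 (taui n * incl n.+1 v) * tau n.+1) =
  incl n.+2 (tau n) * (taui n.+1 * incl n.+2 (taui n * incl n.+1 v)).
Proof.
have e : taui n.+1 * incl n.+2 (taui n) * tau n.+1 =
    incl n.+2 (tau n) * taui n.+1 * incl n.+2 (taui n).
  apply: braid_inverse (tau_braid z f n); rewrite -?rmorphM ?htK ?hKt ?rmorph1 //.
by rewrite [incl n.+2 (_ * _)]rmorphM -mulrA -ht_last_comm !mulrA e.
Qed.

(** The vanishing of [th] on the elements that generate H_{n+1} as a left
H_n-module. *)
Definition kills n : forall M : lmodType (H n), (H n.+1 -> M) -> Prop :=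
  match n with
  | 0 => fun M th => forall i, (i < l)%N -> th (xlast 0 ^+ i) = 0
  | m.+1 => fun M th => (forall i, (i < l)%N -> th (xlast m.+1 ^+ i) = 0) /\
                        (forall u, th (taui m * incl m.+1 u) = 0)
  end.

Lemma kills_x n (M : lmodType (H n)) (th : H n.+1 -> M) : kills th ->
  forall i, (i < l)%N -> th (xlast n ^+ i) = 0.
Proof. by case: n M th => [|n] M th //= []. Qed.

(** For x, the relation f(x) = 0 rewrites x^l by lower powers; for x^-1 the same
relation rewrites x^-1 by nonnegative powers. *)
Lemma kills0_mulr (M : lmodType (H 0)) (th : H 1 -> M) (w : H 1) :
  left_hom th -> kills th -> kills (fun u => th (u * w)).
Proof.
move: w M th; elim/hecke1_gen_ind => [a|||u v Ku Kv|u v Ku Kv] M th hth kth i il.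
- have [_ thZ] := hth.
  by rewrite -ralg_scalC -(hecke_incl_scal z f 0 a) thZ kth // scaler0.
- have [_ thZ] := hth; rewrite -exprSr.
  have [|li] := ltnP i.+1 l; first exact: kth.
  have {}il : i.+1 = l by apply/eqP; rewrite eqn_leq il li.
  have := hcyc z f (i := ord_max : 'I_1) erefl; rewrite szf big_ord_recr /= f_monic.
  rewrite rmorph1 mul1r il => /eqP; rewrite addrC addr_eq0 => /eqP ->.
  rewrite left_homN // left_hom_sum // big1 ?oppr0 // => m _.
  by rewrite -(hecke_incl_scal z f 0) thZ kth ?scaler0.
- have [_ thZ] := hth.
  case: i il => [|i] il; last first.
    by rewrite exprSr -mulrA hxV mulr1 kth // ltnW.
  have [xy _] := root_inverse szf f0_unit (hcyc z f (i := ord_max : 'I_1) erefl).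
  rewrite expr0 mul1r; rewrite (_ : xilast 0 = - (ralg_scal (H 1) (f`_0)^-1 *
    \sum_(m < l) ralg_scal (H 1) f`_m.+1 * xlast 0 ^+ m)).
    rewrite left_homN // -(hecke_incl_scal z f 0) thZ left_hom_sum // big1 ?scaler0 ?oppr0 //.
    by move=> m _; rewrite -(hecke_incl_scal z f 0) thZ kth ?scaler0.
  by rewrite -[LHS]mulr1 -xy mulrA hVx mul1r.
- by have [thD _] := hth; rewrite mulrDr thD Ku ?Kv ?addr0.
- rewrite mulrA; apply: (Ku M (fun w => th (w * v))) => //.
    exact: left_hom_mulr.
  exact: Kv.
Qed.

(** The delicate case is th(tau^-1 u tau) for w = tau: as a function of u it is
linear over the algebra one level below and vanishes on the generators there,
by [taui_x_exp_tau] and the braid relation, hence it is zero by induction. *)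
Lemma killsS_mulr n (M : lmodType (H n.+1)) (th : H n.+2 -> M) (w : H n.+2) :
    (forall (M' : lmodType (H n)) (th' : H n.+1 -> M'),
       left_hom th' -> kills th' -> forall u, th' u = 0) ->
  left_hom th -> kills th -> kills (fun u => th (u * w)).
Proof.
move=> IHn; move: w M th.
elim/hecke_gen_ind => [b||u v Ku Kv|u v Ku Kv] M th hth kth.
- have [_ thZ] := hth; have [kx kt] := kth; split=> [i il|u].
    have -> : xlast n.+1 ^+ i * incl n.+1 b = incl n.+1 b * xlast n.+1 ^+ i.
      exact/esym/commrX/esym/hx_last_comm.
    by rewrite thZ kx // scaler0.
  by rewrite -mulrA -rmorphM kt.
- have [thD thZ] := hth; have [kx kt] := kth.
  have kxt i : (i < l)%N -> th (xlast n.+1 ^+ i * tau n) = 0.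
    move=> il; rewrite x_exp_tau thD kt add0r -(hecke_incl_scal z f n.+1) thZ.
    rewrite left_hom_sum // big1 ?scaler0 // => j _; rewrite thZ kx ?scaler0 //.
    exact: leq_trans (ltn_ord j) il.
  split=> // u; rewrite -mulrA.
  apply: (IHn (res (incl n) M) (fun u => th (taui n * (incl n.+1 u * tau n)))).
    exact: left_hom_sandwich.
  have kxi i : (i < l)%N -> th (taui n * (incl n.+1 (xlast n ^+ i) * tau n)) = 0.
    move=> il; rewrite taui_x_exp_tau thD kx // add0r left_homN //.
    rewrite -(hecke_incl_scal z f n.+1) thZ left_hom_sum // big1 ?scaler0 ?oppr0 //.
    move=> j _; rewrite thZ kxt ?scaler0 //; exact: ltn_trans (ltn_ord j) il.
  case: n M th hth kth thD thZ kx kt {IHn u kxt} kxi => [|n] M th hth kth thD thZ kx kt kxi.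
    exact: kxi.
  split=> [//|u]; rewrite taui_taui_tau thZ kt scaler0 //.
- have [thD _] := hth; have [kux kut] := Ku M th hth kth.
  have [kvx kvt] := Kv M th hth kth.
  by split=> [i il|w]; rewrite mulrDr thD ?(kux, kvx, kut, kvt) ?addr0.
- have [kx kt] := Ku M (fun w => th (w * v)) (left_hom_mulr v hth) (Kv M th hth kth).
  by split=> [i il|w]; rewrite mulrA ?kx ?kt.
Qed.

(** Evaluating at x^0 = 1 the translate of [th] by [u] gives [th u]. *)
Lemma left_hom_inj n (M : lmodType (H n)) (th : H n.+1 -> M) : (0 < l)%N ->
  left_hom th -> kills th -> forall u, th u = 0.
Proof.
move=> l_gt0; elim: n M th => [|n IHn] M th hth kth u; rewrite -[u]mul1r.
  by have /= := kills_x (kills0_mulr u hth kth) l_gt0; rewrite expr0.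
by have /= := kills_x (killsS_mulr u IHn hth kth) l_gt0; rewrite expr0.
Qed.

Section Coefficients.

Variable o : 'I_l.
Hypothesis o0 : o = 0%N :> nat.

(** The coordinates of [u] are the coefficients of 1 u on the basis, and 1 is the
basis element with indices [ord0] and [o], its exponent being 0. *)
Definition coef n (rho : {rmorphism H n.+1 -> E n}) (u : H n.+1)
    (i : 'I_n.+1) (a : 'I_l) : H n := rho u ord0 i o a.

Lemma rep_mulE n (P Q : E n) i j (p q : 'I_l) :
  (P * Q) i j p q = \sum_k \sum_(c < l) P i k p c * Q k j c q.
Proof. by rewrite mxE summxE; apply: eq_bigr => k _; rewrite mxE. Qed.

Lemma coefD n (rho : {rmorphism H n.+1 -> E n}) u v i a :
  coef rho (u + v) i a = coef rho u i a + coef rho v i a.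
Proof. by rewrite /coef rmorphD !mxE. Qed.

Lemma coef_incl n (rho : {rmorphism H n.+1 -> E n}) w u i a : is_rep rho ->
  coef rho (incl n w * u) i a = w * coef rho u i a.
Proof.
case: n rho w u i => [|n] rho w u i rep_rho; rewrite /coef rmorphM.
  have [b ->] := hecke0_scal w.
  rewrite hecke_incl_scal (is_rep_scal rep_rho).
  rewrite -[ralg_scal (E 0) b]/((ralg_scal (K 0) b)%:M) -[_%:M * _]/(_ *m _).
  by rewrite mul_scalar_mx mxE; apply: scalar_mulE.
have [rho' [_ _ rho_incl _]] := rep_rho.
rewrite rho_incl rep_diagE [_ ord0 i]mxE big_ord_recl diag_mx2_00.
rewrite big1 ?addr0; last by move=> k _; rewrite diag_mx2_0S mul0r.
exact: scalar_mulE.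
Qed.

Lemma coef_x n (rho : {rmorphism H n.+1 -> E n}) k i a : is_rep rho ->
  (k < l)%N -> coef rho (xlast n ^+ k) i a = ((i == ord0) && (a == k :> nat))%:R.
Proof.
move=> rep_rho; rewrite /coef; elim: k i a => [|k IHk] i a kl.
  rewrite expr0 rmorph1 mxE eq_sym; case: eqP => _ /=; last by rewrite mxE.
  by rewrite mxE -val_eqE /= o0 eq_sym.
have kl' := ltnW kl; rewrite exprSr rmorphM rep_mulE (bigD1 ord0) //=.
rewrite (bigD1 (Ordinal kl')) //= IHk //= eqxx mul1r.
rewrite (rep_last_x rep_rho _ _ (erefl : Ordinal kl = (Ordinal kl').+1 :> nat)).
rewrite [X in _ + X + _]big1 ?addr0; last first.
  move=> c /negPf ck; rewrite IHk // [_ && _](_ : _ = false) ?mul0r //.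
rewrite big1 ?addr0 // => j /negPf j0; rewrite big1 // => c _.
by rewrite IHk // j0 mul0r.
Qed.

Lemma coef_taui n (rho : {rmorphism H n.+2 -> E n.+1})
    (rho' : {rmorphism H n.+1 -> E n}) u i a :
    (forall b, rho (ralg_scal (H n.+2) b) = ralg_scal (E n.+1) b) ->
    (forall w, rho (incl n.+1 w) = rep_diag rho' w) -> rho (tau n) = rep_tau z f l n ->
  coef rho (taui n * incl n.+1 u) i a =
    if unlift ord0 i is Some j then incl n (coef rho' u j a) else 0.
Proof.
move=> rhoS rho_incl rho_tau.
pose T := rep_tau z f l n; pose Z := ralg_scal (E n.+1) z.
pose D : E n.+1 := rep_diag rho' u; pose g : K n.+1 := geom_mx l (xlast n).
pose Zk := ralg_scal (K n.+1) z.
have e0 : rho (taui n * incl n.+1 u) = (T - Z) * D.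
  by rewrite rmorphM rho_incl rmorphB rho_tau rhoS.
have e1 : (T * D) ord0 i = Zk * g * D ord0 i + D (lift ord0 ord0) i.
  exact: (@tau_mx_row0 (K n.+1)).
have e2 : (Z * D) ord0 i = Zk * D ord0 i.
  by rewrite -[LHS]/((_ *m _) ord0 i) mul_scalar_mx mxE.
have e3 : ((T - Z) * D) ord0 i = (T * D) ord0 i - (Z * D) ord0 i.
  by rewrite mulrBl mx_subE.
have e : coef rho (taui n * incl n.+1 u) i a =
    (Zk * g * D ord0 i + D (lift ord0 ord0) i - Zk * D ord0 i) o a.
  have e4 : ((T - Z) * D) ord0 i = Zk * g * D ord0 i + D (lift ord0 ord0) i - Zk * D ord0 i.
    by apply: (etrans e3); congr (_ - _); [exact: e1|exact: e2].
  by rewrite /coef e0 e4.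
rewrite e {e e0 e1 e2 e3}; case: (unliftP ord0 i) => [j|] ->.
  have -> : D ord0 (lift ord0 j) = 0 by apply: diag_mx2_0S.
  rewrite !mulr0 add0r subr0.
  have -> : D (lift ord0 ord0) (lift ord0 j) = map_mx (lift_block z f l n) (rho' u) ord0 j.
    exact: diag_mx2_SS.
  by rewrite mxE /= mxE.
have -> : D ord0 ord0 = u%:M by apply: diag_mx2_00.
have -> : D (lift ord0 ord0) ord0 = 0 by apply: diag_mx2_S0.
have g1 : g - 1 = shift_mx l (H n.+1) * (xlast n)%:M * g := geom_sub1E z f l n.
have -> : Zk * g * u%:M + 0 - Zk * u%:M =
    shift_mx l (H n.+1) * ((xlast n)%:M * g * (Zk * u%:M)).
  exact: (@shifted_remainder (K n.+1) Zk g (xlast n)%:M (shift_mx l (H n.+1))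
            (fun c => scalZC z c) g1 (u%:M)).
exact: shift_mul0.
Qed.

Fixpoint basis n : 'I_n.+1 -> 'I_l -> H n.+1 :=
  match n with
  | 0 => fun _ a => xlast 0 ^+ a
  | m.+1 => fun i a => if unlift ord0 i is Some j then taui m * incl m.+1 (basis j a)
                       else xlast m.+1 ^+ a
  end.

Definition left_comb n (M : lmodType (H n)) (rho : {rmorphism H n.+1 -> E n})
    (c : 'I_n.+1 -> 'I_l -> M) (u : H n.+1) : M :=
  \sum_i \sum_a coef rho u i a *: c i a.

Lemma left_comb_hom n (M : lmodType (H n)) (rho : {rmorphism H n.+1 -> E n})
    (c : 'I_n.+1 -> 'I_l -> M) : is_rep rho -> left_hom (left_comb rho c).
Proof.
move=> rep_rho; split=> [u v|w u].
  rewrite /left_comb -big_split; apply: eq_bigr => i _; rewrite -big_split.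
  by apply: eq_bigr => a _; rewrite coefD scalerDl.
rewrite /left_comb scaler_sumr; apply: eq_bigr => i _; rewrite scaler_sumr.
by apply: eq_bigr => a _; rewrite coef_incl // scalerA.
Qed.

Lemma left_comb_x n (M : lmodType (H n)) (rho : {rmorphism H n.+1 -> E n})
    (c : 'I_n.+1 -> 'I_l -> M) (k : 'I_l) : is_rep rho ->
  left_comb rho c (xlast n ^+ k) = c ord0 k.
Proof.
move=> rep_rho; rewrite /left_comb (bigD1 ord0) //= (bigD1 k) //=.
rewrite coef_x // !eqxx scale1r big1 ?addr0; last first.
  move=> a /negPf ak; rewrite coef_x // [_ == _ :> nat](_ : _ = false) ?andbF ?scale0r //.
rewrite big1 ?addr0 // => i /negPf i0; rewrite big1 // => a _.
by rewrite coef_x // i0 scale0r.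
Qed.

Lemma left_comb_taui n (M : lmodType (H n.+1)) (rho : {rmorphism H n.+2 -> E n.+1})
    (rho' : {rmorphism H n.+1 -> E n}) (c : 'I_n.+2 -> 'I_l -> M) u :
    (forall b, rho (ralg_scal (H n.+2) b) = ralg_scal (E n.+1) b) ->
    (forall w, rho (incl n.+1 w) = rep_diag rho' w) -> rho (tau n) = rep_tau z f l n ->
  left_comb rho c (taui n * incl n.+1 u) =
  @left_comb n (res (incl n) M) rho' (fun j a => c (lift ord0 j) a) u.
Proof.
move=> rhoS rho_incl rho_tau; rewrite /left_comb big_ord_recl big1 ?add0r.
  apply: eq_bigr => j _; apply: eq_bigr => a _.
  by rewrite (coef_taui _ _ _ rhoS rho_incl rho_tau) liftK.
move=> a _; rewrite (coef_taui _ _ _ rhoS rho_incl rho_tau).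
by rewrite unlift_none scale0r.
Qed.

Lemma left_hom_taui n (M : lmodType (H n.+1)) (th : H n.+2 -> M) : left_hom th ->
  @left_hom n (res (incl n) M) (fun u => th (taui n * incl n.+1 u)).
Proof.
move=> hth; have := left_hom_sandwich 1 hth.
by congr left_hom; apply: functional_extensionality_dep => u; rewrite mulr1.
Qed.

(** Both sides are H_n-linear and agree on generators, so that [left_hom_inj]
applies; with [left_comb_x] and [left_comb_taui] this says that H_{n+1} is free
over H_n on [basis]. *)
Lemma left_hom_expand n (M : lmodType (H n)) (rho : {rmorphism H n.+1 -> E n})
    (th : H n.+1 -> M) : is_rep rho -> left_hom th ->
  forall u, th u = left_comb rho (fun i a => th (basis i a)) u.
Proof.
have l_gt0 : (0 < l)%N := leq_ltn_trans (leq0n o) (ltn_ord o).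
elim: n M rho th => [|n IHn] M rho th rep_rho hth u.
  apply/eqP; rewrite -subr_eq0; apply/eqP.
  apply: (left_hom_inj (th := fun u => th u - left_comb rho _ u) l_gt0).
    have [thD thZ] := hth; have [cD cZ] := left_comb_hom (fun i a => th (basis i a)) rep_rho.
    by split=> [v w|w v]; rewrite ?thD ?cD ?thZ ?cZ ?scalerBr // opprD addrACA.
  move=> i il; rewrite (left_comb_x _ (Ordinal il) rep_rho) /= subrr //.
apply/eqP; rewrite -subr_eq0; apply/eqP.
apply: (left_hom_inj (th := fun u => th u - left_comb rho _ u) l_gt0).
  have [thD thZ] := hth; have [cD cZ] := left_comb_hom (fun i a => th (basis i a)) rep_rho.
  by split=> [v w|w v]; rewrite ?thD ?cD ?thZ ?cZ ?scalerBr // opprD addrACA.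
have [rho' [rep_rho' rhoS rho_incl rho_tau]] := rep_rho.
split=> [i il|v].
  by rewrite (left_comb_x _ (Ordinal il) rep_rho) /= unlift_none subrr.
rewrite (left_comb_taui _ _ rhoS rho_incl rho_tau).
rewrite [X in X - _](IHn _ rho' _ rep_rho' (left_hom_taui hth)).
apply/eqP; rewrite subr_eq0; apply/eqP; apply: eq_bigr => j _; apply: eq_bigr => a _.
by rewrite /= liftK.
Qed.

Lemma mackey_exists0 (M : lmodType (H 0)) (m : 'I_l -> M) :
  exists2 th : H 1 -> M, left_hom th & forall a : 'I_l, th (xlast 0 ^+ a) = m a.
Proof.
have [rho rep_rho] := regular_rep z szf f_monic f0_unit 0.
exists (left_comb rho (fun _ => m)); first exact: left_comb_hom.
by move=> a; apply: left_comb_x.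
Qed.

(** The map prescribed on the basis by [m] and by the values of [phi] on the basis
one level below takes the values of [phi] everywhere, by [left_hom_expand]. *)
Lemma mackey_existsS n (M : lmodType (H n.+1)) (phi : H n.+1 -> M) (m : 'I_l -> M) :
    @left_hom n (res (incl n) M) phi ->
  exists2 th : H n.+2 -> M, left_hom th &
    (forall a : 'I_l, th (xlast n.+1 ^+ a) = m a) /\
    (forall u, th (taui n * incl n.+1 u) = phi u).
Proof.
move=> hphi; have [rho rep_rho] := regular_rep z szf f_monic f0_unit n.+1.
have [rho' [rep_rho' rhoS rho_incl rho_tau]] := rep_rho.
pose c i a := if unlift ord0 i is Some j then phi (basis j a) else m a.
exists (left_comb rho c); first exact: left_comb_hom.
split=> [a|u]; first by rewrite left_comb_x // /c unlift_none.
rewrite (left_comb_taui _ _ rhoS rho_incl rho_tau).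
rewrite [RHS](left_hom_expand rep_rho' hphi).
by apply: eq_bigr => j _; apply: eq_bigr => a _; rewrite /c liftK.
Qed.

(** Only the coordinate of x^-1 on x^(l-1) contributes to the expansion of
th(x^-1). *)
Lemma left_hom_xi n (M : lmodType (H n)) (th : H n.+1 -> M) (p : 'I_l) (v : M) :
    p.+1 = l -> left_hom th ->
    (forall a : 'I_l, th (xlast n ^+ a) = if a == p then v else 0) ->
    match n return (H n.+1 -> M) -> Prop with
    | 0 => fun=> True
    | k.+1 => fun th => forall u, th (taui k * incl k.+1 u) = 0
    end th ->
  th (xilast n) = - (ralg_scal (H n) (f`_0)^-1 *: v).
Proof.
move=> pl hth thx tht; have [rho rep_rho] := regular_rep z szf f_monic f0_unit n.
have basis0 a : basis (ord0 : 'I_n.+1) a = xlast n ^+ a.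
  by case: n {M th v hth thx tht rho rep_rho} => //= n; rewrite unlift_none.
rewrite (left_hom_expand rep_rho hth) /left_comb (bigD1 ord0) //= (bigD1 p) //=.
rewrite basis0 thx eqxx /coef (rep_last_xi szf f_monic f0_unit rep_rho o0 pl).
rewrite scaleNr big1 ?addr0; last first.
  by move=> a /negPf ap; rewrite basis0 thx ap scaler0.
rewrite big1 ?addr0 // => i i0; rewrite big1 // => a _.
case: n M th v hth thx tht rho rep_rho basis0 i i0 =>
  [|n] M th v hth thx tht rho rep_rho basis0 i i0.
  by rewrite [i]ord1 in i0.
have {i0} : ord0 != i by rewrite eq_sym.
by case/unlift_some => j _ /= ->; rewrite tht scaler0.
Qed.

End Coefficients.
End MackeyDecomposition.

Import Defs.

(** * Functors out of the Heisenberg category *)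

(** Tensor products of objects are associative and unital only up to a
propositional equality of objects; morphisms whose ends agree in this sense
are compared through [arr]. *)
Section ArrowTheory.
Variables (R : comPzRingType) (C : lincat R).

Lemma arr_comp (X Y Z X' Y' Z' : C) (f : hom Y Z) (g : hom X Y)
    (f' : hom Y' Z') (g' : hom X' Y') :
  arr f = arr f' -> arr g = arr g' -> arr (comp f g) = arr (comp f' g').
Proof.
move=> ef eg; have [eY eZ] : Y = Y' /\ Z = Z'.
  by have := projT1_eq ef => /= -[-> ->].
have eX : X = X' by have := projT1_eq eg => /= -[-> _].
case: _ / eX g' eg => g'; case: _ / eY f' g' ef => f' g'; case: _ / eZ f' => f'.
by move=> /arr_inj -> /arr_inj ->.
Qed.

Lemma arr_homD (X Y X' Y' : C) (f g : hom X Y) (f' g' : hom X' Y') :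
  arr f = arr f' -> arr g = arr g' -> arr (homD f g) = arr (homD f' g').
Proof.
move=> ef; have [eX eY] : X = X' /\ Y = Y'.
  by have := projT1_eq ef => /= -[-> ->].
case: _ / eX f' g' ef => f' g'; case: _ / eY f' g' => f' g' /arr_inj -> /arr_inj -> //.
Qed.

Lemma arr_homZ (X Y X' Y' : C) a (f : hom X Y) (f' : hom X' Y') :
  arr f = arr f' -> arr (homZ a f) = arr (homZ a f').
Proof.
move=> ef; have [eX eY] : X = X' /\ Y = Y'.
  by have := projT1_eq ef => /= -[-> ->].
by case: _ / eX f' ef => f'; case: _ / eY f' => f' /arr_inj ->.
Qed.

Definition castm (X Y X' Y' : C) (eX : X = X') (eY : Y = Y') (f : hom X Y) :
    hom X' Y' :=
  match eX in _ = X1, eY in _ = Y1 return hom X1 Y1 with erefl, erefl => f end.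

Lemma arr_castm (X Y X' Y' : C) (eX : X = X') (eY : Y = Y') (f : hom X Y) :
  arr (castm eX eY f) = arr f.
Proof. by case: _ / eX; case: _ / eY. Qed.

End ArrowTheory.

Lemma arr_tensm (R : comPzRingType) (D : smcat R) (X Y Z W X' Y' Z' W' : D)
    (f : hom X Y) (g : hom Z W) (f' : hom X' Y') (g' : hom Z' W') :
  arr f = arr f' -> arr g = arr g' -> arr (tensm f g) = arr (tensm f' g').
Proof.
move=> ef eg; have [eX eY] : X = X' /\ Y = Y'.
  by have := projT1_eq ef => /= -[-> ->].
have [eZ eW] : Z = Z' /\ W = W'.
  by have := projT1_eq eg => /= -[-> ->].
case: _ / eX f' ef => f'; case: _ / eY f' => f' /arr_inj ->.
by case: _ / eZ g' eg => g'; case: _ / eW g' => g' /arr_inj ->.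
Qed.

Section UniversalProperty.

Variables (R : comUnitRingType) (k : int) (z s : R) (D : smcat R).
Variables (obj_up obj_down : D).

Definition obj_gen (u : updown) : D := if u is Up then obj_up else obj_down.

(** One-letter words are sent to the chosen objects themselves and not to
their product with the unit, to which they are equal but not convertible. *)
Fixpoint obj_word (X : udword) : D :=
  match X with
  | [::] => sm_unit D
  | u :: X' => if X' is [::] then obj_gen u else tens (obj_gen u) (obj_word X')
  end.

Lemma obj_word_cons u X : obj_word (u :: X) = tens (obj_gen u) (obj_word X).
Proof. by case: X => //=; rewrite tenso1. Qed.

Lemma obj_word_cat X Y : obj_word (X ++ Y) = tens (obj_word X) (obj_word Y).
Proof.
elim: X => [|u X IHX]; first by rewrite tens1o.
by rewrite cat_cons !obj_word_cons IHX tensA.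
Qed.

Variable gen : forall X Y, heis_gen k X Y -> hom (obj_word X) (obj_word Y).

Fixpoint ev X Y (t : hterm R k X Y) : hom (obj_word X) (obj_word Y) :=
  match t in hterm _ _ X0 Y0 return hom (obj_word X0) (obj_word Y0) with
  | TGen _ _ g => gen g
  | TId X => idm (obj_word X)
  | TComp _ _ _ t u => comp (ev t) (ev u)
  | TTens X Y X' Y' t u =>
      castm (esym (obj_word_cat X X')) (esym (obj_word_cat Y Y')) (tensm (ev t) (ev u))
  | TZero X Y => hom0 (obj_word X) (obj_word Y)
  | TAdd _ _ t u => homD (ev t) (ev u)
  | TScale _ _ a t => homZ a (ev t)
  end.

Lemma arr_ev_tens X Y X' Y' (t : hterm R k X Y) (u : hterm R k X' Y') :
  arr (ev (TTens t u)) = arr (tensm (ev t) (ev u)).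
Proof. exact: arr_castm. Qed.

Hypothesis ev_rel : forall X Y (t u : hterm R k X Y),
  heis_rel z s t u -> ev t = ev u.

(** Apart from the defining relations, the congruence is generated by laws of
strict linear monoidal categories, which hold in [D]. *)
Lemma ev_hcong X Y (t : hterm R k X Y) X' Y' (u : hterm R k X' Y') :
  hcong z s t u -> arr (ev t) = arr (ev u).
Proof.
elim=> {X Y t X' Y' u}.
- by move=> X Y t u tu; rewrite (ev_rel tu).
- by [].
- by move=> X Y t X' Y' u _ ->.
- by move=> X Y t X' Y' u X'' Y'' v _ -> _ ->.
- by move=> *; apply: arr_comp.
- by move=> *; rewrite !arr_ev_tens; apply: arr_tensm.
- by move=> *; apply: arr_homD.
- by move=> *; apply: arr_homZ.
- by move=> X Y t u v /=; congr arr; apply: rm_addA.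
- by move=> X Y t u /=; congr arr; apply: rm_addC.
- by move=> X Y t /=; congr arr; apply: rm_add0.
- by move=> X Y t /=; congr arr; apply: homZN1.
- by move=> X Y a b t /=; congr arr; apply: rm_scaleA.
- by move=> X Y t /=; congr arr; apply: rm_scale1.
- by move=> X Y a t u /=; congr arr; apply: rm_scaleDr.
- by move=> X Y a b t /=; congr arr; apply: rm_scaleDl.
- by move=> *; congr arr; apply: compA.
- by move=> *; congr arr; apply: comp1m.
- by move=> *; congr arr; apply: compm1.
- by move=> *; congr arr; apply: compDl.
- by move=> *; congr arr; apply: compDr.
- by move=> *; congr arr; apply: compZl.
- by move=> *; congr arr; apply: compZr.
- by move=> X Y; rewrite arr_ev_tens tens_id /= obj_word_cat.
- move=> X Y Z X' Y' Z' f g f' g'; rewrite arr_ev_tens tens_comp.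
  by apply: arr_comp; rewrite arr_ev_tens.
- move=> X Y X' Y' f g h; rewrite arr_ev_tens [ev (TAdd f g)]/= tensDl.
  by apply: arr_homD; rewrite arr_ev_tens.
- move=> X Y X' Y' f g h; rewrite arr_ev_tens [ev (TAdd g h)]/= tensDr.
  by apply: arr_homD; rewrite arr_ev_tens.
- move=> X Y X' Y' a f g; rewrite arr_ev_tens [ev (TScale a f)]/= tensZl.
  by apply: arr_homZ; rewrite arr_ev_tens.
- move=> X Y X' Y' a f g; rewrite arr_ev_tens [ev (TScale a g)]/= tensZr.
  by apply: arr_homZ; rewrite arr_ev_tens.
- move=> X Y X' Y' X'' Y'' f g h; rewrite !arr_ev_tens.
  rewrite (arr_tensm (erefl (arr (ev f))) (arr_ev_tens g h)) tensmA.
  by apply: arr_tensm; rewrite // arr_ev_tens.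
- by move=> X Y f; rewrite arr_ev_tens tens1m.
- by move=> X Y f; rewrite arr_ev_tens tensm1.
Qed.

Lemma ev_hclass X Y (t u : hterm R k X Y) : hclass z s t = hclass z s u -> ev t = ev u.
Proof. by move=> /hclassP/ev_hcong/arr_inj. Qed.

Definition heis_fhom X Y (t : @hom R (heis k z s) X Y) : hom (obj_word X) (obj_word Y) :=
  ev (hrepr t).

Lemma heis_fhomE X Y (t : hterm R k X Y) : heis_fhom (hclass z s t) = ev t.
Proof. by apply: ev_hclass; rewrite hreprK. Qed.

Lemma heis_fhom1 (X : heis k z s) : heis_fhom (idm X) = idm (obj_word X).
Proof. exact: (@heis_fhomE X X (TId X)). Qed.

Lemma heis_fhomM (X Y Z : heis k z s) (t : hom Y Z) (u : hom X Y) :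
  heis_fhom (comp t u) = comp (heis_fhom t) (heis_fhom u).
Proof.
elim/heis_ind: t => t; elim/heis_ind: u => u.
by rewrite /= heisE !heis_fhomE.
Qed.

Lemma heis_fhomD (X Y : heis k z s) (t u : hom X Y) :
  heis_fhom (homD t u) = homD (heis_fhom t) (heis_fhom u).
Proof.
elim/heis_ind: t => t; elim/heis_ind: u => u.
by rewrite {1}/homD /= heisE !heis_fhomE.
Qed.

Lemma heis_fhomZ (X Y : heis k z s) a (t : hom X Y) :
  heis_fhom (homZ a t) = homZ a (heis_fhom t).
Proof. by elim/heis_ind: t => t; rewrite {1}/homZ /= heisE !heis_fhomE. Qed.

Definition heis_linfunctor : linfunctor (heis k z s) D :=
  @LinFunctor R (heis k z s) D obj_word heis_fhom heis_fhom1 heis_fhomM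
    heis_fhomD heis_fhomZ.

Lemma heis_fhom_tensm (X Y X' Y' : heis k z s) (t : hom X Y) (u : hom X' Y') :
  arr (fhom heis_linfunctor (tensm t u)) =
  arr (tensm (fhom heis_linfunctor t) (fhom heis_linfunctor u)).
Proof.
elim/heis_ind: t => t; elim/heis_ind: u => u.
by rewrite /= heisE !heis_fhomE arr_ev_tens.
Qed.

Definition heis_functor : smfunctor (heis k z s) D :=
  @SMFunctor R (heis k z s) D heis_linfunctor erefl obj_word_cat heis_fhom_tensm.

Lemma heis_functorE X Y (t : hterm R k X Y) :
  fhom heis_functor (hclass z s t : @hom R (heis k z s) X Y) = ev t.
Proof. exact: heis_fhomE. Qed.

End UniversalProperty.

(** * Uniqueness of functors out of the Heisenberg category *)

HB.instance Definition _ (R : comPzRingType) (C : lincat R) (X Y : C) :=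
  Monoid.isComLaw.Build (hom X Y) (hom0 X Y) (@homD R C X Y)
    (rm_addA (hom_rmod X Y)) (rm_addC (hom_rmod X Y)) (rm_add0 (hom_rmod X Y)).

Definition hsum (R : comPzRingType) (C : lincat R) (X Y : C) n
    (F : 'I_n -> hom X Y) : hom X Y := \big[@homD R C X Y/hom0 X Y]_(a < n) F a.

Section LinCatSums.
Variables (R : comPzRingType) (C : lincat R).

Lemma comp0l (X Y Z : C) (g : hom X Y) : comp (hom0 Y Z) g = hom0 X Z.
Proof.
apply: (@rm_addI _ _ (hom_rmod X Z) (comp (hom0 Y Z) g)).
by rewrite -compDl rm_add0 rm_addC rm_add0.
Qed.

Lemma comp0r (X Y Z : C) (f : hom Y Z) : comp f (hom0 X Y) = hom0 X Z.
Proof.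
apply: (@rm_addI _ _ (hom_rmod X Z) (comp f (hom0 X Y))).
by rewrite -compDr rm_add0 rm_addC rm_add0.
Qed.

Lemma comp_hsumr (X Y Z : C) n (f : hom Y Z) (F : 'I_n -> hom X Y) :
  comp f (hsum F) = hsum (fun a => comp f (F a)).
Proof.
by rewrite /hsum (big_morph (comp f) (id1 := hom0 X Z) (op1 := @homD R C X Z));
  [|exact: compDr|exact: comp0r].
Qed.

Lemma comp_hsuml (X Y Z : C) n (F : 'I_n -> hom Y Z) (g : hom X Y) :
  comp (hsum F) g = hsum (fun a => comp (F a) g).
Proof.
rewrite /hsum (big_morph (fun h => comp h g) (id1 := hom0 X Z) (op1 := @homD R C X Z)) //.
- by move=> h h'; apply: compDl.
- exact: comp0l.
Qed.

Lemma hsum0 (X Y : C) n (F : 'I_n -> hom X Y) : (forall a, F a = hom0 X Y) ->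
  hsum F = hom0 X Y.
Proof. by move=> F0; apply: big1. Qed.

Lemma hsum_delta (X Y : C) n (F : 'I_n -> hom X Y) b :
    (forall a, a != b -> F a = hom0 X Y) -> hsum F = F b.
Proof.
move=> F0; rewrite /hsum (bigD1 b) //= big1 => [|a ab]; last exact: F0.
by rewrite Monoid.mulm1.
Qed.

Lemma inverse_unique (X Y : C) (x : hom X Y) (y y' : hom Y X) :
  comp x y = idm Y -> comp y' x = idm X -> y = y'.
Proof. by move=> xy y'x; rewrite -[y]comp1m -y'x -compA xy compm1. Qed.

(** The two-sided inverse, with entries L, eta a and eps a, of the matrix with
entries S, d a and c a.  Allowing both the column part [d] and the row part [c]
covers all signs of the central charge, one of them being empty. *)
Definition matrix_inverse (P Q U : C) p q (S : hom P Q) (d : 'I_p -> hom P U)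
    (c : 'I_q -> hom U Q) (L : hom Q P) (eta : 'I_p -> hom U P)
    (eps : 'I_q -> hom Q U) : Prop :=
  [/\ homD (comp L S) (hsum (fun a => comp (eta a) (d a))) = idm P,
      homD (comp S L) (hsum (fun a => comp (c a) (eps a))) = idm Q,
      [/\ forall a, comp S (eta a) = hom0 U Q, forall a, comp (d a) L = hom0 Q U &
          forall a b, comp (d a) (eta b) = if a == b then idm U else hom0 U U] &
      [/\ forall a, comp (eps a) S = hom0 P U, forall a, comp L (c a) = hom0 U P &
          forall a b, comp (eps a) (c b) = if a == b then idm U else hom0 U U]].

Lemma matrix_inverse_unique (P Q U : C) p q (S : hom P Q) (d : 'I_p -> hom P U)
    (c : 'I_q -> hom U Q) L L' eta eta' eps eps' :
    matrix_inverse S d c L eta eps -> matrix_inverse S d c L' eta' eps' ->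
  [/\ L = L', forall a, eta a = eta' a & forall a, eps a = eps' a].
Proof.
case=> LS SL [Se dL de] [eS Lc ec] [LS' SL' [Se' dL' de'] [eS' Lc' ec']]; split.
- have e1 : L = comp L (comp S L').
    rewrite -{1}[L]compm1 -SL' compDr comp_hsumr hsum0 => [|a].
      by rewrite rm_addC rm_add0.
    by rewrite compA Lc comp0l.
  rewrite e1 -[RHS]comp1m -LS compDl comp_hsuml hsum0 => [|a].
    by rewrite rm_addC rm_add0 compA.
  by rewrite -compA dL' comp0r.
- move=> b; rewrite -[LHS]comp1m -LS' compDl -compA Se comp0r comp_hsuml rm_add0.
  rewrite (hsum_delta (b := b)) => [|a /negPf ab].
    by rewrite -compA de eqxx compm1.
  by rewrite -compA de ab comp0r.
- move=> b; rewrite -[LHS]compm1 -SL' compDr compA eS comp0l comp_hsumr rm_add0.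
  rewrite (hsum_delta (b := b)) => [|a]; first by rewrite compA ec eqxx comp1m.
  by rewrite eq_sym compA ec => /negPf ->; rewrite comp0l.
Qed.

End LinCatSums.

Lemma fhom_hsum (R : comPzRingType) (C D : lincat R) (F : linfunctor C D) (X Y : C) n
    (G : 'I_n -> hom X Y) : fhom F (hsum G) = hsum (fun a => fhom F (G a)).
Proof.
rewrite /hsum (big_morph (fhom F) (id1 := hom0 (F X) (F Y)) (op1 := @homD R D (F X) (F Y))) //.
- by move=> g g'; apply: fhomD.
- exact: fhom0.
Qed.

Lemma fhom_matrix_inverse (R : comPzRingType) (C D : lincat R) (F : linfunctor C D)
    (P Q U : C) p q (S : hom P Q) (d : 'I_p -> hom P U) (c : 'I_q -> hom U Q)
    (L : hom Q P) (eta : 'I_p -> hom U P) (eps : 'I_q -> hom Q U) :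
    matrix_inverse S d c L eta eps ->
  matrix_inverse (fhom F S) (fun a => fhom F (d a)) (fun a => fhom F (c a))
    (fhom F L) (fun a => fhom F (eta a)) (fun a => fhom F (eps a)).
Proof.
case=> LS SL [Se dL de] [eS Lc ec]; split; first 2 last.
- split=> [a|a|a b]; rewrite -fhomM ?(Se, dL, de) ?fhom0 //.
  by case: eqP; rewrite ?fhom1 ?fhom0.
- split=> [a|a|a b]; rewrite -fhomM ?(eS, Lc, ec) ?fhom0 //.
  by case: eqP; rewrite ?fhom1 ?fhom0.
- rewrite -fhom1 -LS fhomD fhomM fhom_hsum; congr homD.
  by congr hsum; apply: functional_extensionality_dep => a; rewrite fhomM.
- rewrite -fhom1 -SL fhomD fhomM fhom_hsum; congr homD.
  by congr hsum; apply: functional_extensionality_dep => a; rewrite fhomM.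
Qed.

Section HeisInverse.
Variables (R : comUnitRingType) (k : int) (z s : R).
Local Notation cl t := (hclass z s t).
Local Notation HC := (heis k z s).

Lemma hclass_rel X Y (t u : hterm R k X Y) : heis_rel z s t u ->
  (cl t : @hom R HC X Y) = cl u.
Proof. by move=> tu; apply/hclassP/HC_rel. Qed.

Lemma hclass_comp X Y Z (t : hterm R k Y Z) (u : hterm R k X Y) :
  (cl (TComp t u) : @hom R HC X Z) = comp (cl t : @hom R HC Y Z) (cl u : @hom R HC X Y).
Proof. by rewrite /= heisE. Qed.

Lemma hclass_add X Y (t u : hterm R k X Y) :
  (cl (TAdd t u) : @hom R HC X Y) = homD (cl t : @hom R HC X Y) (cl u : @hom R HC X Y).
Proof. by rewrite /homD /= heisE. Qed.

Lemma hclass_sum X Y n (F : 'I_n -> hterm R k X Y) :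
  (cl (tsum F) : @hom R HC X Y) = hsum (fun a => cl (F a) : @hom R HC X Y).
Proof.
rewrite /tsum /hsum.
by apply: (big_morph (fun t => cl t : @hom R HC X Y) (id1 := hom0 (X : HC) (Y : HC))
  (op1 := @homD R HC X Y)) => // t u; apply: hclass_add.
Qed.

Lemma heis_matrix_inverse : matrix_inverse
  (cl (tsigma R k) : @hom R HC [:: Up; Down] [:: Down; Up])
  (fun a : 'I_(pos_part k) => cl (tdx R k a) : @hom R HC [:: Up; Down] [::])
  (fun a : 'I_(neg_part k) => cl (txc R k a) : @hom R HC [::] [:: Down; Up])
  (cl (tL R k) : @hom R HC [:: Down; Up] [:: Up; Down])
  (fun a => cl (teta R a) : @hom R HC [::] [:: Up; Down])
  (fun a => cl (teps R a) : @hom R HC [:: Down; Up] [::]).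
Proof.
split; first 2 last.
- split=> [a|a|a b]; rewrite -hclass_comp.
  + exact/hclass_rel/HR_sigmaeta.
  + exact/hclass_rel/HR_dxL.
  + by rewrite (hclass_rel (HR_dxeta _ _ _ _)); case: eqP.
- split=> [a|a|a b]; rewrite -hclass_comp.
  + exact/hclass_rel/HR_epssigma.
  + exact/hclass_rel/HR_Lxc.
  + by rewrite (hclass_rel (HR_epsxc _ _ _ _)); case: eqP.
- have /hclass_rel := @HR_Lsigma R k z s; rewrite hclass_add hclass_comp hclass_sum.
  move=> e; rewrite -[RHS]e; congr homD; congr hsum.
  by apply: functional_extensionality_dep => a; rewrite hclass_comp.
- have /hclass_rel := @HR_sigmaL R k z s; rewrite hclass_add hclass_comp hclass_sum.
  move=> e; rewrite -[RHS]e; congr homD; congr hsum.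
  by apply: functional_extensionality_dep => a; rewrite hclass_comp.
Qed.

End HeisInverse.

Section FunctorUniqueness.

Variables (R : comUnitRingType) (k : int) (z s : R) (D : smcat R).
Local Notation HC := (heis k z s).
Local Notation cl t := (hclass z s t).

Lemma heis_fun_obj (F G : smfunctor HC D) :
    F heis_up = G heis_up -> F heis_down = G heis_down ->
  forall X : HC, F X = G X.
Proof.
move=> eu ed; elim=> [|u X IHX].
  by rewrite (sm_fun_unit F) (sm_fun_unit G).
have := sm_fun_tens F [:: u] X => /= ->; have := sm_fun_tens G [:: u] X => /= ->.
by rewrite IHX; congr tens; case: u.
Qed.

(** Two functors with the same object map, in unbundled form: once the equality
of object maps has been eliminated, the morphism maps have the same type. *)
Section SameObjects.

Variable fo : HC -> D.
Variables fh fh' : forall X Y : HC, hom X Y -> hom (fo X) (fo Y).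
Hypotheses
  (fh1 : forall X, fh (idm X) = idm (fo X))
  (fhM : forall X Y Z (f : hom Y Z) (g : hom X Y), fh (comp f g) = comp (fh f) (fh g))
  (fhD : forall X Y (f g : hom X Y), fh (homD f g) = homD (fh f) (fh g))
  (fhZ : forall X Y a (f : hom X Y), fh (homZ a f) = homZ a (fh f)).
Hypotheses
  (fh1' : forall X, fh' (idm X) = idm (fo X))
  (fhM' : forall X Y Z (f : hom Y Z) (g : hom X Y), fh' (comp f g) = comp (fh' f) (fh' g))
  (fhD' : forall X Y (f g : hom X Y), fh' (homD f g) = homD (fh' f) (fh' g))
  (fhZ' : forall X Y a (f : hom X Y), fh' (homZ a f) = homZ a (fh' f)).
Hypothesis fhT : forall X Y X' Y' (f : hom X Y) (g : hom X' Y'),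
  arr (fh (tensm f g)) = arr (tensm (fh f) (fh g)).
Hypothesis fhT' : forall X Y X' Y' (f : hom X Y) (g : hom X' Y'),
  arr (fh' (tensm f g)) = arr (tensm (fh' f) (fh' g)).
Hypotheses (ex : fh heis_x = fh' heis_x) (et : fh heis_tau = fh' heis_tau)
  (ec : fh heis_c = fh' heis_c) (edd : fh heis_d = fh' heis_d).

Let F := @LinFunctor R HC D fo fh fh1 fhM fhD fhZ.
Let F' := @LinFunctor R HC D fo fh' fh1' fhM' fhD' fhZ'.
Let agree X Y (t : hterm R k X Y) :=
  fhom F (cl t : @hom R HC X Y) = fhom F' (cl t : @hom R HC X Y).

Let agree_id X : agree (TId X).
Proof. exact: etrans (fh1 X) (esym (fh1' X)). Qed.

Let agree_comp X Y Z (t : hterm R k Y Z) (u : hterm R k X Y) :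
  agree t -> agree u -> agree (TComp t u).
Proof. by rewrite /agree hclass_comp !fhomM => -> ->. Qed.

Let agree_tens X Y X' Y' (t : hterm R k X Y) (u : hterm R k X' Y') :
  agree t -> agree u -> agree (TTens t u).
Proof.
move=> et' eu'; rewrite /agree.
have -> : (cl (TTens t u) : @hom R HC (X ++ X') (Y ++ Y')) =
    @tensm R HC X Y X' Y' (cl t) (cl u) by rewrite /= heisE.
apply: arr_inj; rewrite [LHS]fhT [RHS]fhT'; congr arr.
by congr tensm.
Qed.

Let agree_zero X Y : agree (@TZero R k X Y).
Proof. by rewrite /agree -[cl _]/(hom0 (X : HC) (Y : HC)) !fhom0. Qed.

Let agree_add X Y (t u : hterm R k X Y) : agree t -> agree u -> agree (TAdd t u).
Proof. by rewrite /agree hclass_add !fhomD => -> ->. Qed.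

Let agree_scale X Y a (t : hterm R k X Y) : agree t -> agree (TScale a t).
Proof.
rewrite /agree => e; have -> : (cl (TScale a t) : @hom R HC X Y) = homZ a (cl t : @hom R HC X Y).
  by rewrite /homZ /= heisE.
by rewrite !fhomZ; congr homZ.
Qed.

(** sigma_+, d x^a and x^a c are composed of x, tau, c and d, so the functors agree
on them, hence on the entries of the inverse matrix and on the inverse of x. *)
Lemma same_obj_fhom X Y (t : @hom R HC X Y) : fh t = fh' t.
Proof.
have ax : agree (tx R k) by apply: ex.
have at_ : agree (ttau R k) by apply: et.
have ac : agree (tc R k) by apply: ec.
have ad : agree (td R k) by apply: edd.
have apow m : agree (tpow R k m).
  by elim: m => [|m IHm] /=; [exact: agree_id|exact: agree_comp].
have asigma : agree (tsigma R k).
  have id_u := agree_id [:: Up]; have id_d := agree_id [:: Down].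
  exact: agree_comp (agree_comp (agree_tens (agree_tens id_d id_u) ad)
    (agree_tens (agree_tens id_d at_) id_d)) (agree_tens (agree_tens ac id_u) id_d).
have adx a : agree (tdx R k a).
  exact: agree_comp ad (agree_tens (apow a) (agree_id [:: Down])).
have axc a : agree (txc R k a).
  exact: agree_comp (agree_tens (agree_id [:: Down]) (apow a)) ac.
have [aL aeta aeps] : [/\ agree (tL R k), forall a, agree (teta R a) &
    forall a, agree (teps R a)].
  have mi := fhom_matrix_inverse F (heis_matrix_inverse k z s).
  have mi' := fhom_matrix_inverse F' (heis_matrix_inverse k z s).
  have eS : fhom F (cl (tsigma R k) : @hom R HC [:: Up; Down] [:: Down; Up]) =
    fhom F' (cl (tsigma R k) : @hom R HC [:: Up; Down] [:: Down; Up]) := asigma.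
  have eD : (fun a : 'I_(pos_part k) => fhom F (cl (tdx R k a) : @hom R HC [:: Up; Down] [::])) =
      (fun a => fhom F' (cl (tdx R k a) : @hom R HC [:: Up; Down] [::])).
    by apply: functional_extensionality_dep => a; apply: adx.
  have eC : (fun a : 'I_(neg_part k) => fhom F (cl (txc R k a) : @hom R HC [::] [:: Down; Up])) =
      (fun a => fhom F' (cl (txc R k a) : @hom R HC [::] [:: Down; Up])).
    by apply: functional_extensionality_dep => a; apply: axc.
  by rewrite eS eD eC in mi; have [eL eeta eeps] := matrix_inverse_unique mi mi'.
have axi : agree (txi R k).
  have xV := hclass_rel (@HR_xV R k z s); have Vx := hclass_rel (@HR_Vx R k z s).
  rewrite hclass_comp in xV; rewrite hclass_comp in Vx.
  pose x : @hom R HC [:: Up] [:: Up] := cl (tx R k).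
  pose xi : @hom R HC [:: Up] [:: Up] := cl (txi R k).
  have e : comp (fhom F x) (fhom F xi) = idm (F [:: Up]) by rewrite -fhomM xV fhom1.
  have e' : comp (fhom F' xi) (fhom F' x) = idm (F' [:: Up]) by rewrite -fhomM Vx fhom1.
  have eqx : fhom F x = fhom F' x := ax.
  by rewrite eqx in e; apply: inverse_unique e e'.
suff all_agree X' Y' (u : hterm R k X' Y') : agree u by elim/heis_ind: t => t; apply: all_agree.
elim: u => {X' Y'} [X' Y' [] //|X'|||X' Y'|X' Y' u IHu v IHv|X' Y' a u IHu].
- exact: agree_id.
- by move=> *; apply: agree_comp.
- by move=> *; apply: agree_tens.
- exact: agree_zero.
- exact: agree_add.
- exact: agree_scale.
Qed.

End SameObjects.

Theorem heis_functor_unique (F G : smfunctor HC D) :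
    F heis_up = G heis_up -> F heis_down = G heis_down ->
    arr (fhom F heis_x) = arr (fhom G heis_x) ->
    arr (fhom F heis_tau) = arr (fhom G heis_tau) ->
    arr (fhom F heis_c) = arr (fhom G heis_c) ->
    arr (fhom F heis_d) = arr (fhom G heis_d) ->
  F = G.
Proof.
move=> eu ed ex et ec edd; have eo := heis_fun_obj eu ed.
case: F G eo ex et ec edd {eu ed} => [[fo fh fh1 fhM fhD fhZ] fu ft fT].
move=> [[fo' fh' fh1' fhM' fhD' fhZ'] fu' ft' fT'] /= eo.
have {}eo : fo = fo' by apply: functional_extensionality_dep.
case: _ / eo fh' fh1' fhM' fhD' fhZ' fu' ft' fT' => fh' fh1' fhM' fhD' fhZ' fu' ft' fT'.
move=> /arr_inj ex /arr_inj et /arr_inj ec /arr_inj edd.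
have efh : fh = fh'.
  apply: functional_extensionality_dep => X; apply: functional_extensionality_dep => Y.
  apply: functional_extensionality_dep => t.
  exact: (same_obj_fhom fh1 fhM fhD fhZ fh1' fhM' fhD' fhZ' fT fT' ex et ec edd).
case: _ / efh fh1' fhM' fhD' fhZ' fu' ft' fT' {ex et ec edd} => fh1' fhM' fhD' fhZ' fu' ft' fT'.
have e := LinFunctor_eq fh1 fhM fhD fhZ fh1' fhM' fhD' fhZ'.
case: _ / e fu' ft' fT' => fu' ft' fT'.
by congr SMFunctor; apply: Prop_irrelevance.
Qed.

End FunctorUniqueness.

(** * Evaluation of terms in a category of endofunctors *)

Lemma arr_ncomp (R : comPzRingType) (C : lincat R) (F G F' G' : endcat C)
    (a : hom F G) (b : hom F' G') (M : C) :
  arr a = arr b -> arr (ncomp a M) = arr (ncomp b M).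
Proof.
move=> e; have [eF eG] : F = F' /\ G = G' by have := projT1_eq e => /= -[-> ->].
by case: _ / eF b e => b; case: _ / eG b => b /arr_inj ->.
Qed.

Fixpoint npow (R : comPzRingType) (C : lincat R) (X : C) (x : hom X X) (m : nat) :
    hom X X := if m is m'.+1 then comp x (npow x m') else idm X.

Section EndCategoryAction.

Variables (R : comUnitRingType) (k : int) (C : lincat R) (U D : endcat C).

Local Notation W := (@obj_word R (endcat C) U D).
Variable gen : forall X Y, heis_gen k X Y -> hom (W X) (W Y).
Local Notation ev := (ev gen).
Local Notation hterm := (hterm R k).
Local Open Scope heis_scope.
Local Notation "1u" := (TId [:: Up]).
Local Notation "1d" := (TId [:: Down]).
Local Notation x := (gen (Gx k) : hom U U).
Local Notation xi := (gen (Gxi k) : hom U U).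
Local Notation tau := (gen (Gtau k) : hom (tens U U) (tens U U)).
Local Notation c := (gen (Gc k) : hom (sm_unit (endcat C)) (tens D U)).
Local Notation d := (gen (Gd k) : hom (tens U D) (sm_unit (endcat C))).

(** The component at [M] of an evaluated term has the composite of the functors
of a word as source and target; which form of this composite appears depends
on the bracketing of the term, hence the detour through [arr]. *)
Lemma ev_tens_at X Y X' Y' (t : hterm X Y) (u : hterm X' Y') M :
  arr (ncomp (ev (t \ox u)) M) =
  arr (comp (ncomp (ev t) (W Y' M)) (fhom (W X) (ncomp (ev u) M))).
Proof. exact: (arr_ncomp M (arr_ev_tens gen t u)). Qed.

Lemma ev_tens1_at X X' Y' (u : hterm X' Y') M :
  arr (ncomp (ev (TId X \ox u)) M) = arr (fhom (W X) (ncomp (ev u) M)).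
Proof. by rewrite ev_tens_at /= comp1m. Qed.

Lemma ev_tensr1_at X Y X' (t : hterm X Y) M :
  arr (ncomp (ev (t \ox TId X')) M) = arr (ncomp (ev t) (W X' M)).
Proof. by rewrite ev_tens_at /= fhom1 compm1. Qed.

Lemma ev_sigma_at M : ncomp (ev (tsigma R k)) M =
  comp (fhom D (fhom U (ncomp d M)))
    (comp (fhom D (ncomp tau (D M))) (ncomp c (U (D M)))) :> hom (U (D M)) (D (U M)).
Proof.
have e1 : ncomp (ev (1d \ox 1u \ox td R k)) M = fhom D (fhom U (ncomp d M))
    :> hom (D (U (U (D M)))) (D (U M)).
  apply: arr_inj; apply: etrans (ev_tens_at (1d \ox 1u) (td R k) M) _.
  have -> : ncomp (ev (1d \ox 1u)) M = idm (D (U M)) :> hom (D (U M)) (D (U M)).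
    apply: arr_inj; apply: etrans (ev_tens1_at [:: Down] 1u M) _.
    by rewrite /= fhom1.
  by rewrite comp1m.
have e2 : ncomp (ev (1d \ox ttau R k \ox 1d)) M = fhom D (ncomp tau (D M))
    :> hom (D (U (U (D M)))) (D (U (U (D M)))).
  by apply: arr_inj; apply: etrans (ev_tensr1_at [:: Down] (1d \ox ttau R k) M) _;
    apply: (ev_tens1_at [:: Down] (ttau R k) (D M)).
have e3 : ncomp (ev (tc R k \ox 1u \ox 1d)) M = ncomp c (U (D M))
    :> hom (U (D M)) (D (U (U (D M)))).
  by apply: arr_inj; apply: etrans (ev_tensr1_at [:: Down] (tc R k \ox 1u) M) _;
    apply: (ev_tensr1_at [:: Up] (tc R k) (D M)).
rewrite compA -[in RHS]e1 -[in RHS]e2 -[in RHS]e3; reflexivity.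
Qed.

Lemma ev_pow m : ev (tpow R k m) = npow x m.
Proof. by elim: m => //= m ->. Qed.

Lemma ev_dx_at a M : ncomp (ev (tdx R k a)) M =
  comp (ncomp d M) (ncomp (npow x a) (D M)) :> hom (U (D M)) M.
Proof.
have e : ncomp (ev (tpow R k a \ox 1d)) M = ncomp (npow x a) (D M)
    :> hom (U (D M)) (U (D M)).
  by rewrite -ev_pow; apply: arr_inj; apply: (ev_tensr1_at [:: Down] (tpow R k a)).
by rewrite -[in RHS]e; reflexivity.
Qed.

Lemma ev_taux : (forall M, comp (ncomp tau M) (comp (fhom U (ncomp x M)) (ncomp tau M)) =
    ncomp x (U M)) ->
  ev (ttau R k \c (1u \ox tx R k) \c ttau R k) = ev (tx R k \ox 1u).
Proof.
move=> h; apply: nattrans_eq => M.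
have e1 : ncomp (ev (1u \ox tx R k)) M = fhom U (ncomp x M) :> hom (U (U M)) (U (U M)).
  by apply: arr_inj; apply: (ev_tens1_at [:: Up] (tx R k)).
have e2 : ncomp (ev (tx R k \ox 1u)) M = ncomp x (U M) :> hom (U (U M)) (U (U M)).
  by apply: arr_inj; apply: (ev_tensr1_at [:: Up] (tx R k)).
by rewrite [RHS]e2 -h -e1 compA; reflexivity.
Qed.

Lemma ev_braid : (forall M,
    comp (ncomp tau (U M)) (comp (fhom U (ncomp tau M)) (ncomp tau (U M))) =
    comp (fhom U (ncomp tau M)) (comp (ncomp tau (U M)) (fhom U (ncomp tau M)))) ->
  ev ((ttau R k \ox 1u) \c (1u \ox ttau R k) \c (ttau R k \ox 1u)) =
  ev ((1u \ox ttau R k) \c (ttau R k \ox 1u) \c (1u \ox ttau R k)).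
Proof.
move=> h; apply: nattrans_eq => M.
have e1 : ncomp (ev (1u \ox ttau R k)) M = fhom U (ncomp tau M)
    :> hom (U (U (U M))) (U (U (U M))).
  by apply: arr_inj; apply: (ev_tens1_at [:: Up] (ttau R k)).
have e2 : ncomp (ev (ttau R k \ox 1u)) M = ncomp tau (U M)
    :> hom (U (U (U M))) (U (U (U M))).
  by apply: arr_inj; apply: (ev_tensr1_at [:: Up] (ttau R k)).
by have := h M; rewrite -e1 -e2 !compA; apply.
Qed.

Lemma ev_zigzag_up : (forall M,
    comp (ncomp d (U M)) (fhom U (ncomp c M)) = idm (U M)) ->
  ev ((td R k \ox 1u) \c (1u \ox tc R k)) = ev 1u.
Proof.
move=> h; apply: nattrans_eq => M.
have e1 : ncomp (ev (1u \ox tc R k)) M = fhom U (ncomp c M) :> hom (U M) (U (D (U M))).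
  by apply: arr_inj; apply: (ev_tens1_at [:: Up] (tc R k)).
have e2 : ncomp (ev (td R k \ox 1u)) M = ncomp d (U M) :> hom (U (D (U M))) (U M).
  by apply: arr_inj; apply: (ev_tensr1_at [:: Up] (td R k)).
by have := h M; rewrite -e1 -e2; apply.
Qed.

Lemma ev_zigzag_down : (forall M,
    comp (fhom D (ncomp d M)) (ncomp c (D M)) = idm (D M)) ->
  ev ((1d \ox td R k) \c (tc R k \ox 1d)) = ev 1d.
Proof.
move=> h; apply: nattrans_eq => M.
have e1 : ncomp (ev (1d \ox td R k)) M = fhom D (ncomp d M) :> hom (D (U (D M))) (D M).
  by apply: arr_inj; apply: (ev_tens1_at [:: Down] (td R k)).
have e2 : ncomp (ev (tc R k \ox 1d)) M = ncomp c (D M) :> hom (D M) (D (U (D M))).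
  by apply: arr_inj; apply: (ev_tensr1_at [:: Down] (tc R k)).
by have := h M; rewrite -e1 -e2; apply.
Qed.

Lemma ev_sum X Y n (F : 'I_n -> hterm X Y) : ev (tsum F) = hsum (fun a => ev (F a)).
Proof.
by rewrite /tsum /hsum (big_morph (fun t : hterm X Y => ev t) (id1 := hom0 (W X) (W Y))
  (op1 := @homD R (endcat C) (W X) (W Y))).
Qed.

End EndCategoryAction.

Lemma ev_cap_cup_at (R : comUnitRingType) (C : lincat R) (U D : endcat C) (m : nat)
    (gen : forall X Y, heis_gen (Posz m.+1) X Y ->
       hom (@obj_word R (endcat C) U D X) (@obj_word R (endcat C) U D Y))
    (z s : R) (M : C) :
  ncomp (ev gen (TComp (td R (Posz m.+1)) (tcp z s (Posz m.+1)))) M =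
  comp (ncomp (gen _ _ (Gd _) : hom (tens U D) (sm_unit (endcat C))) M)
    (homZ (- (s^-1 * z^-1))
      (comp (ncomp (gen _ _ (Gxi _) : hom U U) (D M))
            (ncomp (gen _ _ (@Geta (Posz m.+1) ord_max) : hom (sm_unit (endcat C)) (tens U D)) M)))
  :> hom M M.
Proof.
have e : ncomp (ev gen (TTens (txi R (Posz m.+1)) (TId [:: Down]))) M =
    ncomp (gen _ _ (Gxi _) : hom U U) (D M) :> hom (U (D M)) (U (D M)).
  by apply: arr_inj; apply: (ev_tensr1_at gen [:: Down] (txi R (Posz m.+1)) M).
by rewrite -[in RHS]e; reflexivity.
Qed.

Section SigmaTransformation.

Variables (R : comUnitRingType) (C : lincat R) (U D : endcat C).
Variables (x : hom U U) (tau : hom (tens U U) (tens U U))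
  (c : hom (sm_unit (endcat C)) (tens D U)) (d : hom (tens U D) (sm_unit (endcat C))).

Definition sigma_at (M : C) : hom (U (D M)) (D (U M)) :=
  comp (fhom D (fhom U (ncomp d M)))
    (comp (fhom D (ncomp tau (D M))) (ncomp c (U (D M)))).

Lemma sigma_natural (M N : C) (h : hom M N) :
  comp (fhom D (fhom U h)) (sigma_at M) = comp (sigma_at N) (fhom U (fhom D h)).
Proof.
have nd := natural d h; have nt := natural tau (fhom D h).
have nc := natural c (fhom U (fhom D h)); rewrite /= in nd nt nc.
have e1 : comp (fhom D (fhom U h)) (fhom D (fhom U (ncomp d M))) =
    comp (fhom D (fhom U (ncomp d N))) (fhom D (fhom U (fhom U (fhom D h)))).
  by rewrite -(fhomM D) -(fhomM U) nd (fhomM U) (fhomM D).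
have e2 : comp (fhom D (fhom U (fhom U (fhom D h)))) (fhom D (ncomp tau (D M))) =
    comp (fhom D (ncomp tau (D N))) (fhom D (fhom U (fhom U (fhom D h)))).
  by rewrite -(fhomM D) nt (fhomM D).
by rewrite /sigma_at compA e1 -compA (compA _ (fhom D (ncomp tau (D M)))) e2 -compA nc !compA.
Qed.

(** The transformation sigma_+ with components that do not mention the words
used in its definition as a term. *)
Definition sigma_nat : hom (tens U D) (tens D U) :=
  @NatTrans R C C (funcomp U D) (funcomp D U) sigma_at sigma_natural.

Definition dx_nat a : hom (tens U D) (sm_unit (endcat C)) :=
  comp d (tensm (npow x a) (idm D)).

Lemma dx_nat_at a M : ncomp (dx_nat a) M =
  comp (ncomp d M) (ncomp (npow x a) (D M)).
Proof. by rewrite /= fhom1 compm1. Qed.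

End SigmaTransformation.

(** * Inverses computed degreewise in a sum of module categories *)

(** If the transformations [S] and [d a] together are bijective on the elements of
every module, the inverse maps are automatically linear and natural.  They are
picked by choice, and every identity about them is checked after applying [S]
and the [d a], by injectivity. *)
Section PointwiseInverse.

Variables (R : comPzRingType) (A : nat -> ralg R).
Local Notation C := (dsum (fun n => modcat (A n))).
Variables (F G : endcat C) (l : nat) (S : hom F G) (d : 'I_l -> hom F (sm_unit (endcat C))).

Definition deg (H : endcat C) (M : C) n : lmodType (A n) := H M n.

Definition s_at M n (th : deg F M n) : deg G M n := ncomp S M n th.
Definition d_at (a : 'I_l) M n (th : deg F M n) : (M n : lmodType (A n)) := ncomp (d a) M n th.

Hypothesis bij : forall M n (g : deg G M n) (m : 'I_l -> (M n : lmodType (A n))),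
  exists th : deg F M n, s_at th = g /\ forall a, d_at a th = m a.
Hypothesis inj : forall M n (th : deg F M n),
  s_at th = 0 -> (forall a, d_at a th = 0) -> th = 0.

Lemma s_at_linear M n : linear (@s_at M n).
Proof. by move=> a u v; rewrite /s_at linearP. Qed.
Lemma d_at_linear a M n : linear (@d_at a M n).
Proof. by move=> b u v; rewrite /d_at linearP. Qed.

Lemma pointwise_eq M n (th th' : deg F M n) :
  s_at th = s_at th' -> (forall a, d_at a th = d_at a th') -> th = th'.
Proof.
move=> es ed; apply/eqP; rewrite -subr_eq0; apply/eqP; apply: inj => [|a].
  by rewrite -scaleN1r addrC s_at_linear es scaleN1r addNr.
by rewrite -scaleN1r addrC d_at_linear ed scaleN1r addNr.
Qed.

Definition pinv M n (g : deg G M n) (m : 'I_l -> (M n : lmodType (A n))) : deg F M n :=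
  projT1 (cid (bij g m)).
Lemma pinv_s M n (g : deg G M n) m : s_at (pinv g m) = g.
Proof. by rewrite /pinv; case: cid => th []. Qed.
Lemma pinv_d M n (g : deg G M n) m a : d_at a (pinv g m) = m a.
Proof. by rewrite /pinv; case: cid => th []. Qed.

Definition inv_L_fun M n (g : deg G M n) : deg F M n := pinv g (fun=> 0).
Lemma inv_L_is_linear M n : linear (@inv_L_fun M n).
Proof.
move=> b u v; apply: pointwise_eq => [|a].
  by rewrite s_at_linear !pinv_s.
by rewrite d_at_linear !pinv_d scaler0 addr0.
Qed.
HB.instance Definition _ M n := GRing.isLinear.Build (A n) (deg G M n) (deg F M n)
  *:%R (@inv_L_fun M n) (@inv_L_is_linear M n).
Definition inv_L_at M : hom (G M) (F M) :=
  fun n => (@inv_L_fun M n : {linear deg G M n -> deg F M n}).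

Definition inv_eta_fun (a : 'I_l) (M : C) n (v : (M n : lmodType (A n))) : deg F M n :=
  pinv 0 (fun b => if b == a then v else 0).
Lemma inv_eta_is_linear a M n : linear (@inv_eta_fun a M n).
Proof.
move=> b u v; apply: pointwise_eq => [|a'].
  by rewrite s_at_linear !pinv_s scaler0 addr0.
by rewrite d_at_linear !pinv_d; case: eqP => // _; rewrite scaler0 addr0.
Qed.
HB.instance Definition _ a (M : C) n := GRing.isLinear.Build (A n) (M n) (deg F M n)
  *:%R (@inv_eta_fun a M n) (@inv_eta_is_linear a M n).
Definition inv_eta_at a (M : C) : hom M (F M) :=
  fun n => (@inv_eta_fun a M n : {linear (M n : lmodType (A n)) -> deg F M n}).

Lemma s_at_natural (M N : C) (h : hom M N) n (th : deg F M n) :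
  s_at (fhom F h n th : deg F N n) = fhom G h n (s_at th).
Proof.
exact: esym (congr1 (fun q : dsum_hom (F M) (G N) =>
  (q n : {linear deg F M n -> deg G N n}) th) (natural S h)).
Qed.

Lemma d_at_natural (M N : C) (h : hom M N) n a (th : deg F M n) :
  d_at a (fhom F h n th : deg F N n) = h n (d_at a th).
Proof.
exact: esym (congr1 (fun q : dsum_hom (F M) N =>
  (q n : {linear deg F M n -> (N n : lmodType (A n))}) th) (natural (d a) h)).
Qed.

Lemma inv_L_natural (M N : C) (h : hom M N) :
  comp (fhom F h) (inv_L_at M) = comp (inv_L_at N) (fhom G h).
Proof.
apply: dsum_hom_eq => n; apply: linear_fun_eq => g.
apply: (@pointwise_eq N n) => [|a].
  by rewrite s_at_natural /= !pinv_s.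
by rewrite d_at_natural /= !pinv_d raddf0.
Qed.
Definition inv_L : hom G F := NatTrans inv_L_natural.

Lemma inv_eta_natural a (M N : C) (h : hom M N) :
  comp (fhom F h) (inv_eta_at a M) = comp (inv_eta_at a N) h.
Proof.
apply: dsum_hom_eq => n; apply: linear_fun_eq => v.
apply: (@pointwise_eq N n) => [|b].
  by rewrite s_at_natural /= !pinv_s raddf0.
by rewrite d_at_natural /= !pinv_d; case: eqP => // _; rewrite raddf0.
Qed.
Definition inv_eta a : hom (sm_unit (endcat C)) F :=
  @NatTrans R C C (idfunctor C) F (inv_eta_at a) (@inv_eta_natural a).

Lemma hsum_at (H H' : endcat C) m (T : 'I_m -> hom H H') (M : C) n (v : deg H M n) :
  (ncomp (hsum T) M n v : deg H' M n) = \sum_a (ncomp (T a) M n v : deg H' M n).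
Proof.
exact: (big_morph (fun t : hom H H' => ncomp t M n v : deg H' M n)
  (id1 := 0) (op1 := +%R)).
Qed.

Lemma s_at_sum M n m (th : 'I_m -> deg F M n) : s_at (\sum_a th a) = \sum_a s_at (th a).
Proof. exact: (raddf_sum (ncomp S M n : {linear deg F M n -> deg G M n})). Qed.

Lemma d_at_sum b M n m (th : 'I_m -> deg F M n) :
  d_at b (\sum_a th a) = \sum_a d_at b (th a).
Proof.
exact: (raddf_sum (ncomp (d b) M n : {linear deg F M n -> (M n : lmodType (A n))})).
Qed.

Lemma pointwise_matrix_inverse (c : 'I_0 -> hom (sm_unit (endcat C)) G)
    (eps : 'I_0 -> hom G (sm_unit (endcat C))) :
  matrix_inverse S d c inv_L inv_eta eps.
Proof.
have sD M n (u v : deg F M n) : s_at (u + v) = s_at u + s_at v.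
  exact: (raddfD (ncomp S M n : {linear deg F M n -> deg G M n})).
have dD a M n (u v : deg F M n) : d_at a (u + v) = d_at a u + d_at a v.
  exact: (raddfD (ncomp (d a) M n : {linear deg F M n -> (M n : lmodType (A n))})).
split; last by split=> -[].
- apply: nattrans_eq => M; apply: dsum_hom_eq => n; apply: linear_fun_eq => th.
  have -> : (ncomp (homD (comp inv_L S) (hsum (fun a => comp (inv_eta a) (d a)))) M n th
      : deg F M n) = inv_L_fun (s_at th) + \sum_a inv_eta_fun a (d_at a th).
    by congr (_ + _); apply: hsum_at.
  apply: (@pointwise_eq M n) => [|b].
    rewrite sD s_at_sum pinv_s big1 ?addr0 // => a _; exact: pinv_s.
  rewrite dD d_at_sum pinv_d add0r (bigD1 b) //= pinv_d eqxx big1 ?addr0 // => a.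
  by rewrite pinv_d eq_sym => /negPf ->.
- apply: nattrans_eq => M; apply: dsum_hom_eq => n; apply: linear_fun_eq => g.
  have -> : (ncomp (homD (comp S inv_L) (hsum (fun a => comp (c a) (eps a)))) M n g
      : deg G M n) = s_at (inv_L_fun g) + \sum_a ncomp (comp (c a) (eps a)) M n g.
    by congr (_ + _); apply: hsum_at.
  by rewrite pinv_s big_ord0 addr0.
- split=> [a|a|a b]; apply: nattrans_eq => M; apply: dsum_hom_eq => n;
    apply: linear_fun_eq => v.
  + exact: pinv_s.
  + exact: pinv_d.
  + by apply: etrans (pinv_d _ _ _) _; case: eqP.
Qed.

End PointwiseInverse.

(** * The generating transformations on modules over Hecke algebras *)

Section HeckeAction.

Variables (R : comUnitRingType) (z : R) (f : {poly R}).

Local Notation H n := (hecke z f n).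
Local Notation incl n := (hecke_incl z f n).
Local Notation tau n := (@ht R z f n.+2 ord_max).
Local Notation taui n := (@hti R z f n.+2 ord_max).
Local Notation xlast n := (@hx R z f n.+1 ord_max).
Local Notation xilast n := (@hxi R z f n.+1 ord_max).
Local Notation C := (hmods z f).
Local Notation U := (res_endo z f).
Local Notation D := (coind_endo z f).

Section ActXi.
Variables (n : nat) (M : lmodType (H n.+1)).
Definition act_xi_fun (v : res (incl n) M) : res (incl n) M := xilast n *: (v : M).
Lemma act_xi_is_linear : linear act_xi_fun.
Proof.
move=> a u v; rewrite /act_xi_fun scalerDr; congr (_ + _).
rewrite /GRing.scale /= /res_scale -[LHS]/(_ *: (_ *: _ : M)) !scalerA.
by rewrite (hx_hxi_comm (esym (hx_last_comm a))).
Qed.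
HB.instance Definition _ := GRing.isLinear.Build (H n) (res (incl n) M)
  (res (incl n) M) *:%R act_xi_fun act_xi_is_linear.
Definition act_xi : {linear res (incl n) M -> res (incl n) M} := act_xi_fun.
End ActXi.

Definition psi_xi : @hom R (endcat C) U U.
Proof.
exists (fun (M : C) n => act_xi (M n.+1)) => M N g.
apply: dsum_hom_eq => n; apply: linear_fun_eq => v.
exact: (linearZZ (g n.+1)).
Defined.

Local Notation x := (psi_x z f).
Local Notation xi := psi_xi.
Local Notation tau_ := (psi_tau z f).
Local Notation c := (psi_c z f).
Local Notation d := (psi_d z f).

Lemma hmods_eq (F G : endcat C) (a b : hom F G) :
  (forall (M : C) n (v : (F M n : lmodType (H n))), ncomp a M n v = ncomp b M n v) -> a = b.
Proof.
move=> ab; apply: nattrans_eq => M; apply: dsum_hom_eq => n.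
by apply: linear_fun_eq => v; apply: ab.
Qed.

Lemma psi_xV : comp x xi = idm U.
Proof.
apply: hmods_eq => M n v; apply: etrans (scalerA _ _ (v : (M n.+1 : lmodType (H n.+1)))) _.
by rewrite hxV scale1r.
Qed.

Lemma psi_Vx : comp xi x = idm U.
Proof.
apply: hmods_eq => M n v; apply: etrans (scalerA _ _ (v : (M n.+1 : lmodType (H n.+1)))) _.
by rewrite hVx scale1r.
Qed.

Lemma npow_at a (M : C) n (v : (M n.+1 : lmodType (H n.+1))) :
  ncomp (npow (x : hom (U : endcat C) U) a) M n v = xlast n ^+ a *: v.
Proof.
elim: a => [|a IHa]; first by rewrite expr0 scale1r.
rewrite exprS -scalerA -IHa; reflexivity.
Qed.

Lemma psi_taux (M : C) :
  comp (ncomp tau_ M) (comp (fhom U (ncomp x M)) (ncomp tau_ M)) = ncomp x (U M).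
Proof.
apply: dsum_hom_eq => n; apply: linear_fun_eq => v.
set N : lmodType (H n.+2) := M n.+2; set w : N := v.
have -> : (comp (ncomp tau_ M) (comp (fhom U (ncomp x M)) (ncomp tau_ M))) n v =
  - (taui n *: (xlast n.+1 *: (- (taui n *: w)))) by [].
have -> : ncomp x (U M) n v = incl n.+1 (xlast n) *: w by [].
rewrite !scalerN opprK !scalerA -tau_x_tau -!mulrA htK mulr1 mulrA hKt mul1r.
by [].
Qed.

Lemma psi_tautau : comp tau_ tau_ = homD (homZ z tau_) (idm (tens (U : endcat C) U)).
Proof.
apply: hmods_eq => M n v.
set N : lmodType (H n.+2) := M n.+2; set w : N := v.
have -> : ncomp (comp tau_ tau_) M n v = - (taui n *: (- (taui n *: w))) by [].
have -> : ncomp (homD (homZ z tau_) (idm (tens (U : endcat C) U))) M n v =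
  (incl n.+1 (incl n (ralg_scal (H n) z)) *: (- (taui n *: w)) + w : N) by [].
rewrite !hecke_incl_scal !scalerN opprK !scalerA -scaleNr.
suff -> : taui n * taui n = - (ralg_scal (H n.+2) z * taui n) + 1.
  by rewrite scalerDl scale1r.
rewrite /hti; set t := tau n; set Z := ralg_scal _ z.
have -> : (t - Z) * (t - Z) = t * t - t * Z - Z * t + Z * Z by non_commutative_ring.
rewrite htt -(ralg_scalC z t) -/Z; non_commutative_ring.
Qed.

Lemma psi_braid (M : C) :
  comp (ncomp tau_ (U M)) (comp (fhom U (ncomp tau_ M)) (ncomp tau_ (U M))) =
  comp (fhom U (ncomp tau_ M)) (comp (ncomp tau_ (U M)) (fhom U (ncomp tau_ M))).
Proof.
apply: dsum_hom_eq => n; apply: linear_fun_eq => v.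
set N : lmodType (H n.+3) := M n.+3; set w : N := v.
set t := incl n.+2 (taui n); set t' := taui n.+1.
have -> : comp (ncomp tau_ (U M)) (comp (fhom U (ncomp tau_ M)) (ncomp tau_ (U M))) n v =
  - (t *: - (t' *: - (t *: w))) by [].
have -> : comp (fhom U (ncomp tau_ M)) (comp (ncomp tau_ (U M)) (fhom U (ncomp tau_ M))) n v =
  - (t' *: - (t *: - (t' *: w))) by [].
rewrite !scalerN !scalerA; suff -> : t * t' * t = t' * t * t' by [].
set s := incl n.+2 (tau n); set s' := tau n.+1.
have st : s * t = 1 by rewrite -rmorphM htK rmorph1.
have ts : t * s = 1 by rewrite -rmorphM hKt rmorph1.
have st' : s' * t' = 1 by apply: htK.
have ts' : t' * s' = 1 by apply: hKt.
have br : s' * s * s' = s * s' * s := tau_braid z f n.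
have -> : t * t' * t = t * t' * t * (s' * s * s') * (t' * t * t').
  have e : s' * s * s' * (t' * t * t') = 1.
    by rewrite -!mulrA (mulrA s' t') st' mul1r (mulrA s t) st mul1r st'.
  by rewrite -[in RHS]mulrA e mulr1.
have e : t * t' * t * (s * s' * s) = 1.
  by rewrite -!mulrA (mulrA t s) ts mul1r (mulrA t' s') ts' mul1r ts.
by rewrite br e mul1r.
Qed.

Lemma psi_zigzag_up (M : C) : comp (ncomp d (U M)) (fhom U (ncomp c M)) = idm (U M).
Proof.
apply: dsum_hom_eq => n; apply: linear_fun_eq => v.
exact: (scale1r (v : (M n.+1 : lmodType (H n.+1)))).
Qed.

(** The composite sends theta to u |-> (u theta)(1) = theta(1 u). *)
Lemma psi_zigzag_down (M : C) : comp (fhom D (ncomp d M)) (ncomp c (D M)) = idm (D M).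
Proof.
apply: dsum_hom_eq => -[|n]; apply: linear_fun_eq => v.
  (* in degree 0 the coinduced module is zero *)
  by rewrite [LHS]thinmx0 [RHS]thinmx0.
apply: linear_fun_eq => u.
exact: (congr1 (v : {linear res (incl n) (H n.+1)^o -> (M n : lmodType (H n))})
  (mul1r (u : H n.+1))).
Qed.

Section Mackey.

Variable l : nat.
Hypotheses (szf : size f = l.+1) (f_monic : f`_l = 1).
Hypothesis f0_unit : f`_0 \is a GRing.unit.

Local Notation sigma :=
  (sigma_nat (tau_ : hom (tens (U : endcat C) U) (tens (U : endcat C) U)) c d).
Local Notation dx a := (dx_nat (x : hom (U : endcat C) U) d a).
Local Notation A := (fun n => H n).
Local Notation UD := (tens (U : endcat C) D).
Local Notation DU := (tens (D : endcat C) U).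
Local Notation s_of th := (@s_at R A UD DU sigma _ _ th).
Local Notation d_of a th := (@d_at R A UD l (fun a : 'I_l => dx a) a _ _ th).

(** Restriction after coinduction applied to M has the maps from H_{n+1} to M in
degree n. *)
Definition fun_of (M : C) n (th : deg UD M n) (u : H n.+1) :
    (M n : lmodType (H n)) :=
  (th : {linear res (incl n) (H n.+1)^o -> (M n : lmodType (H n))}) u.

Lemma fun_of_hom (M : C) n (th : deg UD M n) : left_hom (fun_of th).
Proof.
split=> [u v|w u]; first exact: raddfD.
exact: (linearZZ (th : {linear res (incl n) (H n.+1)^o -> (M n : lmodType (H n))}) w u).
Qed.

Lemma fun_of_inj (M : C) n (th : deg UD M n) :
  (forall u, fun_of th u = 0) -> th = 0.
Proof. by move=> th0; apply: linear_fun_eq => u; apply: th0. Qed.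

Section OfLeftHom.
Variables (n : nat) (N : lmodType (H n)) (h : H n.+1 -> N) (hh : left_hom h).
Definition left_hom_fun of left_hom h := fun u : res (incl n) (H n.+1)^o => h u.
Lemma left_hom_is_linear : linear (left_hom_fun hh).
Proof.
by case: (hh) => hD hZ a u v; apply: etrans (hD _ _) (congr1 (+%R^~ _) (hZ _ _)).
Qed.
HB.instance Definition _ := GRing.isLinear.Build (H n) (res (incl n) (H n.+1)^o) N *:%R
  (left_hom_fun hh) left_hom_is_linear.
Definition of_left_hom : {linear res (incl n) (H n.+1)^o -> N} := left_hom_fun hh.
End OfLeftHom.

Lemma sigma_fun (M : C) n (th : deg UD M n.+1) (u : H n.+1) :
  (s_of th : {linear res (incl n) (H n.+1)^o -> _}) u =
  - fun_of th (taui n * incl n.+1 u).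
Proof.
rewrite -[taui n in RHS]mul1r; reflexivity.
Qed.

Lemma dx_fun (M : C) n a (th : deg UD M n) :
  ncomp (dx a) M n th = fun_of th (xlast n ^+ a).
Proof.
rewrite dx_nat_at; apply: etrans (congr1 (@coind_counit_fun _ _ (incl n) (M n))
  (npow_at a (M := D M) (th : (D M n.+1 : lmodType (H n.+1))))) _.
by rewrite -[xlast n ^+ a in RHS]mul1r; reflexivity.
Qed.

(** For l = 0 the relation f(x_1) = 0 reads 1 = 0. *)
Lemma hecke_level0 n (u : H n.+1) : l = 0%N -> u = 0.
Proof.
move=> l0; have := hcyc z f (i := ord0 : 'I_n.+1) erefl.
rewrite szf; move: f_monic; rewrite l0 => f1.
by rewrite big_ord_recl big_ord0 f1 rmorph1 mul1r addr0 expr0 => e; rewrite -[u]mulr1 e mulr0.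
Qed.

(** Surjectivity in the Mackey decomposition, with the sign of sigma_+ absorbed
in [phi]. *)
Lemma sigma_bij (M : C) n (g : deg DU M n)
    (m : 'I_l -> (M n : lmodType (H n))) :
  exists th : deg UD M n,
    s_of th = g /\ forall a, d_of a th = m a.
Proof.
have [l0|l_gt0] := posnP l.
  exists 0; split; last by move=> [a lta]; have : False by move: lta; rewrite l0.
  case: n g m => [|n] g m; first by rewrite [LHS]thinmx0 [RHS]thinmx0.
  apply: linear_fun_eq => u; have u0 : u = 0 := hecke_level0 (u : H n.+1) l0.
  by rewrite u0 [LHS]raddf0 [RHS]raddf0.
pose o : 'I_l := Ordinal l_gt0.
case: n g m => [|n] g m.
  have [h hh hx] := mackey_exists0 szf f_monic f0_unit (erefl : o = 0%N :> nat) m.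
  exists (of_left_hom hh); split; first by rewrite [LHS]thinmx0 [RHS]thinmx0.
  by move=> a; rewrite /d_at dx_fun; apply: hx.
pose phi (u : H n.+1) : (M n.+1 : lmodType (H n.+1)) :=
  - (g : {linear res (incl n) (H n.+1)^o -> res (incl n) (M n.+1)}) u.
have hphi : @left_hom _ z f n (res (incl n) (M n.+1)) phi.
  split=> [u v|w u]; rewrite /phi; first by rewrite raddfD opprD.
  have := linearZZ (g : {linear res (incl n) (H n.+1)^o -> res (incl n) (M n.+1)}) w u.
  by move=> e; rewrite [X in - X]e scalerN.
have [h hh [hx ht]] := mackey_existsS szf f_monic f0_unit (erefl : o = 0%N :> nat) m hphi.
exists (of_left_hom hh); split; last by move=> a; rewrite /d_at dx_fun; apply: hx.
apply: linear_fun_eq => u; rewrite sigma_fun.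
by rewrite [fun_of _ _]ht opprK.
Qed.

Lemma sigma_inj (M : C) n (th : deg UD M n) :
  s_of th = 0 -> (forall a, d_of a th = 0) -> th = 0.
Proof.
move=> s0 d0; have [l0|l_gt0] := posnP l.
  apply: fun_of_inj => u; rewrite (hecke_level0 u l0); exact: left_hom0 (fun_of_hom th).
apply: fun_of_inj; apply: (left_hom_inj szf f_monic f0_unit l_gt0 (fun_of_hom th)).
have kx i : (i < l)%N -> fun_of th (xlast n ^+ i) = 0.
  by move=> il; rewrite -dx_fun; apply: (d0 (Ordinal il)).
case: n th s0 d0 kx => [//|n] th s0 d0 kx; split=> // u.
apply/eqP; rewrite -oppr_eq0 -sigma_fun s0; exact/eqP.
Qed.

Definition psi_L := inv_L sigma_bij sigma_inj.
Definition psi_eta := inv_eta sigma_bij sigma_inj.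

(** The transformation [psi_eta p] sends v to the map that is v on x^(l-1) and 0 on
the other generators, and d x^-1 evaluates this map at x^-1. *)
Lemma psi_eta_xi (M : C) n (p : 'I_l) (v : (M n : lmodType (H n))) : p.+1 = l ->
  ncomp d M n (ncomp xi (D M) n (ncomp (psi_eta p) M n v)) =
  - (ralg_scal (H n) (f`_0)^-1 *: v).
Proof.
move=> pl; set th : deg UD M n := ncomp (psi_eta p) M n v.
have -> : ncomp d M n (ncomp xi (D M) n th) = fun_of th (xilast n).
  by rewrite -[xilast n in RHS]mul1r; reflexivity.
have l_gt0 : (0 < l)%N by rewrite -pl.
apply: (left_hom_xi szf f_monic f0_unit (o := Ordinal l_gt0) erefl pl (fun_of_hom th)).
  by move=> a; rewrite -dx_fun; exact: (pinv_d sigma_bij 0 (fun b => if b == p then v else 0) a).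
have sth : s_of th = 0 by exact: (pinv_s sigma_bij 0 (fun b => if b == p then v else 0)).
case: n M v th sth => [//|n] M v th sth u.
by apply/eqP; rewrite -oppr_eq0 -sigma_fun sth; apply/eqP.
Qed.

End Mackey.

End HeckeAction.

(** * The defining relations and the theorem *)

Section CyclotomicAction.

Variables (R : comUnitRingType) (z t : R) (l : nat) (f : {poly R}).
Hypothesis t_unit : t \is a GRing.unit.
Hypotheses (szf : size f = l.+1) (f_monic : f`_l = 1) (f0 : f`_0 = t ^+ 2).

Local Notation k := (Posz l).
Local Notation C := (hmods z f).
Local Notation U := (res_endo z f).
Local Notation D := (coind_endo z f).
Local Notation W := (@obj_word R (endcat C) U D).
Local Notation H n := (hecke z f n).

Lemma f0_unit : f`_0 \is a GRing.unit.
Proof. by rewrite f0 unitrX. Qed.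

Definition psi_gen X Y (g : heis_gen k X Y) : hom (W X) (W Y) :=
  match g in heis_gen _ X0 Y0 return hom (W X0) (W Y0) with
  | Gx => psi_x z f
  | Gxi => psi_xi z f
  | Gtau => psi_tau z f
  | Gc => psi_c z f
  | Gd => psi_d z f
  | GL => psi_L z szf f_monic f0_unit
  | Geta a => psi_eta z szf f_monic f0_unit a
  | Geps a => hom0 (W [:: Down; Up]) (W [::])
  end.

Local Notation ev := (ev psi_gen).
Local Notation sigma :=
  (sigma_nat (psi_tau z f : hom (tens (U : endcat C) U) (tens (U : endcat C) U))
    (psi_c z f) (psi_d z f)).
Local Notation dx a := (dx_nat (psi_x z f : hom (U : endcat C) U) (psi_d z f) a).

Lemma ev_sigma : ev (tsigma R k) = sigma :> hom (tens (U : endcat C) D) (tens (D : endcat C) U).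
Proof. by apply: nattrans_eq => M; apply: (ev_sigma_at psi_gen). Qed.

Lemma ev_dx a : ev (tdx R k a) = dx a :> hom (tens (U : endcat C) D) (sm_unit (endcat C)).
Proof.
apply: nattrans_eq => M; apply: etrans (ev_dx_at psi_gen a M) _.
by rewrite dx_nat_at.
Qed.

Lemma psi_matrix_inverse : matrix_inverse sigma (fun a : 'I_l => dx a)
  (fun a : 'I_0 => ev (txc R k a)) (ev (tL R k)) (fun a => ev (@teta R k a))
  (fun a : 'I_0 => ev (@teps R k a)).
Proof. exact: pointwise_matrix_inverse. Qed.

(** The normalization of d c' is assumed here, as it depends on whether the level
is zero. *)
Lemma psi_rel :
    ((0 < k)%R -> ev (TComp (td R k) (tcp z t^-1 k)) =
      ev (TScale (t^-1 * z^-1) (TId [::]))) ->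
    (k = 0 -> ev (TComp (td R k) (tcp z t^-1 k)) =
      ev (TScale (t^-1 * z^-1 - t^-1^-1 * z^-1) (TId [::]))) ->
  forall X Y (p q : hterm R k X Y), heis_rel z t^-1 p q -> ev p = ev q.
Proof.
move=> rel_pos rel_zero; have [LS SL [Se dL de] [eS Lc ec]] := psi_matrix_inverse.
move=> X Y p q; case=> {X Y p q}.
- exact: psi_xV.
- exact: psi_Vx.
- exact/ev_taux/psi_taux.
- exact: psi_tautau.
- exact/ev_braid/psi_braid.
- exact/ev_zigzag_up/psi_zigzag_up.
- exact/ev_zigzag_down/psi_zigzag_down.
- apply: etrans LS; rewrite -[LHS]/(homD (comp (ev (tL R k)) (ev (tsigma R k))) (ev (tsum _))).
  rewrite ev_sum ev_sigma; congr homD; congr hsum.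
  apply: functional_extensionality_dep => a.
  by rewrite -[LHS]/(comp (ev (teta R a)) (ev (tdx R k a))) ev_dx.
- apply: etrans SL; rewrite -[LHS]/(homD (comp (ev (tsigma R k)) (ev (tL R k))) (ev (tsum _))).
  by rewrite ev_sum ev_sigma.
- move=> a; apply: etrans (Se a).
  by rewrite -[LHS]/(comp (ev (tsigma R k)) (ev (teta R a))) ev_sigma.
- move=> a; apply: etrans (dL a).
  by rewrite -[LHS]/(comp (ev (tdx R k a)) (ev (tL R k))) ev_dx.
- move=> a b; apply: etrans (etrans (de a b) _); last by case: eqP.
  by rewrite -[LHS]/(comp (ev (tdx R k a)) (ev (teta R b))) ev_dx.
- by case.
- by case.
- by case.
- exact: rel_pos.
- exact: rel_zero.
- by [].
Qed.

End CyclotomicAction.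

Section NormalizationRelations.

Variables (R : comUnitRingType) (z t : R) (f : {poly R}).
Hypotheses (t_unit : t \is a GRing.unit) (f0 : f`_0 = t ^+ 2).
Local Notation C := (hmods z f).
Local Notation U := (res_endo z f).
Local Notation D := (coind_endo z f).
Local Notation W := (@obj_word R (endcat C) U D).
Local Notation H n := (hecke z f n).

(** The scalar is (- t z^-1) (- t^-2) = t^-1 z^-1. *)
Lemma psi_rel_pos m (szf : size f = m.+2) (f_monic : f`_m.+1 = 1) :
  let k := Posz m.+1 in
  ev (psi_gen z t_unit szf f_monic f0) (TComp (td R k) (tcp z t^-1 k)) =
  ev (psi_gen z t_unit szf f_monic f0) (TScale (t^-1 * z^-1) (TId [::])).
Proof.
move=> k; set g := psi_gen _ _ _ _ _.
apply: hmods_eq => M n v.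
have -> : ncomp (ev g (TComp (td R k) (tcp z t^-1 k))) M n v =
    ncomp (psi_d z f) M n
      (ralg_scal (H n) (- (t^-1^-1 * z^-1)) *:
        (ncomp (psi_xi z f) (D M) n
          (ncomp (psi_eta z szf f_monic (f0_unit t_unit f0) ord_max) M n v) :
         deg (tens (U : endcat C) D) M n)).
  exact: (congr1 (fun h : dsum_hom M M =>
    (h n : {linear (M n : lmodType (H n)) -> (M n : lmodType (H n))}) v)
    (ev_cap_cup_at g z t^-1 M)).
rewrite linearZZ psi_eta_xi // f0 invrK.
have -> : ncomp (ev g (TScale (t^-1 * z^-1) (TId [::]))) M n v =
  ralg_scal (H n) (t^-1 * z^-1) *: (v : (M n : lmodType (H n))) by [].
rewrite scalerN scalerA -rmorphM -scaleNr -rmorphN; congr (ralg_scal _ _ *: _).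
by rewrite mulNr opprK mulrAC expr2 invrM // mulrA divrr // mul1r.
Qed.

Lemma ev_cap_comp_at (C' : lincat R) (U' D' : endcat C') (k : int)
    (gen : forall X Y, heis_gen k X Y ->
       hom (@obj_word R (endcat C') U' D' X) (@obj_word R (endcat C') U' D' Y))
    (p : hterm R k [::] [:: Up; Down]) (M : C') :
  ncomp (ev gen (TComp (td R k) p)) M =
  comp (ncomp (gen _ _ (Gd _) : hom (tens U' D') (sm_unit (endcat C'))) M)
       (ncomp (ev gen p : hom (sm_unit (endcat C')) (tens U' D')) M) :> hom M M.
Proof. reflexivity. Qed.

Lemma ev_psi_d_comp (k : int)
    (gen : forall X Y, heis_gen k X Y -> hom (W X) (W Y))
    (p : hterm R k [::] [:: Up; Down]) (M : C) n (v : M n : lmodType (H n)) :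
  gen _ _ (Gd _) = psi_d z f ->
  ncomp (ev gen (TComp (td R k) p)) M n v =
  fun_of (ncomp (ev gen p : hom (sm_unit (endcat C)) (tens (U : endcat C) D)) M n v :
    deg (tens (U : endcat C) D) M n) 1.
Proof.
move=> gd.
have e := ev_cap_comp_at gen p M.
move: e; rewrite gd; move: (ncomp _ M) (ncomp _ M) => a b e.
exact: (congr1 (fun h : dsum_hom M M =>
    (h n : {linear (M n : lmodType (H n)) -> (M n : lmodType (H n))}) v) e).
Qed.

(** The left side vanishes since the algebras H_{n+1} do, the right side since
t^2 = f_0 = 1. *)
Lemma psi_rel_zero (szf : size f = 1%N) (f_monic : f`_0 = 1) :
  let k := Posz 0 in
  ev (psi_gen z t_unit szf f_monic f0) (TComp (td R k) (tcp z t^-1 k)) =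
  ev (psi_gen z t_unit szf f_monic f0) (TScale (t^-1 * z^-1 - t^-1^-1 * z^-1) (TId [::])).
Proof.
move=> k; set g := psi_gen _ _ _ _ _.
apply: hmods_eq => M n v.
have tV : t^-1 = t.
  by apply: (mulrI t_unit); rewrite divrr // -expr2 -f0 f_monic.
have c0 : t^-1 * z^-1 - t^-1^-1 * z^-1 = 0 by rewrite invrK tV subrr.
have -> : ncomp (ev g (TScale (t^-1 * z^-1 - t^-1^-1 * z^-1) (TId [::]))) M n v = 0.
  have z0 (c : R) (u : M n : lmodType (H n)) : c = 0 -> ralg_scal (H n) c *: u = 0.
    by move=> ->; rewrite rmorph0 scale0r.
  have -> : ncomp (ev g (TScale (t^-1 * z^-1 - t^-1^-1 * z^-1) (TId [::]))) M n v =
    ralg_scal (H n) (t^-1 * z^-1 - t^-1^-1 * z^-1) *: (v : M n : lmodType (H n)) by [].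
  exact: z0 c0.
have fun_of0 (w : deg (tens (U : endcat C) D) M n) : fun_of w 1 = 0.
  by rewrite (hecke_level0 szf f_monic 1 erefl); apply: left_hom0 (fun_of_hom w).
by rewrite ev_psi_d_comp // fun_of0.
Qed.

End NormalizationRelations.

Theorem theorem6p3 (R : comUnitRingType) (z t : R) (l : nat) (f : {poly R}) :
  z \is a GRing.unit -> t \is a GRing.unit ->
  size f = l.+1 -> f`_l = 1 -> f`_0 = t ^+ 2 ->
  exists! Psi : smfunctor (heis l%:Z z t^-1) (endcat (hmods z f)),
    [/\ Psi heis_up = res_endo z f, Psi heis_down = coind_endo z f &
    [/\ arr (fhom Psi heis_x) = arr (psi_x z f),
        arr (fhom Psi heis_tau) = arr (psi_tau z f),
        arr (fhom Psi heis_c) = arr (psi_c z f) &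
        arr (fhom Psi heis_d) = arr (psi_d z f)]].
Proof.
move=> z_unit t_unit szf f_monic f0.
have rel : forall X Y (p q : hterm R (Posz l) X Y), heis_rel z t^-1 p q ->
    ev (psi_gen z t_unit szf f_monic f0) p = ev (psi_gen z t_unit szf f_monic f0) q.
  apply: psi_rel; case: l szf f_monic => [|m] szf f_monic //.
  - by move=> _; apply: psi_rel_pos.
  - by move=> _; apply: psi_rel_zero.
exists (heis_functor rel); split.
  by split=> //; split; congr arr; exact: (heis_functorE rel (TGen _)).
move=> Psi [eu ed [ex et ec edd]].
have fE X Y (g : heis_gen (Posz l) X Y) := heis_functorE rel (TGen g).
apply: heis_functor_unique.
- by rewrite eu.
- by rewrite ed.
- by rewrite ex; congr arr; exact: (fE _ _ (Gx _)).
- by rewrite et; congr arr; exact: (fE _ _ (Gtau _)).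
- by rewrite ec; congr arr; exact: (fE _ _ (Gc _)).
- by rewrite edd; congr arr; exact: (fE _ _ (Gd _)).
Qed.
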